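(* Let $r\ge1$, $N=2r+2$, let $\lambda=(\lambda_1\ge\dots\ge\lambda_N\ge0)$ be a partition with at most $N$ parts, and let $V_\lambda$ be the irreducible polynomial representation of $GL(N,\mathbb{C})$ of highest weight $\lambda$. Then $$V_\lambda\big|_{O(N,\mathbb{C})}\cong V_\lambda\big|_{O(N,\mathbb{C})}\otimes\det$$ as $O(N,\mathbb{C})$-modules if and only if the numbers $\beta_j=\lambda_j+N-j$ ($1\le j\le N$) all have the same parity, or there is an odd integer $w$ such that $\lambda_i+\lambda_{N+1-i}=w$ for every $1\le i\le N$.
   Context: $\det$ denotes the one-dimensional determinant character of $O(N,\mathbb{C})$. *)

(* Defs.v *)
From HB Require Import structures.
From mathcomp Require Import all_boot all_order all_algebra.
From mathcomp Require Import reals complex mxtens.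
From mathcomp Require mpoly.

Set Implicit Arguments.
Unset Strict Implicit.
Unset Printing Implicit Defensive.

Import Order.TTheory GRing.Theory Num.Theory.
Local Open Scope ring_scope.

Section MatrixRepresentations.

Variables (F : fieldType) (N : nat).

Definition GLmx : {pred 'M[F]_N} := fun g => g \in unitmx.

Definition Omx : {pred 'M[F]_N} := fun g => g *m g^T == 1%:M.

(* A d-dimensional representation is a map into d x d matrices acting on the
   left of column vectors; only its values on the group [G] are relevant, so
   restricting to a subgroup amounts to changing [G]. *)
Definition is_rep (G : {pred 'M[F]_N}) d (rho : 'M[F]_N -> 'M[F]_d) : Prop :=
  rho 1%:M = 1%:M /\ {in G &, {morph rho : g h / g *m h}}.

Definition rep_iso (G : {pred 'M[F]_N}) d1 d2
    (rho1 : 'M[F]_N -> 'M[F]_d1) (rho2 : 'M[F]_N -> 'M[F]_d2) : Prop :=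
  exists (P : 'M[F]_(d2, d1)) (Q : 'M[F]_(d1, d2)),
    [/\ P *m Q = 1%:M, Q *m P = 1%:M
      & {in G, forall g, P *m rho1 g = rho2 g *m P}].

Definition rep_tens d1 d2
    (rho1 : 'M[F]_N -> 'M[F]_d1) (rho2 : 'M[F]_N -> 'M[F]_d2) :
  'M[F]_N -> 'M[F]_(d1 * d2) := fun g => rho1 g *t rho2 g.

Definition det_rep : 'M[F]_N -> 'M[F]_1 := fun g => (\det g)%:M.

Definition irreducible_rep (G : {pred 'M[F]_N}) d
    (rho : 'M[F]_N -> 'M[F]_d) : Prop :=
  (0 < d)%N /\
  forall U : {vspace 'cV[F]_d},
    {in G, forall g, forall v, v \in U -> rho g *m v \in U} ->
    U = 0%VS \/ U = fullv.

(* The N * N polynomial variables stand for the entries of [g], in the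
   order given by [mxvec]. *)
Definition polynomial_rep d (rho : 'M[F]_N -> 'M[F]_d) : Prop :=
  exists p : 'I_d -> 'I_d -> mpoly.mpoly (N * N) F,
    {in GLmx, forall g i j,
      rho g i j = mpoly.meval (fun k => mxvec g 0 k) (p i j)}.

Definition upper_unitriangular : {pred 'M[F]_N} :=
  fun u => [forall i : 'I_N, forall j : 'I_N,
    (j <= i)%N ==> (u i j == (i == j)%:R)].

(* Highest weights are taken with respect to the upper triangular Borel
   subgroup and the diagonal torus. *)
Definition highest_weight_vector d (rho : 'M[F]_N -> 'M[F]_d)
    (lam : 'I_N -> nat) (v : 'cV[F]_d) : Prop :=
  [/\ v != 0,
      {in upper_unitriangular, forall u, rho u *m v = v}
    & forall t : 'rV[F]_N, (forall i, t 0 i != 0) ->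
        rho (diag_mx t) *m v = (\prod_i t 0 i ^+ lam i) *: v].

Definition irr_poly_rep_of_highest_weight (lam : 'I_N -> nat) d
    (rho : 'M[F]_N -> 'M[F]_d) : Prop :=
  [/\ is_rep GLmx rho, polynomial_rep rho, irreducible_rep GLmx rho
    & exists v, highest_weight_vector rho lam v].

End MatrixRepresentations.

Arguments GLmx {F N}.
Arguments Omx {F N}.
Arguments det_rep {F N}.

(* Indices start at 0, so a 1-based index j corresponds to i = j - 1. *)
Definition is_partition N (lam : 'I_N -> nat) : Prop :=
  forall i j : 'I_N, (i <= j)%N -> (lam j <= lam i)%N.

Definition beta N (lam : 'I_N -> nat) (i : 'I_N) : nat :=
  (lam i + (N - i.+1))%N.

(* Main.v *)
Require Import Defs.
From HB Require Import structures.
From mathcomp Require Import all_boot all_order all_algebra all_fingroup.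
From mathcomp Require Import boolp reals complex mxtens.
From mathcomp Require mpoly.
From mathcomp Require Import ring zify.

Set Implicit Arguments.
Unset Strict Implicit.
Unset Printing Implicit Defensive.

Import Order.TTheory GRing.Theory Num.Theory.
Local Open Scope ring_scope.

(** No analysis or integration is used: curves are matrices over [{poly C}], derivatives are
    coefficients at degree 1, and limits are values at 0. This is why the representation is first
    replaced by a map linear in [theta g]: such a map makes sense over every commutative ring and at
    singular matrices.

    In the Weyl formula, the norm condition leaves many candidate exponents. For a strictly
    decreasing exponent [k], specializing the torus to [X ^ k] bounds [<k, k>] by [<k, beta>]. As
    the two norms agree, the equality case of Cauchy-Schwarz gives [k = beta].

    The assumption that [W] commutes with the adjoint comes from an embedding of the representation
    into [theta], which commutes with it by construction. In an orthonormal basis of the image, [W]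
    becomes a compression of [theta]. After that, closure of O(N) under conjugate transpose takes
    the place of a compact form.

    The formula divides by the Vandermonde product, which may vanish at the spectrum of an
    orthogonal element. Statements about characters there are therefore obtained by deforming the
    point or by extending polynomial identities. *)

(* Both sides are tested on traces.  Let [W] be a representation of GL(N) of
   highest weight [lam] and [chi] its character on the diagonal torus.  The Casimir
   operator [\sum_(i, j) dW E_ij * dW E_ji] is central, hence scalar; taking traces
   against torus elements turns this into the statement that [vdm * chi] is an
   eigenfunction of [\sum_i (x_i d/dx_i) ^ 2], so that all its exponents have the
   norm of [beta].  Being alternating, it has to be the alternant of [beta], which is
   the Weyl character formula.

   [V] and [V (x) det] are isomorphic over O(N) iff [tr W] vanishes on the component
   det = -1.  For the converse direction we may assume [W g^* = (W g)^*]; an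
   intertwiner of maximal rank is then invertible, since otherwise a Gaschutz average
   of maps from its kernel to its cokernel would increase the rank.

   An element of O(N) of determinant -1 has eigenvalues 1, -1, and its spectrum is
   closed under inversion.  If all [beta j] have the same parity, the alternant has
   two proportional rows there; in the symmetric case, [chi (x^-1)] and [chi x]
   differ by the factor [det ^ w = -1].  Conversely the alternant at
   (z_1, 1/z_1, ..., z_r, 1/z_r, 1, -1) is nonzero for some [z] in all other cases:
   its coefficient at the power [p - q] of [z_1] is up to sign the alternant of the
   exponents without [p] and [q], when no other pair with the same difference
   contributes, and the ends of the sequence always provide such a pair for which
   induction applies. *)

(** * Matrices of polynomials *)

Section PolyDensity.
Variable C : numFieldType.

Lemma poly_eq0_all (p : {poly C}) : (forall s, p.[s] = 0) -> p = 0.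
Proof.
move=> p0; apply/eqP/negPn/negP => /max_poly_roots.
move=> /(_ [seq n%:R | n <- iota 0 (size p)]); rewrite size_map size_iota ltnn.
move=> H; suff : false by []; apply: H; first by apply/allP=> x _; apply/rootP.
by rewrite map_inj_uniq ?iota_uniq // => m n /eqP; rewrite eqr_nat => /eqP.
Qed.

Lemma poly_eq0_generic (q p : {poly C}) : q != 0 ->
  (forall s, q.[s] != 0 -> p.[s] = 0) -> p = 0.
Proof.
move=> q0 H; have /poly_eq0_all/eqP : forall s, (q * p).[s] = 0.
  move=> s; rewrite hornerM; have [->|/H ->] := eqVneq q.[s] 0; first by rewrite mul0r.
  by rewrite mulr0.
by rewrite mulf_eq0 (negPf q0) => /eqP.
Qed.

Lemma poly_neq0_ex (q : {poly C}) : q != 0 -> exists s, q.[s] != 0.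
Proof.
move=> q0; have [/hasP[x _ qx]|/hasPn H] :=
  boolP (has (fun x => ~~ root q x) [seq n%:R | n <- iota 0 (size q)]).
  by exists x.
have := max_poly_roots (rs := [seq n%:R | n <- iota 0 (size q)]) q0.
rewrite size_map size_iota ltnn => F; suff : false by [].
apply: F; first by apply/allP=> x /H; rewrite negbK.
by rewrite map_inj_uniq ?iota_uniq // => m n /eqP; rewrite eqr_nat => /eqP.
Qed.

End PolyDensity.

Section EvalMx.
Variable C : comNzRingType.

Definition evalmx m n (s : C) (G : 'M[{poly C}]_(m, n)) : 'M[C]_(m, n) :=
  map_mx (horner_eval s) G.

Definition coefmx m n k (G : 'M[{poly C}]_(m, n)) : 'M[C]_(m, n) :=
  map_mx (coefp k) G.

Definition cstmx m n (g : 'M[C]_(m, n)) : 'M[{poly C}]_(m, n) := map_mx polyC g.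

Lemma evalmxM m n p s (G : 'M_(m, n)) (H : 'M_(n, p)) :
  evalmx s (G *m H) = evalmx s G *m evalmx s H.
Proof. exact: map_mxM. Qed.

Lemma evalmxD m n s (G H : 'M_(m, n)) : evalmx s (G + H) = evalmx s G + evalmx s H.
Proof. exact: map_mxD. Qed.

Lemma evalmx1 n s : evalmx s (1%:M : 'M_n) = 1%:M.
Proof. exact: map_mx1. Qed.

Lemma evalmxZX m n s (g : 'M_(m, n)) : evalmx s ('X *: cstmx g) = s *: g.
Proof. by apply/matrixP=> i j; rewrite !mxE /horner_eval hornerM hornerX hornerC. Qed.

Lemma evalmx_cst m n s (g : 'M_(m, n)) : evalmx s (cstmx g) = g.
Proof. by apply/matrixP=> i j; rewrite !mxE /horner_eval hornerC. Qed.

Lemma coef0mx_eval m n (G : 'M_(m, n)) : coefmx 0 G = evalmx 0 G.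
Proof. by apply/matrixP=> i j; rewrite !mxE /horner_eval horner_coef0. Qed.

Lemma coef1mxM m n p (G : 'M_(m, n)) (H : 'M_(n, p)) :
  coefmx 1 (G *m H) = coefmx 1 G *m coefmx 0 H + coefmx 0 G *m coefmx 1 H.
Proof.
apply/matrixP=> i j; rewrite !mxE /= coef_sum -big_split /=; apply: eq_bigr => k _.
by rewrite !mxE coefM !big_ord_recl big_ord0 /= addr0 addrC.
Qed.

Lemma coef0mx_cst m n (g : 'M_(m, n)) : coefmx 0 (cstmx g) = g.
Proof. by apply/matrixP=> i j; rewrite !mxE /= coefC. Qed.

Lemma coef1mx_cst m n (g : 'M_(m, n)) : coefmx 1 (cstmx g) = 0.
Proof. by apply/matrixP=> i j; rewrite !mxE /= coefC. Qed.

End EvalMx.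

(** Carries every density argument below: an identity checked at generic values of the variable also
    holds at the excluded values and coefficient by coefficient. *)
Lemma evalmx_ext (C : numFieldType) m n (q : {poly C}) (P Q : 'M[{poly C}]_(m, n)) :
  q != 0 -> (forall s, q.[s] != 0 -> evalmx s P = evalmx s Q) -> P = Q.
Proof.
move=> q0 H; apply/matrixP=> i j; apply/eqP; rewrite -subr_eq0; apply/eqP.
apply: poly_eq0_generic q0 _ => s /H /matrixP/(_ i j).
by rewrite !mxE /horner_eval hornerD hornerN => ->; rewrite subrr.
Qed.

(** * Polynomial representations *)

Section Theta.
Variables (N K : nat).

Definition tensidx := {ffun 'I_K -> option 'I_N}.

Definition tidx (a : 'I_#|tensidx|) : tensidx := enum_val a.

Lemma tidx_inj : injective tidx.
Proof. exact: enum_val_inj. Qed.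

Section Ring.
Variable A : comNzRingType.

Definition mx1plus (g : 'M[A]_N) (a b : option 'I_N) : A :=
  match a, b with
  | None, None => 1
  | Some i, Some j => g i j
  | _, _ => 0
  end.

(* The [K]-th tensor power of [1 (+) g]: its entries are the monomials of degree at
   most [K] in the entries of [g], so polynomial maps are linear in [theta g]. *)
Definition theta (g : 'M[A]_N) : 'M[A]_#|tensidx| :=
  \matrix_(a, b) \prod_k mx1plus g (tidx a k) (tidx b k).

Lemma big_option (F : option 'I_N -> A) :
  \sum_o F o = F None + \sum_i F (Some i).
Proof.
rewrite (bigD1 None) //=; congr (_ + _).
rewrite (reindex_omap Some id) /=; last by case.
by apply: eq_bigl => i; rewrite eqxx.
Qed.

Lemma mx1plusM (g h : 'M[A]_N) a b :
  mx1plus (g *m h) a b = \sum_o mx1plus g a o * mx1plus h o b.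
Proof.
rewrite big_option; case: a b => [i|] [j|] /=; rewrite ?mul0r ?mulr0 ?mul1r ?add0r.
- by rewrite !mxE.
- by rewrite big1 // => k _; rewrite mulr0.
- by rewrite big1 // => k _; rewrite mul0r.
- by rewrite big1 ?addr0 // => k _; rewrite mulr0.
Qed.

Lemma thetaM (g h : 'M[A]_N) : theta (g *m h) = theta g *m theta h.
Proof.
apply/matrixP=> a b; rewrite !mxE.
under eq_bigr do rewrite mx1plusM.
rewrite bigA_distr_bigA /= (reindex tidx) /=; last first.
  by apply: onW_bij; exact: enum_val_bij.
by apply: eq_bigr => c _; rewrite !mxE big_split.
Qed.

Lemma theta_diag (x : 'rV[A]_N) : theta (diag_mx x) =
  diag_mx (\row_a \prod_i x 0 i ^+ #|[set k | tidx a k == Some i]|).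
Proof.
apply/matrixP=> a b; rewrite !mxE.
have [<-|neq] := eqVneq a b.
  rewrite mulr1n; set f := tidx a.
  transitivity (\prod_k if f k is Some i then x 0 i else 1).
    by apply: eq_bigr => k _; case: (f k) => [i|] //=; rewrite !mxE eqxx mulr1n.
  under [RHS]eq_bigr do rewrite -prodr_const big_mkcond /=.
  rewrite exchange_big /=; apply: eq_bigr => k _.
  under eq_bigr do rewrite inE.
  case: (f k) => [i|]; last by rewrite big1.
  rewrite (bigD1 i) //= eqxx big1 ?mulr1 // => j ji.
  by case: eqP => // -[ij]; rewrite ij eqxx in ji.
rewrite mulr0n.
have [k nk] : exists k, tidx a k != tidx b k.
  apply/existsP; rewrite -negb_forall; apply: contraNN neq => /forallP H.
  by apply/eqP/tidx_inj/ffunP=> k; apply/eqP.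
rewrite (bigD1 k) //=; case: (_ k) (_ k) nk => [i|] [j|] //= nk; rewrite ?mul0r //.
by rewrite !mxE; have [ij|_] := eqVneq i j; [rewrite ij eqxx in nk|rewrite mulr0n mul0r].
Qed.

End Ring.

Lemma theta_map (A B : comNzRingType) (f : {rmorphism A -> B}) (g : 'M[A]_N) :
  map_mx f (theta g) = theta (map_mx f g).
Proof.
apply/matrixP=> a b; rewrite !mxE rmorph_prod; apply: eq_bigr => k _.
by case: (_ k) (_ k) => [i|] [j|] /=; rewrite ?mxE ?rmorph1 ?rmorph0.
Qed.

Lemma theta_tr (A : comNzRingType) (g : 'M[A]_N) : (theta g)^T = theta g^T.
Proof.
apply/matrixP=> a b; rewrite !mxE; apply: eq_bigr => k _.
by case: (_ k) (_ k) => [i|] [j|] //=; rewrite mxE.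
Qed.

Section Derivative.
Variable C : comNzRingType.

(** The derivative of [mx1plus] at the identity; the constant entry at [None], [None] disappears. *)
Definition mx0plus (g : 'M[C]_N) (a b : option 'I_N) : C :=
  if a is Some i then if b is Some j then g i j else 0 else 0.

(* The coefficient of [s] in [theta (1 + s g)]. *)
Definition dtheta (g : 'M[C]_N) : 'M[C]_#|tensidx| :=
  \matrix_(a, b) \sum_k mx0plus g (tidx a k) (tidx b k) *
     \prod_(l | l != k) (tidx a l == tidx b l)%:R.

(** Leibniz rule at 0, with values and derivatives read off as coefficients. *)
Lemma coef1_prod (I : finType) (F : I -> {poly C}) :
  (\prod_i F i)`_1 = \sum_k (F k)`_1 * \prod_(l | l != k) (F l)`_0.
Proof.
have c0 (r : seq I) (P : pred I) : (\prod_(i <- r | P i) F i)`_0 = \prod_(i <- r | P i) (F i)`_0.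
  by elim/big_rec2: _ => [|i x y _ <-]; rewrite ?coef1 // coef0M.
suff H (r : seq I) : uniq r -> (\prod_(i <- r) F i)`_1 =
    \sum_(k <- r) (F k)`_1 * \prod_(l <- r | l != k) (F l)`_0.
  exact: (H _ (index_enum_uniq I)).
elim: r => [|i r IH] /=; first by rewrite !big_nil coef1.
case/andP=> nir ur; rewrite !big_cons eqxx /= coefM !big_ord_recl big_ord0 /= addr0.
rewrite c0 IH // addrC; congr (_ + _).
  congr (_ * _); rewrite [RHS]big_seq_cond [LHS]big_seq_cond; apply: eq_bigl => l.
  by case lr: (l \in r) => //=; symmetry; apply: contraNneq nir => <-.
rewrite big_distrr big_seq [RHS]big_seq /=; apply: eq_bigr => k kr.
rewrite big_cons; case: eqP => [ik|_]; first by rewrite ik kr in nir.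
by rewrite mulrCA.
Qed.

Lemma coef1_theta (G : 'M[{poly C}]_N) : coefmx 0 G = 1%:M ->
  coefmx 1 (theta G) = dtheta (coefmx 1 G).
Proof.
move=> G0; apply/matrixP=> a b; rewrite !mxE /= coef1_prod; apply: eq_bigr => k _.
congr (_ * _); first by case: (_ k) (_ k) => [i|] [j|] //=; rewrite ?mxE ?coef1 ?coef0.
apply: eq_bigr => l _; case: (_ l) (_ l) => [i|] [j|] //=; rewrite ?coef1 ?coef0 //.
by move/matrixP: G0 => /(_ j i); rewrite !mxE /= => ->.
Qed.

Lemma dtheta_linear a (g h : 'M[C]_N) : dtheta (a *: g + h) = a *: dtheta g + dtheta h.
Proof.
apply/matrixP=> i j; rewrite !mxE big_distrr -big_split /=; apply: eq_bigr => k _.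
rewrite mulrA -mulrDl; congr (_ * _).
by case: (_ k) (_ k) => [u|] [v|] /=; rewrite ?mxE ?mulr0 ?addr0.
Qed.

End Derivative.
End Theta.

Section PolynomialTheta.
Variables (C : comNzRingType) (N : nat).

Definition mxvec_pair (k : 'I_(N * N)) : 'I_N * 'I_N := mxvec_indexP k.

Lemma mxvec_pairE (A : 'M[C]_N) k : mxvec A 0 k = A (mxvec_pair k).1 (mxvec_pair k).2.
Proof. by rewrite /mxvec_pair; case: mxvec_indexP => i j; rewrite mxvecE. Qed.

Lemma prod_pairs_theta K (s : seq ('I_N * 'I_N)) : (size s <= K)%N ->
  exists a b, forall g : 'M[C]_N, \prod_(q <- s) g q.1 q.2 = theta K g a b.
Proof.
(* Slots past the end of [s] default to [None] and contribute the factor 1, so shorter monomials fit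
   into [K] slots. *)
move=> sK; pose o (k : 'I_K) := nth None (map Some s) k.
pose f : tensidx N K := [ffun k => omap fst (o k)].
pose h : tensidx N K := [ffun k => omap snd (o k)].
exists (enum_rank f), (enum_rank h) => g; rewrite mxE /tidx !enum_rankK.
pose F := fun q => if q is Some q then g q.1 q.2 else 1 : C.
transitivity (\prod_(k < K) F (o k)); last first.
  by apply: eq_bigr => k _; rewrite !ffunE /F /=; case: (o k).
rewrite -(big_mkord predT (fun k => F (nth None (map Some s) k))) /=.
rewrite (big_cat_nat (n := size s)) //= [X in _ * X]big_nat_cond [X in _ * X]big1 => [|k]; last first.
  by rewrite andbT => /andP[ks _]; rewrite nth_default ?size_map.
rewrite mulr1; transitivity (\prod_(q <- map Some s) F q); first by rewrite big_map.
by rewrite (big_nth None) size_map.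
Qed.

Lemma monomial_theta K (m : 'I_(N * N) -> nat) : (\sum_k m k <= K)%N ->
  exists a b, forall g : 'M[C]_N, \prod_k mxvec g 0 k ^+ m k = theta K g a b.
Proof.
move=> mK; pose s := flatten [seq nseq (m k) (mxvec_pair k) | k <- index_enum 'I_(N * N)].
have /prod_pairs_theta[a [b H]] : (size s <= K)%N.
  rewrite /s size_flatten /shape -map_comp sumnE big_map.
  by under eq_bigr do rewrite /= size_nseq.
exists a, b => g; rewrite -H /s big_flatten big_map; apply: eq_bigr => k _.
by rewrite mxvec_pairE big_nseq -Monoid.iteropE; elim: (m k) => [|n IH] //=; rewrite ?exprS IH.
Qed.

Lemma mpoly_theta K (p : mpoly.mpoly (N * N) C) :
  (\max_(m <- mpoly.msupp p) \sum_k mpoly.fun_of_multinom m k <= K)%N ->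
  exists c : 'M[C]_#|tensidx N K|, forall g : 'M[C]_N,
    mpoly.meval (fun k => mxvec g 0 k) p = \sum_a \sum_b c a b * theta K g a b.
Proof.
move=> pK.
suff [c H] : exists c : 'M[C]_#|tensidx N K|, forall g : 'M[C]_N,
    \sum_(m <- mpoly.msupp p) mpoly.mcoeff m p * \prod_k mxvec g 0 k ^+ mpoly.fun_of_multinom m k =
    \sum_a \sum_b c a b * theta K g a b.
  by exists c => g; rewrite -H mpoly.mevalE.
elim: (mpoly.msupp p) pK => [|m s IH].
  move=> _.
  exists 0 => g; rewrite big_nil big1 // => a _; rewrite big1 // => b _.
  by rewrite mxE mul0r.
rewrite big_cons geq_max => /andP[/monomial_theta[a [b Hab]] /IH[c Hc]].
exists (mpoly.mcoeff m p *: delta_mx a b + c) => g.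
rewrite big_cons Hc Hab.
rewrite -[X in X + _](_ : \sum_a' \sum_b'
    (mpoly.mcoeff m p *: delta_mx a b) a' b' * theta K g a' b' = _).
  rewrite -big_split; apply: eq_bigr => a' _; rewrite -big_split.
  by apply: eq_bigr => b' _; rewrite !mxE mulrDl.
rewrite (bigD1 a) //= (bigD1 b) //= [X in X * _]mxE [X in _ * X * _]mxE !eqxx mulr1.
rewrite big1 => [|b' ne]; last by rewrite !mxE (negPf ne) andbF mulr0 mul0r.
rewrite big1 ?addr0 // => a' ne.
by rewrite big1 // => b' _; rewrite !mxE (negPf ne) mulr0 mul0r.
Qed.

End PolynomialTheta.

Section LinMap.
Variables (A : comNzRingType) (n d : nat) (c : 'I_d -> 'I_d -> 'M[A]_n).

Definition linmap (M : 'M[A]_n) : 'M[A]_d :=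
  \matrix_(i, j) \sum_a \sum_b c i j a b * M a b.

Fact linmap_is_linear : linear linmap.
Proof.
move=> k M M'; apply/matrixP=> i j; rewrite !mxE big_distrr -big_split /=.
apply: eq_bigr => a _; rewrite big_distrr -big_split /=.
by apply: eq_bigr => b _; rewrite !mxE; ring.
Qed.

HB.instance Definition _ := GRing.isLinear.Build A 'M[A]_n 'M[A]_d _ linmap linmap_is_linear.

End LinMap.

Lemma coef0mx_line (C : comNzRingType) n (A : 'M[C]_n) :
  coefmx 0 (1%:M + 'X *: cstmx A) = 1%:M.
Proof. by rewrite coef0mx_eval evalmxD evalmx1 evalmxZX scale0r addr0. Qed.

Lemma coef1mx_line (C : comNzRingType) n (A : 'M[C]_n) :
  coefmx 1 (1%:M + 'X *: cstmx A) = A.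
Proof.
apply/matrixP=> i j; rewrite !mxE /= coefD mulrC coefMX /= coefC.
by case: (i == j); rewrite ?coef1 ?coef0 add0r.
Qed.

Section PolyMap.
Variables (C : numFieldType) (N K d : nat).
Variable c : 'I_d -> 'I_d -> 'M[C]_#|tensidx N K|.

Definition polymap (g : 'M[C]_N) : 'M[C]_d := linmap c (theta K g).

Definition polymapX (G : 'M[{poly C}]_N) : 'M[{poly C}]_d :=
  linmap (fun i j => cstmx (c i j)) (theta K G).

(** The differential of [polymap] at the identity: the Lie algebra representation once [polymap] is
    multiplicative. *)
Definition dpolymap (g : 'M[C]_N) : 'M[C]_d := linmap c (dtheta K g).

Fact dpolymap_is_linear : linear dpolymap.
Proof. by move=> a g h; rewrite /dpolymap dtheta_linear linearP. Qed.

HB.instance Definition _ :=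
  GRing.isLinear.Build C 'M[C]_N 'M[C]_d _ dpolymap dpolymap_is_linear.

Lemma evalmx_polymapX s G : evalmx s (polymapX G) = polymap (evalmx s G).
Proof.
apply/matrixP=> i j; rewrite !mxE rmorph_sum; apply: eq_bigr => a _.
rewrite rmorph_sum; apply: eq_bigr => b _; rewrite rmorphM /=.
by rewrite /evalmx -theta_map !mxE [X in X * _]hornerC.
Qed.

Lemma coef0mx_polymapX G : coefmx 0 (polymapX G) = polymap (coefmx 0 G).
Proof. by rewrite !coef0mx_eval evalmx_polymapX. Qed.

Lemma coef1mx_polymapX G : coefmx 0 G = 1%:M ->
  coefmx 1 (polymapX G) = dpolymap (coefmx 1 G).
Proof.
move=> G0; rewrite /dpolymap -coef1_theta //; apply/matrixP=> i j; rewrite !mxE /=.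
rewrite coef_sum; apply: eq_bigr => a _; rewrite coef_sum; apply: eq_bigr => b _.
by rewrite !mxE coefCM.
Qed.

Lemma coef1mx_polymapX_line A :
  coefmx 1 (polymapX (1%:M + 'X *: cstmx A)) = dpolymap A.
Proof. by rewrite coef1mx_polymapX ?coef0mx_line // coef1mx_line. Qed.

Lemma polymapX_cst g : polymapX (cstmx g) = cstmx (polymap g).
Proof.
rewrite /polymapX /cstmx -theta_map; apply/matrixP=> i j; rewrite !mxE rmorph_sum.
apply: eq_bigr => a _; rewrite rmorph_sum; apply: eq_bigr => b _.
by rewrite !mxE rmorphM.
Qed.

Lemma polymap_diag (x : 'rV[C]_N) : polymap (diag_mx x) =
  \sum_a (\prod_i x 0 i ^+ #|[set k | tidx a k == Some i]|) *: linmap c (delta_mx a a).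
Proof.
rewrite /polymap theta_diag [in LHS]diag_mx_sum_delta linear_sum /=.
by apply: eq_bigr => a _; rewrite linearZ mxE.
Qed.

End PolyMap.

Section Shift.
Variables (C : numFieldType) (N : nat).
Implicit Type g : 'M[C]_N.

Lemma evalmx_shift s g : evalmx s ('X%:M + cstmx g) = s%:M + g.
Proof. by rewrite evalmxD evalmx_cst /evalmx map_scalar_mx /= /horner_eval hornerX. Qed.

Lemma det_shift g : \det ('X%:M + cstmx g) != 0.
Proof.
have -> : 'X%:M + cstmx g = char_poly_mx (- g).
  by rewrite /char_poly_mx /cstmx raddfN /= opprK.
exact: monic_neq0 (char_poly_monic _).
Qed.

Lemma shift_unit s g : (\det ('X%:M + cstmx g)).[s] != 0 -> s%:M + g \in unitmx.
Proof. by rewrite -evalmx_shift unitmxE unitfE /evalmx det_map_mx. Qed.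

End Shift.

Section PolyRep.
Variables (C : numFieldType) (N K d : nat).
Variable c : 'I_d -> 'I_d -> 'M[C]_#|tensidx N K|.

Local Notation W := (polymap c).
Local Notation WX := (polymapX c).
Local Notation dW := (dpolymap c).

Hypothesis W1 : W 1%:M = 1%:M.
Hypothesis WM_unit :
  forall g h, g \in unitmx -> h \in unitmx -> W (g *m h) = W g *m W h.

(* Multiplicativity on invertible matrices extends to all matrices, since [s + g] is
   invertible for generic [s]. *)
Lemma polymapM g h : W (g *m h) = W g *m W h.
Proof.
pose shift (g : 'M[C]_N) := 'X%:M + cstmx g.
have /(congr1 (evalmx 0)) : WX (shift g *m shift h) = WX (shift g) *m WX (shift h).
  apply: (@evalmx_ext _ _ _ (\det (shift g) * \det (shift h))).
    by rewrite mulf_neq0 ?det_shift.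
  move=> s; rewrite hornerM mulf_eq0 negb_or => /andP[/shift_unit gs /shift_unit hs].
  by rewrite evalmxM !evalmx_polymapX evalmxM !evalmx_shift WM_unit.
by rewrite evalmxM !evalmx_polymapX evalmxM !evalmx_shift raddf0 !add0r.
Qed.

Lemma polymapXM G H : WX (G *m H) = WX G *m WX H.
Proof.
apply: (@evalmx_ext _ _ _ 1); first exact: oner_neq0.
by move=> s _; rewrite evalmxM !evalmx_polymapX evalmxM polymapM.
Qed.

(** Compare the coefficients of [X] in the image of [g (1 + X A) h]. As [g h = 1], this curve starts
    at the identity, where the differential is taken. *)
Lemma dpolymap_conj g h A : g *m h = 1%:M -> W g *m dW A *m W h = dW (g *m A *m h).
Proof.
move=> gh; pose G := cstmx g *m (1%:M + 'X *: cstmx A) *m cstmx h.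
have c0X := coef0mx_line A; have c1X := coef1mx_line A.
have G0 : coefmx 0 G = 1%:M.
  by rewrite coef0mx_eval !evalmxM -!coef0mx_eval c0X !coef0mx_cst mulmx1.
have := coef1mx_polymapX c G0; rewrite /G !polymapXM !polymapX_cst.
rewrite !coef1mxM !coef1mx_cst !mulmx0 !mul0mx !addr0 !add0r !coef0mx_cst.
by rewrite (coef1mx_polymapX c c0X) c1X.
Qed.

(** Since [A] squares to 0, the inverse of [1 + s A] is [1 - s A], so conjugating [B] by this curve
    is polynomial in [s], with linear coefficient the bracket. *)
Lemma dpolymap_bracket A B : A *m A = 0 ->
  dW A *m dW B - dW B *m dW A = dW (A *m B - B *m A).
Proof.
move=> AA; pose E := 1%:M + 'X *: cstmx A.
have c0X : coefmx 0 E = 1%:M := coef0mx_line A.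
have c1X : coefmx 1 E = A := coef1mx_line A.
(* The identity [(1 + s A) B (1 - s A) = B + s (A B - B A) - s^2 A B A] under [dW], with the inverse
   moved to the other side. *)
have H : WX E *m cstmx (dW B) = (cstmx (dW B) + 'X *: cstmx (dW (A *m B - B *m A))
    - 'X^2 *: cstmx (dW (A *m B *m A))) *m WX E.
  apply: (@evalmx_ext _ _ _ 1); first exact: oner_neq0.
  move=> s _; rewrite !evalmxM evalmx_cst !evalmx_polymapX.
  have -> : evalmx s E = 1%:M + s *: A by rewrite evalmxD evalmx1 evalmxZX.
  rewrite !evalmxD.
  rewrite !evalmxZX evalmx_cst [evalmx s (- _)](_ : _ = - (s ^+ 2 *: dW (A *m B *m A))); last first.
    by apply/matrixP=> i j; rewrite !mxE /horner_eval hornerN hornerM hornerXn hornerC.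
  have inv : (1%:M - s *: A) *m (1%:M + s *: A) = 1%:M.
    rewrite mulmxBl mul1mx mulmxDr mulmx1 -scalemxAl -scalemxAr AA !scaler0 addr0.
    by rewrite addrK.
  have Winv : W (1%:M - s *: A) *m W (1%:M + s *: A) = 1%:M by rewrite -polymapM inv.
  rewrite -[LHS]mulmx1 -Winv mulmxA dpolymap_conj ?(mulmx1C inv) //.
  congr (_ *m _); rewrite -!linearZ -linearD -linearB /=; congr (dW _).
  rewrite mulmxDl mul1mx mulmxBr mulmx1 mulmxDl -!scalemxAl -!scalemxAr -?scalemxAl.
  rewrite !scalerA -expr2 scalerBr opprD !addrA; congr (_ - _).
move/(congr1 (coefmx 1)): H; rewrite !coef1mxM coef1mx_cst coef0mx_cst mulmx0 addr0.
rewrite !coef0mx_polymapX c0X W1 mulmx1 !(coef1mx_polymapX c c0X) c1X => ->.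
rewrite [coefmx 1 (_ + _)](_ : _ = dW (A *m B - B *m A)); last first.
  apply/matrixP=> i j; rewrite !mxE /= !coefB coefD coefC coefXM /= coefXnM /= add0r subr0.
  by rewrite coefC ?mxE.
rewrite [coefmx 0 (_ + _)](_ : _ = dW B) ?addrK //.
by apply/matrixP=> i j; rewrite !mxE /= !coefB coefD coefXM coefXnM /= subr0 addr0 coefC.
Qed.

End PolyRep.

Lemma digits_inj n B (e f : 'I_n -> nat) :
  (forall i, e i < B)%N -> (forall i, f i < B)%N ->
  (\sum_i e i * B ^ i = \sum_i f i * B ^ i)%N -> e =1 f.
Proof.
elim: n e f => [|n IH] e f eB fB; first by move=> _ [].
have step (g : 'I_n.+1 -> nat) : (\sum_i g i * B ^ i =
    g ord0 + (\sum_(i < n) g (lift ord0 i) * B ^ i) * B)%N.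
  rewrite big_ord_recl expn0 muln1 big_distrl /=; congr (_ + _)%N.
  by apply: eq_bigr => i _; rewrite /bump /= add1n expnSr mulnA.
rewrite !step => H.
have B0 : (0 < B)%N by apply: leq_ltn_trans (eB ord0).
have e0 : e ord0 = f ord0.
  by have := congr1 (modn^~ B) H; rewrite ![(_ ord0 + _)%N]addnC !modnMDl !modn_small // !eB.
move: H; rewrite e0 => /addnI/eqP; rewrite eqn_pmul2r // => /eqP /IH IHe i.
by have [j ->|->] := unliftP ord0 i; [apply: IHe => k|].
Qed.

Section Monomials.
Variables (C : numFieldType) (N : nat).
Implicit Types (x : 'rV[C]_N) (e : 'I_N -> nat).

Definition monom (A : comNzRingType) (x : 'rV[A]_N) e : A := \prod_i x 0 i ^+ e i.

Definition generic x := (forall i, x 0 i != 0) /\ (forall i j, i != j -> x 0 i != x 0 j).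

(* Kronecker's substitution [x i := s ^ (B ^ i)] separates the monomials. *)
Lemma monom_indep (I : finType) (c : I -> C) (e : I -> 'I_N -> nat) :
  (forall x, generic x -> \sum_a c a * monom x (e a) = 0) ->
  forall k : 'I_N -> nat, \sum_(a | [forall i, e a i == k i]) c a = 0.
Proof.
(* Larger than every exponent, so that base [B] digits are unique, and at least 2, so that the
   powers of [B] are distinct. *)
move=> H k; pose B := (\sum_a \sum_i e a i + \sum_i k i).+2.
have eB a i : (e a i < B)%N.
  rewrite ltnS (leq_trans _ (leqnSn _)) // (leq_trans _ (leq_addr _ _)) //.
  by rewrite (bigD1 a) //= (bigD1 i) //= -addnA leq_addr.
have kB i : (k i < B)%N.
  rewrite ltnS (leq_trans _ (leqnSn _)) // (leq_trans _ (leq_addl _ _)) //.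
  by rewrite (bigD1 i) //= leq_addr.
pose code (f : 'I_N -> nat) := (\sum_i f i * B ^ i)%N.
pose p := \sum_a c a *: 'X^(code (e a)).
(* Where [q] does not vanish the substituted point is generic: the factor ['X] keeps its entries
   nonzero, the others keep them distinct. *)
pose q : {poly C} := 'X * \prod_(i < N) \prod_(j < N | j != i) ('X^(B ^ i) - 'X^(B ^ j)).
have q0 : q != 0.
  rewrite mulf_neq0 ?polyX_eq0 //; apply/prodf_neq0 => i _; apply/prodf_neq0 => j ji.
  rewrite subr_eq0; apply/eqP => /(congr1 (fun p : {poly C} => size p)).
  rewrite !size_polyXn => /eqP; rewrite eqSS eqn_exp2l // => /eqP ij.
  by case/eqP: ji; exact: val_inj.
have p0 : p = 0.
  apply: poly_eq0_generic q0 _ => s; rewrite hornerM mulf_eq0 negb_or hornerX.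
  case/andP=> s0; rewrite horner_prod => /prodf_neq0 Hs.
  transitivity (\sum_a c a * monom (\row_i s ^+ (B ^ i)) (e a)); last first.
    apply: H.
    split=> [i|i j ij]; rewrite !mxE ?expf_neq0 // -subr_eq0.
    have := Hs i isT; rewrite horner_prod => Hi; move/prodf_neq0: Hi => /(_ j).
    by rewrite eq_sym hornerD hornerN !hornerXn; apply.
  rewrite /p horner_sum; apply: eq_bigr => a _.
  rewrite hornerZ hornerXn -prodrXr; congr (_ * _).
  by apply: eq_bigr => i _; rewrite mxE -exprM mulnC.
transitivity p`_(code k); last by rewrite p0 coef0.
rewrite /p coef_sum big_mkcond /=; apply: eq_bigr => a _; rewrite coefZ coefXn.
have [/forallP He|/forallP nHe] := boolP [forall i, e a i == k i].
  rewrite (_ : code k = code (e a)) ?eqxx ?mulr1 //.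
  by apply: eq_bigr => i _; rewrite (eqP (He i)).
case: eqP => [ck|_]; last by rewrite mulr0.
by case: nHe => i; apply/eqP; symmetry; apply: (digits_inj kB (eB a) ck).
Qed.

End Monomials.

(** A subspace of maximal dimension inside [S] exhausts it, since adding the line of another vector
    of [S] stays inside. Invariant subspaces can thus be handled as predicates. *)
Lemma vspace_of_prop (F : fieldType) (V : vectType F) (S : V -> Prop) :
  S 0 -> (forall a u v, S u -> S v -> S (a *: u + v)) ->
  exists U : {vspace V}, forall w, w \in U <-> S w.
Proof.
move=> S0 SD; pose P n := `[< exists U : {vspace V}, \dim U = n /\ forall w, w \in U -> S w >].
have exP : exists n, P n.
  exists 0%N; apply/asboolP; exists 0%VS; rewrite dimv0; split=> // w.
  by rewrite memv0 => /eqP ->.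
have ubP n : P n -> (n <= \dim {:V})%N.
  by move=> /asboolP[U [<- _]]; exact: dimvS (subvf U).
case: (ex_maxnP exP ubP) => n /asboolP[U [dU SU]] max.
exists U => w; split=> [|Sw]; first exact: SU.
have : P (\dim (U + <[w]>)%VS).
  apply/asboolP; exists (U + <[w]>)%VS; split=> // _ /memv_addP[u Uu [_ /vlineP[k ->] ->]].
  by rewrite addrC; apply: SD => //; exact: SU.
move/max; rewrite -dU => le.
have := dimv_leqif_sup (addvSl U <[w]>); case=> _.
have -> : \dim U = \dim (U + <[w]>)%VS by apply/eqP; rewrite eqn_leq le dimvS ?addvSl.
by rewrite eqxx => /esym; rewrite subv_add => /andP[_]; rewrite -memvE.
Qed.

(** * Triangular factorizations of generic matrices *)

Definition upper_uni (A : pzSemiRingType) n (u : 'M[A]_n) : Prop :=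
  forall i j : 'I_n, (j <= i)%N -> u i j = (i == j)%:R.

Definition lower_uni (A : pzSemiRingType) n (u : 'M[A]_n) : Prop :=
  forall i j : 'I_n, (i <= j)%N -> u i j = (i == j)%:R.

Section Triangular.
Variable C : numFieldType.

Lemma upper_uni_block n (b : 'M[C]_(1, n)) (u : 'M[C]_n) :
  upper_uni u -> upper_uni (block_mx 1%:M b 0 u : 'M_(1 + n)).
Proof.
move=> Hu i j ji; rewrite -val_eqE /=; rewrite !mxE.
case: splitP => i' ei; rewrite !mxE; case: splitP => j' ej; rewrite ?mxE.
- by rewrite ei ej -val_eqE.
- by move: ji; rewrite ei ej ord1.
- by rewrite ei ej ord1.
- by rewrite Hu ?ei ?ej ?eqn_add2l // -(leq_add2l 1) -ei -ej.
Qed.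

Lemma lower_uniT (A : pzSemiRingType) n (u : 'M[A]_n) : upper_uni u^T -> lower_uni u.
Proof. by move=> Hu i j ij; have := Hu j i ij; rewrite mxE eq_sym. Qed.

Lemma upper_uniT (A : pzSemiRingType) n (u : 'M[A]_n) : lower_uni u -> upper_uni u^T.
Proof. by move=> Hu i j ij; rewrite mxE Hu // eq_sym. Qed.

Lemma lower_uni_block n (b : 'M[C]_(n, 1)) (l : 'M[C]_n) :
  lower_uni l -> lower_uni (block_mx 1%:M 0 b l : 'M_(1 + n)).
Proof.
move=> /upper_uniT Hl; apply: lower_uniT.
by rewrite (tr_block_mx 1%:M 0 b l) trmx1 trmx0; exact: upper_uni_block.
Qed.

(* Shifting by a generic scalar makes every trailing principal minor nonzero. *)
Lemma generic_UDL n (g : 'M[C]_n) : exists2 q : {poly C}, q != 0 & forall s, q.[s] != 0 ->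
  exists (u : 'M[C]_n) (t : 'rV[C]_n) (l : 'M[C]_n),
    [/\ upper_uni u, lower_uni l, forall i, t 0 i != 0
                  & s%:M + g = u *m diag_mx t *m l].
Proof.
elim: n g => [|n IH] g.
  exists 1; first exact: oner_neq0.
  move=> s _; exists 1%:M, 0, 1%:M; split; try by case.
  by apply/matrixP=> -[].
pose g' : 'M[C]_(1 + n) := g; have [q q0 Hq] := IH (drsubmx g').
exists (\det ('X%:M + cstmx g) * (\det ('X%:M + cstmx (drsubmx g')) * q)).
  by rewrite !mulf_neq0 ?det_shift.
move=> s; rewrite !hornerM !mulf_eq0 !negb_or => /and3P[/shift_unit gs /shift_unit Ds].
move=> /Hq [u [t [l [Hu Hl Ht E]]]].
have /andP[/andP[uu tu] lu] : (u \in unitmx) && (diag_mx t \in unitmx) && (l \in unitmx).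
  by move: Ds; rewrite E !unitmx_mul.
(* Block elimination with the lower right block as pivot; [t1] is its Schur complement. *)
pose X := ursubmx g' *m invmx l *m invmx (diag_mx t).
pose Y := invmx (diag_mx t) *m invmx u *m dlsubmx g'.
pose t1 := s%:M + ulsubmx g' - X *m diag_mx t *m Y.
pose U : 'M_(1 + n) := block_mx 1%:M X 0 u.
pose L : 'M_(1 + n) := block_mx 1%:M 0 Y l.
pose T : 'rV_(1 + n) := row_mx t1 t.
have E' : s%:M + g = U *m diag_mx T *m L :> 'M_(1 + n).
  rewrite /U /L /T diag_mx_row !mulmx_block !mulmx1 !mul1mx !mulmx0 !mul0mx !add0r !addr0.
  transitivity (block_mx s%:M 0 0 s%:M + block_mx (ulsubmx g') (ursubmx g') (dlsubmx g') (drsubmx g')).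
    by rewrite -scalar_mx_block submxK.
  rewrite add_block_mx !add0r -E.
  have -> : diag_mx t1 = t1 by apply/matrixP=> i j; rewrite !mxE !ord1 eqxx mulr1n.
  congr block_mx.
  - by rewrite /t1 subrK.
  - by rewrite /X -!mulmxA (mulKmx tu) (mulVmx lu) mulmx1.
  - by rewrite /Y -!mulmxA (mulKVmx tu) (mulKVmx uu).
exists U, T, L; split=> //; first exact: upper_uni_block.
  exact: lower_uni_block.
have : \det (diag_mx T) != 0.
  move: gs; rewrite E' !unitmx_mul => /andP[/andP[_]].
  by rewrite unitmxE unitfE.
by rewrite det_diag => /prodf_neq0 H i; exact: H.
Qed.

(** Conjugation by the order-reversing permutation, which exchanges upper and lower triangular
    matrices. *)
Definition rev_mx n (g : 'M[C]_n) : 'M[C]_n := \matrix_(i, j) g (rev_ord i) (rev_ord j).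

Lemma rev_mxM n (g h : 'M[C]_n) : rev_mx (g *m h) = rev_mx g *m rev_mx h.
Proof.
apply/matrixP=> i j; rewrite !mxE (reindex_inj rev_ord_inj) /=.
by apply: eq_bigr => k _; rewrite !mxE.
Qed.

Lemma leq_rev_ord n (i j : 'I_n) : (rev_ord i <= rev_ord j)%N = (j <= i)%N.
Proof. by have := ltn_ord i; have := ltn_ord j; rewrite /=; lia. Qed.

Lemma generic_LDU n (g : 'M[C]_n) : exists2 q : {poly C}, q != 0 & forall s, q.[s] != 0 ->
  exists (l : 'M[C]_n) (t : 'rV[C]_n) (u : 'M[C]_n),
    [/\ lower_uni l, upper_uni u, forall i, t 0 i != 0
                  & s%:M + g = l *m diag_mx t *m u].
Proof.
have [q q0 Hq] := generic_UDL (rev_mx g); exists q => // s /Hq [u [t [l [Hu Hl Ht E]]]].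
exists (rev_mx u), (\row_i t 0 (rev_ord i)), (rev_mx l); split.
- by move=> i j ij; rewrite mxE Hu ?leq_rev_ord // (inj_eq rev_ord_inj).
- by move=> i j ij; rewrite mxE Hl ?leq_rev_ord // (inj_eq rev_ord_inj).
- by move=> i; rewrite mxE.
have -> : diag_mx (\row_i t 0 (rev_ord i)) = rev_mx (diag_mx t).
  by apply/matrixP=> i j; rewrite !mxE (inj_eq rev_ord_inj).
rewrite -!rev_mxM -E; apply/matrixP=> i j.
by rewrite !mxE (inj_eq rev_ord_inj) !rev_ordK.
Qed.

End Triangular.

(** * Weights *)

Section MonomialsFfun.
Variables (C : numFieldType) (N B : nat).
Local Notation Wt := {ffun 'I_N -> 'I_B}.

Definition wt_nat (m : Wt) (i : 'I_N) : nat := m i.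

Lemma monom_indep_mx m n (M : Wt -> 'M[C]_(m, n)) :
  (forall x : 'rV[C]_N, generic x -> \sum_w monom x (wt_nat w) *: M w = 0) -> forall w, M w = 0.
Proof.
move=> H w; apply/matrixP=> i j; rewrite !mxE.
rewrite -(monom_indep (c := fun w => M w i j) (e := wt_nat) _ (wt_nat w)).
  rewrite (big_pred1 w) // => w' /=; apply/forallP/eqP => [E|-> //].
  by apply/ffunP=> k; apply/val_inj/eqP; exact: E.
move=> x /H /matrixP/(_ i j); rewrite summxE !mxE => E; rewrite -[RHS]E.
by apply: eq_bigr => w' _; rewrite mxE mulrC.
Qed.

End MonomialsFfun.

Lemma monomM (C : numFieldType) N (x y : 'rV[C]_N) e :
  monom (\row_i (x 0 i * y 0 i)) e = monom x e * monom y e.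
Proof. by rewrite /monom -big_split; apply: eq_bigr => i _; rewrite mxE exprMn. Qed.

Lemma monom1 (C : numFieldType) N e : monom (\row_(i < N) (1 : C)) e = 1.
Proof. by rewrite /monom big1 // => i _; rewrite mxE expr1n. Qed.

Lemma mul_diag_mx_row (A : pzSemiRingType) N (x y : 'rV[A]_N) :
  diag_mx x *m diag_mx y = diag_mx (\row_i (x 0 i * y 0 i)).
Proof. by rewrite mulmx_diag; congr diag_mx; apply/rowP=> i; rewrite !mxE. Qed.

Definition pairing N (h e : 'I_N -> nat) : nat := \sum_i h i * e i.

Definition strictly_dec N (h : 'I_N -> nat) := forall i j : 'I_N, (i < j)%N -> (h j < h i)%N.

Section Contraction.
Variables (C : comNzRingType) (N : nat).

(** The conjugate of [l] by the inverse of the torus element [X ^ h]. It is polynomial in [X]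
    because [l] is lower triangular and [h] decreases. *)
Definition contract (h : 'I_N -> nat) (l : 'M[C]_N) : 'M[{poly C}]_N :=
  \matrix_(i, j) if (j <= i)%N then (l i j)%:P * 'X^(h j - h i) else 0.

Variables (h : 'I_N -> nat) (l : 'M[C]_N).
Hypotheses (hdec : strictly_dec h) (ltl : is_trig_mx l).

Lemma contractM : diag_mx (\row_i 'X^(h i)) *m contract h l = cstmx l *m diag_mx (\row_i 'X^(h i)).
Proof.
have hle (i j : 'I_N) : (j <= i)%N -> (h i <= h j)%N.
  by rewrite leq_eqVlt => /orP[/eqP/val_inj ->|/hdec/ltnW].
rewrite mul_diag_mx mul_mx_diag; apply/matrixP=> i j; rewrite !mxE.
case: leqP => ij; last by rewrite (is_trig_mxP ltl) // mulr0 mul0r.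
by rewrite mulrCA -exprD subnKC // hle.
Qed.

Lemma contract0 : evalmx 0 (contract h l) = diag_mx (\row_i l i i).
Proof.
apply/matrixP=> i j; rewrite !mxE /horner_eval; case: ltngtP => ij.
- rewrite hornerM hornerXn hornerC expr0n subn_eq0 leqNgt hdec // mulr0.
  by rewrite (_ : (i == j) = false) //; apply: gtn_eqF.
- by rewrite horner0 (_ : (i == j) = false) //; apply: ltn_eqF.
- by rewrite (val_inj ij) eqxx subnn hornerM hornerXn hornerC mulr1.
Qed.

Lemma contract1 : evalmx 1 (contract h l) = l.
Proof.
apply/matrixP=> i j; rewrite !mxE /horner_eval; case: leqP => ij.
  by rewrite hornerM hornerXn hornerC expr1n mulr1.
by rewrite horner0 (is_trig_mxP ltl).
Qed.

End Contraction.

Section Weights.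
Variables (C : numFieldType) (N K d : nat).
Variable c : 'I_d -> 'I_d -> 'M[C]_#|tensidx N K|.

Local Notation W := (polymap c).
Local Notation WX := (polymapX c).
Local Notation Wt := {ffun 'I_N -> 'I_K.+1}.

Hypothesis W1 : W 1%:M = 1%:M.
Hypothesis WM : forall g h, W (g *m h) = W g *m W h.

Definition tens_wt (a : 'I_#|tensidx N K|) : Wt :=
  [ffun i => inord #|[set k | tidx a k == Some i]|].

(** The projection onto the weight space of [w]: the terms of [polymap_diag] collected by weight. *)
Definition wproj (w : Wt) : 'M[C]_d := \sum_(a | tens_wt a == w) linmap c (delta_mx a a).

Lemma W_diag x : W (diag_mx x) = \sum_w monom x (wt_nat w) *: wproj w.
Proof.
rewrite polymap_diag (partition_big tens_wt predT) //=; apply: eq_bigr => w _.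
rewrite /wproj scaler_sumr; apply: eq_bigr => a /eqP <-; congr (_ *: _).
apply: eq_bigr => i _; rewrite /wt_nat ffunE inordK // ltnS.
by rewrite -[X in (_ <= X)%N]card_ord max_card.
Qed.

Lemma sum_wproj : \sum_w wproj w = 1%:M.
Proof.
rewrite -W1 -[1%:M](_ : diag_mx (\row_i 1) = _); last first.
  by apply/matrixP=> i j; rewrite !mxE.
by rewrite W_diag; apply: eq_bigr => w _; rewrite monom1 scale1r.
Qed.

(** Compare coefficients of the monomials in [y] in [W x * W y = W (x y)]. *)
Lemma W_wproj x w : W (diag_mx x) *m wproj w = monom x (wt_nat w) *: wproj w.
Proof.
apply/eqP; rewrite -subr_eq0; apply/eqP; move: w; apply: monom_indep_mx => y _.
under eq_bigr do rewrite scalerBr scalemxAr scalerA mulrC -monomM.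
by rewrite sumrB -mulmx_sumr -!W_diag -WM mul_diag_mx_row subrr.
Qed.

Lemma wproj_W x w : wproj w *m W (diag_mx x) = monom x (wt_nat w) *: wproj w.
Proof.
apply/eqP; rewrite -subr_eq0; apply/eqP; move: w; apply: monom_indep_mx => y _.
under eq_bigr do rewrite scalerBr scalemxAl scalerA -monomM.
by rewrite sumrB -mulmx_suml -!W_diag -WM mul_diag_mx_row subrr.
Qed.

Lemma wproj_mul w w' : wproj w *m wproj w' = (w == w')%:R *: wproj w.
Proof.
apply/eqP; rewrite -subr_eq0; apply/eqP.
move: w; apply: (@monom_indep_mx _ _ _ _ _ (fun w => wproj w *m wproj w' - _)) => y _.
under eq_bigr do rewrite scalerBr scalemxAl.
rewrite sumrB -mulmx_suml -W_diag W_wproj (bigD1 w') //= eqxx scale1r.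
by rewrite big1 ?addr0 ?subrr // => w /negPf ->; rewrite scale0r scaler0.
Qed.

Lemma W_torusX (h : 'I_N -> nat) :
  WX (diag_mx (\row_i 'X^(h i))) = \sum_w 'X^(pairing h (wt_nat w)) *: cstmx (wproj w).
Proof.
apply: (@evalmx_ext _ _ _ 1); first exact: oner_neq0.
move=> s _; rewrite evalmx_polymapX.
have -> : evalmx s (diag_mx (\row_i 'X^(h i))) = diag_mx (\row_i (s ^+ h i)).
  apply/matrixP=> i j; rewrite !mxE /horner_eval; case: eqP => // _.
    by rewrite !mulr1n hornerXn.
  by rewrite !mulr0n horner0.
rewrite W_diag /evalmx raddf_sum /=; apply: eq_bigr => w _.
apply/matrixP=> i j; rewrite !mxE /horner_eval hornerM hornerXn hornerC; congr (_ * _).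
rewrite /monom /pairing -prodrXr; apply: eq_bigr => k _; by rewrite mxE -exprM.
Qed.

(* Conjugating by the one-parameter torus [s ^ h] contracts the lower unitriangular
   group to 1 as [s] tends to 0, while the extremality of [w] bounds the degree in [s]. *)
Lemma extremal_row_fixed h w (xi : 'rV[C]_d) l : strictly_dec h ->
  (forall w', wproj w' != 0 -> (pairing h (wt_nat w') <= pairing h (wt_nat w))%N) ->
  xi *m wproj w = xi -> lower_uni l -> xi *m W l = xi.
Proof.
move=> hdec hmax xiw ll; set M := pairing h (wt_nat w) in hmax *.
pose D : 'M[{poly C}]_N := diag_mx (\row_i 'X^(h i)); pose G := contract h l.
have ltl : is_trig_mx l.
  by apply/is_trig_mxP => i j ij; rewrite ll 1?ltnW // (_ : (i == j) = false) //; apply: ltn_eqF.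
have DG : D *m G = cstmx l *m D by exact: contractM.
have G0 : evalmx 0 G = 1%:M.
  rewrite contract0 //; apply/matrixP=> i j; rewrite !mxE ll //.
  by rewrite eqxx.
have G1 : evalmx 1 G = l by exact: contract1.
pose R := cstmx xi *m WX G.
(* Both sides are [xi W(l) W(D)]. On the left, [l] is moved across [D] and [xi] absorbs the torus
   through its weight; on the right, [W(D)] is split into weights. *)
have ER : 'X^M *: R = \sum_w' 'X^(pairing h (wt_nat w')) *: cstmx (xi *m W l *m wproj w').
  transitivity (cstmx (xi *m W l) *m WX D).
    rewrite /cstmx map_mxM -/(cstmx xi) -/(cstmx (W l)) -polymapX_cst -mulmxA.
    rewrite -polymapXM // -DG polymapXM // mulmxA W_torusX mulmx_sumr (bigD1 w) //=.
    rewrite big1 => [|w' ne]; last first.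
      rewrite -scalemxAr -map_mxM /= -xiw -mulmxA wproj_mul eq_sym (negPf ne) scale0r.
      by rewrite mulmx0 map_mx0 scaler0.
    by rewrite addr0 -scalemxAr -map_mxM /= xiw -scalemxAl.
  rewrite W_torusX mulmx_sumr; apply: eq_bigr => w' _.
  by rewrite -scalemxAr -map_mxM.
(* By maximality of [M] the product of [X^M] and [R] has degree at most [M], so [R] is constant. *)
have Rconst : evalmx 1 R = evalmx 0 R.
  apply/rowP=> j; rewrite [LHS]mxE [RHS]mxE /horner_eval.
  have : (size ('X^M * R 0 j)%R <= M.+1)%N.
    have /rowP/(_ j) := ER; rewrite mxE => ->; rewrite summxE.
    apply: leq_trans (size_sum _ _ _) _; apply/bigmax_leqP => w' _; rewrite mxE.
    have [->|nz] := eqVneq (wproj w') 0.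
      by rewrite mulmx0 mxE mxE polyC0 mulr0 size_poly0.
    rewrite mxE mulrC mul_polyC; apply: leq_trans (size_scale_leq _ _) _.
    by rewrite size_polyXn ltnS hmax.
  have [->|nz] := eqVneq (R 0 j) 0; first by rewrite !horner0.
  rewrite size_monicM ?monicXn // size_polyXn addSn /= => sz.
  have /size1_polyC -> : (size (R 0%R j) <= 1)%N by rewrite -(leq_add2l M) (leq_trans sz) ?addn1.
  by rewrite !hornerC.
move: Rconst; rewrite !evalmxM !evalmx_cst !evalmx_polymapX G0 G1 W1 mulmx1.
by [].
Qed.

End Weights.

Section HighestWeight.
Variables (C : numFieldType) (N K d : nat).
Variable c : 'I_d -> 'I_d -> 'M[C]_#|tensidx N K|.

Local Notation W := (polymap c).
Local Notation WX := (polymapX c).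
Local Notation P := (wproj c).

Hypothesis W1 : W 1%:M = 1%:M.
Hypothesis WM : forall g h, W (g *m h) = W g *m W h.
Hypothesis irrW : forall S : 'cV[C]_d -> Prop,
  S 0 -> (forall a u v, S u -> S v -> S (a *: u + v)) ->
  (forall g w, g \in unitmx -> S w -> S (W g *m w)) ->
  forall w0, w0 != 0 -> S w0 -> forall w, S w.

Variables (lam : 'I_N -> nat) (v : 'cV[C]_d).
Hypothesis v0 : v != 0.
Hypothesis v_upper : forall u, upper_uni u -> W u *m v = v.
Hypothesis v_torus : forall t : 'rV[C]_N, (forall i, t 0 i != 0) ->
  W (diag_mx t) *m v = monom t lam *: v.

(** [v] generates the representation: the vectors killed by all [xi W g] form an invariant subspace,
    which cannot contain [v] unless it is everything. *)
Lemma cyclic_row (xi : 'rV[C]_d) :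
  (forall g, g \in unitmx -> xi *m W g *m v = 0) -> xi = 0.
Proof.
move=> H; apply/eqP/negPn/negP => xi0.
pose S (w : 'cV[C]_d) := forall g, g \in unitmx -> xi *m W g *m w = 0.
have Sall : forall w, S w.
  apply: (irrW (S := S)) v0 H; first by move=> g _; rewrite mulmx0.
    by move=> a u w Su Sw g gu; rewrite mulmxDr -scalemxAr Su // Sw // scaler0 addr0.
  by move=> g w gu Sw h hu; rewrite mulmxA -(mulmxA xi) -WM Sw // unitmx_mul hu.
case/eqP: xi0; apply/rowP=> j.
have := Sall (delta_mx j 0) 1%:M (unitmx1 _ _).
by rewrite W1 mulmx1 -colE => /matrixP/(_ 0 0); rewrite !mxE.
Qed.

(** On the big cell [g = l t u] the value [xi W g v] is a multiple of [xi v]. If [xi v] were 0,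
    density of the cell would make [xi] kill the whole orbit of [v]. *)
Lemma lower_fixed_row_neq0 w (xi : 'rV[C]_d) : xi *m P w = xi -> xi != 0 ->
  (forall l, lower_uni l -> xi *m W l = xi) -> xi *m v != 0.
Proof.
move=> xiw xi0 xil; apply: contraNneq xi0 => xiv; apply/eqP; apply: cyclic_row => g gu.
have [q q0 Hq] := generic_LDU g.
pose p := cstmx xi *m WX ('X%:M + cstmx g) *m cstmx v.
have p0 : p = 0.
  apply: evalmx_ext q0 _ => s /Hq[l [t [u [ll uu tn E]]]].
  rewrite !evalmxM !evalmx_cst evalmx_polymapX evalmx_shift E !WM !mulmxA xil //.
  rewrite -(mulmxA _ (W u)) v_upper // -mulmxA v_torus // -scalemxAr xiv scaler0.
  by rewrite /evalmx map_mx0.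
have := congr1 (evalmx 0) p0.
rewrite !evalmxM !evalmx_cst evalmx_polymapX evalmx_shift raddf0 add0r => ->.
by rewrite /evalmx map_mx0.
Qed.

(** [xi W t v] can be evaluated from the left with weight [w] and from the right with weight [lam].
    A torus element with a single entry 2 compares the exponents, as powers of 2 are distinct. *)
Lemma weight_of_fixed w (xi : 'rV[C]_d) : xi *m P w = xi -> xi *m v != 0 ->
  wt_nat w =1 lam.
Proof.
move=> xiw xiv i; pose t : 'rV[C]_N := \row_j if j == i then 2 else 1.
have t0 j : t 0 j != 0 by rewrite mxE; case: ifP; rewrite ?oner_eq0 ?pnatr_eq0.
have mt e : monom t e = 2 ^+ e i.
  rewrite /monom (bigD1 i) //= mxE eqxx big1 ?mulr1 // => j ji.
  by rewrite mxE (negPf ji) expr1n.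
have : xi *m W (diag_mx t) *m v = xi *m W (diag_mx t) *m v by [].
rewrite -{1}xiw -(mulmxA xi) wproj_W // -scalemxAr xiw -mulmxA v_torus //.
rewrite -scalemxAl -scalemxAr !mt => /eqP.
rewrite -subr_eq0 -scalerBl scaler_eq0 (negPf xiv) orbF subr_eq0 => /eqP E.
have : (2 ^ wt_nat w i)%:R = (2 ^ lam i)%:R :> C by rewrite !natrX.
by move/eqP; rewrite eqr_nat eqn_exp2l // => /eqP.
Qed.

Lemma wproj_row w : P w != 0 -> exists2 xi : 'rV[C]_d, xi != 0 & xi *m P w = xi.
Proof.
move=> Pw; have [i Pi] : exists i, row i (P w) != 0.
  apply/existsP; rewrite -negb_forall; apply: contraNN Pw => /forallP H.
  by apply/eqP/row_matrixP=> i; rewrite (eqP (H i)) row0.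
by exists (row i (P w)) => //; rewrite -row_mul wproj_mul // eqxx scale1r.
Qed.

Lemma max_weight (h : 'I_N -> nat) : exists2 w, P w != 0 &
  forall w', P w' != 0 -> (pairing h (wt_nat w') <= pairing h (wt_nat w))%N.
Proof.
have [w Pw] : exists w, P w != 0.
  apply/existsP; rewrite -negb_forall; apply: contraNN v0 => /forallP H.
  by rewrite -[v]mul1mx -(sum_wproj W1) big1 ?mul0mx // => w _; apply/eqP.
by case: (@arg_maxnP _ w (fun w => P w != 0) (fun w => pairing h (wt_nat w)) Pw) => w' Pw' H; exists w'.
Qed.

Lemma extremal_fixed_neq0 h w (xi : 'rV[C]_d) : strictly_dec h ->
  (forall w', P w' != 0 -> (pairing h (wt_nat w') <= pairing h (wt_nat w))%N) ->
  xi *m P w = xi -> xi != 0 -> xi *m v != 0.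
Proof.
move=> hd hmax xiw xi0; apply: lower_fixed_row_neq0 (xiw) xi0 _ => l ll.
exact: extremal_row_fixed hd hmax xiw ll.
Qed.

(** Any weight maximizing the pairing with [h] carries a row fixed by the lower unitriangular group.
    Such a row does not kill [v], hence has weight [lam]; so [lam] is the unique maximizer. *)
Lemma highest_weight_max h w : strictly_dec h -> P w != 0 ->
  (pairing h (wt_nat w) <= pairing h lam ?= iff [forall i, wt_nat w i == lam i])%N.
Proof.
move=> hd Pw.
have key w' : P w' != 0 -> (forall w'', P w'' != 0 ->
    (pairing h (wt_nat w'') <= pairing h (wt_nat w'))%N) -> wt_nat w' =1 lam.
  move=> Pw' hmax; have [xi xi0 xiw] := wproj_row Pw'.
  exact: weight_of_fixed xiw (extremal_fixed_neq0 hd hmax xiw xi0).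
have pE e e' : e =1 e' -> pairing h e = pairing h e'.
  by move=> E; apply: eq_bigr => i _; rewrite E.
have [w1 Pw1 w1max] := max_weight h.
have E1 := key _ Pw1 w1max; rewrite -(pE _ _ E1); split; first exact: w1max.
apply/eqP/forallP => [E i|E]; last by rewrite (pE _ _ E1); apply: pE => i; apply/eqP.
by apply/eqP; apply: key => // w'' /w1max; rewrite E.
Qed.

Definition rev_dec (i : 'I_N) : nat := N - i.

Lemma rev_dec_strict : strictly_dec rev_dec.
Proof. by move=> i j ij; rewrite /rev_dec; have := ltn_ord j; lia. Qed.

(** Multiplicity one: a row of the extremal weight that kills [v] is 0, so this weight space of rows
    is a line and the projection has rank 1. *)
Lemma highest_weight_wt : exists2 w, wt_nat w =1 lam & \tr (P w) = 1.
Proof.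
have hd := rev_dec_strict.
have [w Pw wmax] := max_weight rev_dec; have [z z0 zw] := wproj_row Pw.
have zv := extremal_fixed_neq0 hd wmax zw z0.
have wl := weight_of_fixed zw zv; exists w => //.
pose k := (z *m v) 0 0.
have k0 : k != 0.
  apply: contraNneq zv => E; apply/eqP/matrixP=> i j; rewrite !ord1 -/k E !mxE //.
(* The multiple of [z] is chosen so that the difference kills [v]. *)
have row_eq (eta : 'rV[C]_d) : eta *m P w = ((eta *m P w *m v) 0 0 / k) *: z.
  have EP : eta *m P w *m P w = eta *m P w by rewrite -mulmxA wproj_mul // eqxx scale1r.
  apply/eqP; rewrite -subr_eq0; apply/negPn/negP => ne.
  have := extremal_fixed_neq0 (xi := eta *m P w - ((eta *m P w *m v) 0 0 / k) *: z) hd wmax.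
  rewrite mulmxBl -scalemxAl zw EP => /(_ erefl ne).
  rewrite mulmxBl -scalemxAl => /eqP[]; apply/matrixP=> i j; rewrite !ord1.
  by rewrite [LHS]mxE [X in _ + X]mxE [X in _ - X]mxE -/k divfK ?mxE ?subrr.
have -> : P w = k^-1 *: (P w *m v *m z).
  apply/row_matrixP=> i; rewrite rowE row_eq linearZ /= row_mul -!rowE.
  rewrite [row i (P w *m v)]mx11_scalar mul_scalar_mx scalerA mulrC; congr (_ * _ *: _).
  by rewrite -row_mul.
by rewrite mxtraceZ mxtrace_mulC mulmxA zw /mxtrace big_ord1 -/k mulVf.
Qed.

End HighestWeight.

(** * The Casimir operator *)

Section Characters.
Variables (C : numFieldType) (N K d : nat).
Variable c : 'I_d -> 'I_d -> 'M[C]_#|tensidx N K|.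

Local Notation W := (polymap c).
Local Notation WX := (polymapX c).
Local Notation dW := (dpolymap c).
Local Notation Wt := {ffun 'I_N -> 'I_K.+1}.
Local Notation P := (wproj c).
Local Notation E := (@delta_mx C N N).

Definition char_coef (w : Wt) : C := \tr (P w).

Definition char (x : 'rV[C]_N) : C := \tr (W (diag_mx x)).

(** [char1] and [char2] are the first and second powers of the operator [x_i d/dx_i] applied to
    [char]. *)
Definition char1 i (x : 'rV[C]_N) : C :=
  \sum_w char_coef w * (wt_nat w i)%:R * monom x (wt_nat w).

Definition char2 i (x : 'rV[C]_N) : C :=
  \sum_w char_coef w * (wt_nat w i)%:R ^+ 2 * monom x (wt_nat w).

Lemma charE x : char x = \sum_w char_coef w * monom x (wt_nat w).
Proof.
rewrite /char W_diag raddf_sum /=; apply: eq_bigr => w _.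
by rewrite mxtraceZ mulrC.
Qed.

Hypothesis W1 : W 1%:M = 1%:M.
Hypothesis WM : forall g h, W (g *m h) = W g *m W h.

Let WM_unit g h : g \in unitmx -> h \in unitmx -> W (g *m h) = W g *m W h.
Proof. by move=> _ _; exact: WM. Qed.

Lemma coef1_exp_1X n : ((1 + 'X : {poly C}) ^+ n)`_1 = n%:R.
Proof.
rewrite -[n in LHS]card_ord -prodr_const coef1_prod.
under eq_bigr => k _.
  rewrite big1 => [|l _]; last by rewrite coefD coef1 coefX addr0.
  rewrite coefD coef1 coefX add0r mulr1; over.
by rewrite sumr_const card_ord.
Qed.

Lemma line_Eii i :
  1%:M + 'X *: cstmx (E i i) = diag_mx (\row_j if j == i then 1 + 'X else 1).
Proof.
apply/matrixP=> j k; rewrite !mxE; have [<-|jk] := eqVneq j k.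
  by rewrite mulr1n andbb; case: eqP => _; rewrite ?mulr1 // mulr0 addr0.
rewrite mulr0n add0r; have [ji|_] := eqVneq j i; last by rewrite mulr0.
by rewrite -ji eq_sym (negPf jk) mulr0.
Qed.

Lemma WX_line_Eii i : WX (1%:M + 'X *: cstmx (E i i)) =
  \sum_w (1 + 'X) ^+ wt_nat w i *: cstmx (P w).
Proof.
apply: (@evalmx_ext _ _ _ 1); first exact: oner_neq0.
move=> s _; rewrite evalmx_polymapX line_Eii.
have -> : evalmx s (diag_mx (\row_j if j == i then 1 + 'X else 1)) =
    diag_mx (\row_j if j == i then 1 + s else 1).
  apply/matrixP=> j k; rewrite !mxE /horner_eval; have [_|_] := eqVneq j k.
    by rewrite !mulr1n; case: ifP; rewrite ?hornerD ?hornerX hornerC.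
  by rewrite !mulr0n horner0.
rewrite W_diag /evalmx raddf_sum /=; apply: eq_bigr => w _.
apply/matrixP=> j k; rewrite !mxE /horner_eval hornerM hornerC horner_exp hornerD hornerX hornerC.
congr (_ * _); rewrite /monom (bigD1 i) //= mxE eqxx big1 ?mulr1 // => l li.
by rewrite mxE (negPf li) expr1n.
Qed.

Lemma dW_Eii i : dW (E i i) = \sum_w (wt_nat w i)%:R *: P w.
Proof.
rewrite -coef1mx_polymapX_line WX_line_Eii /coefmx raddf_sum /=; apply: eq_bigr => w _.
by apply/matrixP=> j k; rewrite !mxE /= mulrC coefCM coef1_exp_1X mulrC.
Qed.

Lemma dW_Eii2 i : dW (E i i) *m dW (E i i) = \sum_w (wt_nat w i)%:R ^+ 2 *: P w.
Proof.
rewrite {1}dW_Eii mulmx_suml; apply: eq_bigr => w _.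
rewrite dW_Eii mulmx_sumr (bigD1 w) //= -scalemxAl -scalemxAr wproj_mul // eqxx scale1r.
rewrite scalerA -expr2 big1 ?addr0 // => w' ne.
by rewrite -scalemxAl -scalemxAr wproj_mul // eq_sym (negPf ne) scale0r !scaler0.
Qed.

Lemma char1E i x : \tr (W (diag_mx x) *m dW (E i i)) = char1 i x.
Proof.
rewrite dW_Eii mulmx_sumr raddf_sum /=; apply: eq_bigr => w _.
by rewrite -scalemxAr W_wproj // scalerA mxtraceZ mulrC mulrA.
Qed.

Lemma char2E i x : \tr (W (diag_mx x) *m (dW (E i i) *m dW (E i i))) = char2 i x.
Proof.
rewrite dW_Eii2 mulmx_sumr raddf_sum /=; apply: eq_bigr => w _.
by rewrite -scalemxAr W_wproj // scalerA mxtraceZ mulrC mulrA.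
Qed.

Lemma Eij_sq i j : i != j -> E i j *m E i j = 0.
Proof. by move=> ij; rewrite mul_delta_mx_cond eq_sym (negPf ij). Qed.

Lemma dW_bracket_Eij i j : i != j ->
  dW (E i j) *m dW (E j i) - dW (E j i) *m dW (E i j) = dW (E i i) - dW (E j j).
Proof.
move=> ij; by rewrite (dpolymap_bracket W1 WM_unit) ?Eij_sq // !mul_delta_mx linearB.
Qed.

(** Moving the torus element past [dW E_ij] costs the factor [x_i / x_j]. With cyclicity of the
    trace this gives the ratio of the traces for the two orders of the factors, while the bracket
    gives their difference; solve for the first trace. *)
Lemma char_offdiag i j x : i != j -> generic x ->
  \tr (W (diag_mx x) *m (dW (E i j) *m dW (E j i))) =
  x 0 i / (x 0 i - x 0 j) * (char1 i x - char1 j x).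
Proof.
move=> ij [x0 xd]; pose y : 'rV[C]_N := \row_i (x 0 i)^-1.
have xy : diag_mx x *m diag_mx y = 1%:M.
  rewrite mul_diag_mx_row; apply/matrixP=> k l; rewrite !mxE.
  by rewrite divff.
have WE k l : W (diag_mx x) *m dW (E k l) = (x 0 k / x 0 l) *: (dW (E k l) *m W (diag_mx x)).
  rewrite -[LHS]mulmx1 -W1 -(mulmx1C xy) WM mulmxA (dpolymap_conj WM_unit) //.
  rewrite scalemxAl -linearZ /=; congr (dW _ *m _).
  apply/matrixP=> a b; rewrite mul_diag_mx mul_mx_diag !mxE.
  by case: eqP => [->|_]; [case: eqP => [->|_]|]; rewrite /= ?mulr0 ?mul0r ?mulr1 // mulr0 mul0r.
set t := \tr _.
have Et : t = x 0 i / x 0 j * \tr (W (diag_mx x) *m (dW (E j i) *m dW (E i j))).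
  by rewrite /t mulmxA WE -scalemxAl mxtraceZ -mulmxA mxtrace_mulC -mulmxA.
have : t - \tr (W (diag_mx x) *m (dW (E j i) *m dW (E i j))) = char1 i x - char1 j x.
  by rewrite /t -raddfB /= -mulmxBr dW_bracket_Eij // mulmxBr raddfB /= !char1E.
have xij : x 0 i - x 0 j != 0 by rewrite subr_eq0 xd.
move: Et (x0 i) (x0 j); set s := \tr _ => Et xi xj <-.
rewrite Et; field.
by rewrite xij xj.
Qed.

Definition casimir : 'M[C]_d := \sum_i \sum_j dW (E i j) *m dW (E j i).

(** The canonical element of a pair of dual bases does not depend on the pair. *)
Lemma dual_bases_sum (g h : 'M[C]_N) (X Y : 'I_N -> 'M[C]_d) : g *m h = 1%:M ->
  \sum_i (\sum_k g k i *: X k) *m (\sum_n h i n *: Y n) = \sum_k X k *m Y k.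
Proof.
move=> gh.
transitivity (\sum_k \sum_n (\sum_i g k i * h i n) *: (X k *m Y n)).
  under eq_bigr do rewrite mulmx_suml.
  rewrite exchange_big /=; apply: eq_bigr => k _.
  under eq_bigr do rewrite mulmx_sumr.
  rewrite exchange_big /=; apply: eq_bigr => n _.
  rewrite scaler_suml; apply: eq_bigr => i _.
  by rewrite -scalemxAl -scalemxAr scalerA.
have gE k n : \sum_i g k i * h i n = (k == n)%:R.
  by have /matrixP/(_ k n) := gh; rewrite !mxE.
apply: eq_bigr => k _; rewrite (bigD1 k) //= [X in _ + X]big1 => [|n nk].
  by rewrite gE eqxx scale1r addr0.
by rewrite gE eq_sym (negPf nk) scale0r.
Qed.

Lemma mul_Eij_l (g : 'M[C]_N) i j : g *m E i j = \sum_k g k i *: E k j.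
Proof.
rewrite {1}[g]matrix_sum_delta mulmx_suml; apply: eq_bigr => k _.
rewrite mulmx_suml (bigD1 i) //= -scalemxAl mul_delta_mx big1 ?addr0 // => l li.
by rewrite -scalemxAl mul_delta_mx_cond (negPf li) scaler0.
Qed.

Lemma mul_Eij_r (h : 'M[C]_N) i j : E i j *m h = \sum_l h j l *: E i l.
Proof.
rewrite {1}[h]matrix_sum_delta mulmx_sumr (bigD1 j) //= [X in _ + X]big1 => [|k kj].
  rewrite addr0 mulmx_sumr; apply: eq_bigr => l _.
  by rewrite -scalemxAr mul_delta_mx.
rewrite mulmx_sumr big1 // => l _.
by rewrite -scalemxAr mul_delta_mx_cond eq_sym (negPf kj) scaler0.
Qed.

(** Conjugation by [g] turns the matrix units into another pair of dual bases. The change of basis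
    is undone in the index [i] for fixed [j], and then in [j]. *)
Lemma casimir_central g : g \in unitmx -> W g *m casimir = casimir *m W g.
Proof.
move=> gu; pose h := invmx g.
have gh : g *m h = 1%:M by rewrite mulmxV.
have hg : h *m g = 1%:M by rewrite mulVmx.
suff conj : W g *m casimir *m W h = casimir.
  by rewrite -{2}conj -mulmxA -WM hg W1 mulmx1.
rewrite /casimir mulmx_sumr mulmx_suml.
transitivity (\sum_i \sum_j dW (g *m E i j *m h) *m dW (g *m E j i *m h)).
  apply: eq_bigr => i _; rewrite mulmx_sumr mulmx_suml; apply: eq_bigr => j _.
  rewrite -!(dpolymap_conj WM_unit _ gh) !mulmxA -(mulmxA _ (W h) (W g)) -WM hg W1.
  by rewrite mulmx1 ?mulmxA.
transitivity (\sum_j \sum_k dW (E k j *m h) *m dW (g *m E j k)).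
  rewrite exchange_big /=; apply: eq_bigr => j _.
  rewrite -[RHS](dual_bases_sum _ _ gh); apply: eq_bigr => i _; congr (_ *m _).
    by rewrite mul_Eij_l mulmx_suml linear_sum; apply: eq_bigr => k _; rewrite -scalemxAl linearZ.
  by rewrite -mulmxA mul_Eij_r mulmx_sumr linear_sum; apply: eq_bigr => k _; rewrite -scalemxAr linearZ.
rewrite exchange_big /=; apply: eq_bigr => k _.
have hgT : h^T *m g^T = 1%:M by rewrite -trmx_mul gh trmx1.
rewrite -[RHS](dual_bases_sum _ _ hgT); apply: eq_bigr => j _; congr (_ *m _).
  by rewrite mul_Eij_r linear_sum; apply: eq_bigr => l _; rewrite linearZ mxE.
by rewrite mul_Eij_l linear_sum; apply: eq_bigr => l _; rewrite linearZ mxE.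
Qed.

Hypothesis irrW : forall S : 'cV[C]_d -> Prop,
  S 0 -> (forall a u v, S u -> S v -> S (a *: u + v)) ->
  (forall g w, g \in unitmx -> S w -> S (W g *m w)) ->
  forall w0, w0 != 0 -> S w0 -> forall w, S w.

Variables (lam : 'I_N -> nat) (v : 'cV[C]_d).
Hypothesis v0 : v != 0.
Hypothesis v_upper : forall u, upper_uni u -> W u *m v = v.
Hypothesis v_torus : forall t : 'rV[C]_N, (forall i, t 0 i != 0) ->
  W (diag_mx t) *m v = monom t lam *: v.

(** The eigenspace through [v] is invariant. As an eigenvector is given, no eigenvalue has to be
    found. *)
Lemma schur_scalar (A : 'M[C]_d) a :
  (forall g, g \in unitmx -> W g *m A = A *m W g) -> A *m v = a *: v -> A = a%:M.
Proof.
move=> cA Av; pose S (w : 'cV[C]_d) := A *m w = a *: w; have H : forall w, S w.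
  apply: (irrW (S := S)) v0 Av; rewrite /S; first by rewrite mulmx0 scaler0.
    move=> k u w Hu Hw; rewrite mulmxDr -scalemxAr Hu Hw scalerDr !scalerA.
    by rewrite mulrC.
  by move=> g w gu Hw; rewrite mulmxA -cA // -mulmxA Hw -scalemxAr.
apply/matrixP=> i j; have /matrixP/(_ i 0) := H (delta_mx j 0).
by rewrite -colE !mxE andbT mulr_natr.
Qed.

Lemma dW_upper (i j : 'I_N) : (i < j)%N -> dW (E i j) *m v = 0.
Proof.
move=> ij; have H : WX (1%:M + 'X *: cstmx (E i j)) *m cstmx v = cstmx v.
  apply: (@evalmx_ext _ _ _ 1); first exact: oner_neq0.
  move=> s _; rewrite evalmxM evalmx_polymapX !evalmx_cst evalmxD evalmx1 evalmxZX.
  apply: v_upper => k l lk; rewrite !mxE; have [ki|_] := eqVneq k i; last by rewrite mulr0 addr0.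
  have [lj|_] := eqVneq l j; last by rewrite mulr0 addr0.
  by move: lk; rewrite ki lj leqNgt ij.
move/(congr1 (coefmx 1)): H; rewrite coef1mxM coef1mx_polymapX_line.
by rewrite coef0mx_cst coef1mx_cst mulmx0 addr0.
Qed.

Lemma dW_torus i : dW (E i i) *m v = (lam i)%:R *: v.
Proof.
have H : WX (1%:M + 'X *: cstmx (E i i)) *m cstmx v = (1 + 'X) ^+ lam i *: cstmx v.
  apply: (@evalmx_ext _ _ _ (1 + 'X)).
    by rewrite -size_poly_eq0 addrC -polyC1 size_XaddC.
  move=> s s1; rewrite evalmxM evalmx_polymapX !evalmx_cst.
  have -> : evalmx s ((1 + 'X) ^+ lam i *: cstmx v) = (1 + s) ^+ lam i *: v.
    apply/matrixP=> k l; rewrite !mxE /horner_eval hornerM hornerC horner_exp.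
    by rewrite hornerD hornerX hornerC.
  have -> : evalmx s (1%:M + 'X *: cstmx (E i i)) = diag_mx (\row_j if j == i then 1 + s else 1).
    rewrite line_Eii; apply/matrixP=> k l; rewrite !mxE /horner_eval.
    have [_|_] := eqVneq k l; last by rewrite !mulr0n horner0.
    by rewrite !mulr1n; case: ifP; rewrite ?hornerD ?hornerX hornerC.
  rewrite v_torus => [|k]; last first.
    by rewrite mxE; case: ifP; rewrite ?oner_neq0 //; move: s1; rewrite hornerD hornerX hornerC.
  congr (_ *: _); rewrite /monom (bigD1 i) //= mxE eqxx big1 ?mulr1 // => l li.
  by rewrite mxE (negPf li) expr1n.
move/(congr1 (coefmx 1)): H; rewrite coef1mxM coef1mx_polymapX_line.
rewrite coef0mx_cst coef1mx_cst mulmx0 addr0 => ->.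
by apply/matrixP=> k l; rewrite !mxE /= mulrC coefCM coef1_exp_1X mulrC.
Qed.

(** This is [<lam, lam + 2 rho>], where [2 rho] is the sum of the positive roots. *)
Definition casimir_value : C :=
  \sum_i (lam i)%:R ^+ 2 + \sum_(i < N) \sum_(j < N | (i < j)%N) ((lam i)%:R - (lam j)%:R).

Lemma casimir_scalar : casimir = casimir_value%:M.
Proof.
apply: schur_scalar; first exact: casimir_central.
rewrite /casimir /casimir_value mulmx_suml -big_split scaler_suml /=.
apply: eq_bigr => i _; rewrite mulmx_suml (bigD1 i) //= -mulmxA dW_torus -scalemxAr dW_torus.
rewrite scalerA -expr2 scalerDl; congr (_ + _).
rewrite scaler_suml big_mkcond [RHS]big_mkcond /=; apply: eq_bigr => j _.
(* For [j < i] the operator applied first raises weights and kills [v]. For [i < j] it lowers, so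
   the product is replaced by the commutator, whose other term kills [v]. *)
case: (ltngtP i j) => ij.
- rewrite (_ : j != i); last by rewrite -val_eqE /= gtn_eqF.
  have ne : i != j by rewrite -val_eqE /= ltn_eqF.
  rewrite -[LHS]subr0 -[X in _ - X](mulmx0 _ (dW (E j i))) -(dW_upper ij) mulmxA -mulmxBl.
  by rewrite dW_bracket_Eij // mulmxBl !dW_torus scalerBl.
- rewrite (_ : j != i); last by rewrite -val_eqE /= ltn_eqF.
  by rewrite -mulmxA dW_upper // mulmx0.
- by rewrite (val_inj ij) eqxx.
Qed.

(** A second central element, giving homogeneity of the character. The staircase differs from [rho]
    by the constant [(N - 1) / 2], and homogeneity absorbs the difference. *)
Lemma dW1_scalar : dW 1%:M = (\sum_i (lam i)%:R)%:M.
Proof.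
have dW1 : dW 1%:M = \sum_i dW (E i i).
  rewrite -linear_sum; congr (dW _); apply/matrixP=> i j; rewrite summxE !mxE.
  rewrite (bigD1 i) //= mxE eqxx /= big1 ?addr0 => [|k ki]; first by rewrite eq_sym.
  by rewrite mxE [i == k]eq_sym (negPf ki).
apply: schur_scalar => [g gu|]; last first.
  by rewrite dW1 mulmx_suml scaler_suml; apply: eq_bigr => i _; exact: dW_torus.
have gh : g *m invmx g = 1%:M by rewrite mulmxV.
have e : W g *m dW 1%:M *m W (invmx g) = dW 1%:M.
  by rewrite (dpolymap_conj WM_unit) // mulmx1 gh.
by rewrite -[X in _ = X *m _]e -[RHS]mulmxA -WM mulVmx // W1 mulmx1.
Qed.

Lemma sum_char1 x : \sum_i char1 i x = (\sum_i (lam i)%:R) * char x.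
Proof.
under eq_bigr do rewrite -char1E.
rewrite -raddf_sum -mulmx_sumr /= (_ : \sum_i dW (E i i) = dW 1%:M).
  by rewrite dW1_scalar mul_mx_scalar mxtraceZ.
rewrite -linear_sum; congr (dW _); apply/matrixP=> i j; rewrite summxE !mxE.
rewrite (bigD1 i) //= mxE eqxx /= big1 ?addr0 => [|k ki]; first by rewrite eq_sym.
by rewrite mxE [i == k]eq_sym (negPf ki).
Qed.

(** The radial part of the Casimir operator: its trace against a torus element is computed once as a
    scalar and once summand by summand. *)
Lemma radial_equation x : generic x ->
  casimir_value * char x = \sum_i char2 i x +
    \sum_i \sum_(j | j != i) x 0 i / (x 0 i - x 0 j) * (char1 i x - char1 j x).
Proof.
move=> gx; rewrite /char -mxtraceZ -mul_mx_scalar -casimir_scalar.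
rewrite /casimir mulmx_sumr raddf_sum -big_split; apply: eq_bigr => i _ /=.
rewrite mulmx_sumr raddf_sum (bigD1 i) //= char2E; congr (_ + _).
by apply: eq_bigr => j ji; rewrite char_offdiag // eq_sym.
Qed.

End Characters.

(** * The Weyl character formula *)

Definition stair N (i : 'I_N) : nat := N - i.+1.

Section Alternants.
Variables (A : comNzRingType) (N : nat).
Implicit Types (x : 'rV[A]_N) (e : 'I_N -> nat).

Definition alternant x e : A := \det (\matrix_(i, j) x 0 i ^+ e j).

Definition vdm x : A := \prod_(i < N) \prod_(j < N | (i < j)%N) (x 0 i - x 0 j).

Lemma alternantE x e :
  alternant x e = \sum_(s : 'S_N) (-1) ^+ s * monom x (fun i => e (s i)).
Proof. by apply: eq_bigr => s _; congr (_ * _); apply: eq_bigr => i _; rewrite mxE. Qed.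

Lemma det_rev (M : 'M[A]_N) : \det (\matrix_(i, j) M (rev_ord i) (rev_ord j)) = \det M.
Proof.
pose s : 'S_N := perm rev_ord_inj.
have -> : \matrix_(i, j) M (rev_ord i) (rev_ord j) = row_perm s (col_perm s M).
  by apply/matrixP=> i j; rewrite !mxE !permE.
rewrite row_permE col_permE !det_mulmx !det_perm odd_permV.
by rewrite mulrC -mulrA -signr_addb addbb mulr1.
Qed.

Lemma alternant_stair x : alternant x (@stair N) = vdm x.
Proof.
rewrite /alternant -det_tr.
transitivity (\det (Vandermonde N (\row_j x 0 (rev_ord j)))).
  by rewrite -det_rev; congr (\det _); apply/matrixP=> i j; rewrite !mxE rev_ordK.
rewrite det_Vandermonde /vdm [LHS](reindex_inj rev_ord_inj) /=.
under eq_bigr do rewrite (reindex_inj rev_ord_inj) /=.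
rewrite (exchange_big_dep xpredT) //=; apply: eq_bigr => i _.
apply: eq_big => [j|j _]; last by rewrite !mxE !rev_ordK.
by have := ltn_ord i; have := ltn_ord j; lia.
Qed.

End Alternants.

Lemma vdm_map (A B : comNzRingType) (f : {rmorphism A -> B}) N (x : 'rV[A]_N) :
  f (vdm x) = vdm (map_mx f x).
Proof.
rewrite rmorph_prod; apply: eq_bigr => i _; rewrite rmorph_prod; apply: eq_bigr => j _.
by rewrite rmorphB !mxE.
Qed.

Lemma monom_map (A B : comNzRingType) (f : {rmorphism A -> B}) N (x : 'rV[A]_N) e :
  f (monom x e) = monom (map_mx f x) e.
Proof. by rewrite rmorph_prod; apply: eq_bigr => i _; rewrite rmorphXn mxE. Qed.

Lemma deriv_prod_log (C : fieldType) (I : Type) (r : seq I) (P : pred I) (F : I -> {poly C}) a :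
  (forall k, P k -> (F k).[a] != 0) ->
  (\prod_(k <- r | P k) F k)^`().[a] =
  (\prod_(k <- r | P k) F k).[a] * \sum_(k <- r | P k) (F k)^`().[a] / (F k).[a].
Proof.
move=> H; elim: r => [|k r IH].
  by rewrite !big_nil -polyC1 derivC horner0 mulr0.
rewrite !big_cons; case: ifP => Pk //; rewrite derivM hornerD !hornerM IH mulrDr.
rewrite mulrA; congr (_ + _); last by rewrite mulrA.
by have Fk := H k Pk; field.
Qed.

Section VdmDerivative.
Variables (C : numFieldType) (N : nat).
Implicit Types x : 'rV[C]_N.

(** The operator [x_i d/dx_i] applied to [alternant x e], term by term. *)
Definition alternant1 x (e : 'I_N -> nat) i : C :=
  \sum_(s : 'S_N) (-1) ^+ s * (e (s i))%:R * monom x (fun i => e (s i)).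

Lemma big_pair_split (F : 'I_N -> 'I_N -> C) (i : 'I_N) :
  (forall k l, k != i -> l != i -> F k l = 0) ->
  \sum_(k < N) \sum_(l < N | (k < l)%N) F k l =
  \sum_(l < N | (i < l)%N) F i l + \sum_(k < N | (k < i)%N) F k i.
Proof.
move=> F0; rewrite (bigD1 i) //=; congr (_ + _).
rewrite [RHS]big_mkcond [RHS](bigD1 i) //= ltnn add0r; apply: eq_bigr => k ki.
rewrite big_mkcond /= (bigD1 i) //= big1 ?addr0 // => l li.
by rewrite F0 // if_same.
Qed.

(** Differentiate in the [i]-th variable in two ways: the Leibniz expansion of the determinant, and
    the logarithmic derivative of the product, where only factors containing that variable
    survive. *)
Lemma vdm_derivative x i : (forall k l, k != l -> x 0 k != x 0 l) ->
  alternant1 x (@stair N) i = vdm x * \sum_(j | j != i) x 0 i / (x 0 i - x 0 j).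
Proof.
move=> xd; pose y : 'rV[{poly C}]_N := \row_j if j == i then 'X else (x 0 j)%:P.
have ey : map_mx (horner_eval (x 0 i)) y = x.
  apply/rowP=> j; rewrite !mxE /horner_eval.
  by have [->|_] := eqVneq j i; rewrite ?hornerX ?hornerC.
have yi : y 0 i = 'X by rewrite mxE eqxx.
have yn j : j != i -> y 0 j = (x 0 j)%:P by rewrite mxE => /negPf ->.
have yh j : (y 0 j).[x 0 i] = x 0 j.
  by have /rowP/(_ j) := ey; rewrite [LHS]mxE.
transitivity (x 0 i * (vdm y)^`().[x 0 i]).
  rewrite -alternant_stair alternantE raddf_sum horner_sum big_distrr /=.
  apply: eq_bigr => s _.
  have -> : monom y (fun i => stair (s i)) =
      (\prod_(j | j != i) x 0 j ^+ stair (s j))%:P * 'X^(stair (s i)).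
    rewrite /monom (bigD1 i) //= yi mulrC rmorph_prod; congr (_ * _).
    by apply: eq_bigr => j ji; rewrite yn // rmorphXn.
  rewrite -(rmorph_sign (@polyC C)) !derivM !derivC !mul0r !add0r.
  rewrite derivXn !hornerM !hornerC hornerMn hornerXn.
  rewrite /monom (bigD1 i) //=; case: (stair (s i)) => [|n]; first by rewrite !mulr0n !(mulr0, mul0r).
  rewrite exprS -[X in _ = _ * (_ * (_ * X))]mulr_natr /=.
  move: (\prod_(_ | _) _) ((-1) ^+ _) => p g.
  move: (x 0 i) (x 0 i ^+ n) (n.+1%:R : C) => a b k; ring.
have nz (k l : 'I_N) : (k < l)%N -> (y 0 k - y 0 l).[x 0 i] != 0.
  move=> kl; rewrite hornerD hornerN !yh subr_eq0 xd //.
  by apply: contraTneq kl => ->; rewrite ltnn.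
have -> : (vdm y)^`().[x 0 i] = (vdm y).[x 0 i] * \sum_(k < N) \sum_(l < N | (k < l)%N)
    (y 0 k - y 0 l)^`().[x 0 i] / (x 0 k - x 0 l).
  rewrite /vdm deriv_prod_log; last first.
    by move=> k _; rewrite horner_prod; apply/prodf_neq0 => l; exact: nz.
  congr (_ * _); apply: eq_bigr => k _.
  rewrite deriv_prod_log; last by move=> l; exact: nz.
  rewrite mulrC mulrA mulVf ?mul1r; last first.
    by rewrite horner_prod; apply/prodf_neq0 => l; exact: nz.
  by apply: eq_bigr => l _; rewrite hornerD hornerN !yh.
rewrite (big_pair_split (i := i)); last first.
  by move=> k l ki li; rewrite !yn // -polyCB derivC hornerC mul0r.
have -> : (vdm y).[x 0 i] = vdm x by rewrite -[LHS]/(horner_eval _ _) vdm_map ey.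
rewrite mulrCA; congr (_ * _); rewrite mulrDr !big_distrr /=.
rewrite [RHS](bigID (fun j : 'I_N => (i < j)%N)) /=; congr (_ + _).
  apply: eq_big => [j|j ij]; first by rewrite -val_eqE /=; case: ltngtP.
  rewrite yi yn; last by rewrite -val_eqE /= gtn_eqF.
  by rewrite derivB derivX derivC subr0 hornerC mul1r.
apply: eq_big => [j|j ij]; first by rewrite -val_eqE /=; case: ltngtP.
rewrite yi yn; last by rewrite -val_eqE /= ltn_eqF.
rewrite derivB derivX derivC sub0r hornerN hornerC mulN1r -invrN opprB //.
Qed.

End VdmDerivative.

Section GroupSums.
Variables (A : nmodType) (N : nat) (I : finType) (c : I -> A) (e : I -> 'I_N -> nat).

(** The coefficient of the monomial with exponent [k] in the sum of the [c a * monom x (e a)], whose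
    exponents may repeat. *)
Definition group_sum (k : 'I_N -> nat) : A := \sum_(a | [forall i, e a i == k i]) c a.

Lemma eq_group_sum k k' : k =1 k' -> group_sum k = group_sum k'.
Proof. by move=> E; apply: eq_bigl => a; apply: eq_forallb => i; rewrite E. Qed.

Let B := (\sum_a \sum_i e a i).+1.
Let code (a : I) : {ffun 'I_N -> 'I_B} := [ffun i => inord (e a i)].

Let codeE a i : code a i = e a i :> nat.
Proof.
by rewrite ffunE inordK // ltnS (bigD1 a) //= (bigD1 i) //= -addnA leq_addr.
Qed.

Let codeP a (w : {ffun 'I_N -> 'I_B}) : (code a == w) = [forall i, e a i == w i :> nat].
Proof.
apply/eqP/forallP => [<- i|E]; first by rewrite codeE.
by apply/ffunP=> i; apply/val_inj => /=; rewrite codeE (eqP (E i)).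
Qed.

Lemma sum_by_groups (Q : ('I_N -> nat) -> bool) :
  (forall k k', k =1 k' -> Q k = Q k') ->
  \sum_(a | Q (e a)) c a =
  \sum_(w : {ffun 'I_N -> 'I_B} | Q (wt_nat w)) group_sum (wt_nat w).
Proof.
move=> Qext; rewrite (partition_big code (fun w => Q (wt_nat w))) /=; last first.
  by move=> a; rewrite (Qext (wt_nat (code a)) (e a)) // => i; rewrite /wt_nat codeE.
apply: eq_bigr => w Qw; apply: eq_bigl => a; rewrite codeP andbC.
case: forallP => //= E; rewrite (Qext (e a) (wt_nat w)) // => i.
by rewrite (eqP (E i)).
Qed.

Lemma sum_one_group (Q : ('I_N -> nat) -> bool) k :
  (forall k k', k =1 k' -> Q k = Q k') -> Q k ->
  (forall k', Q k' -> group_sum k' != 0 -> k' =1 k) ->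
  \sum_(a | Q (e a)) c a = group_sum k.
Proof.
move=> Qext Qk H; rewrite sum_by_groups //.
have [/existsP[w /forallP wk]|/existsPn nw] :=
  boolP [exists w : {ffun 'I_N -> 'I_B}, [forall i, wt_nat w i == k i]].
  have {}wk : wt_nat w =1 k by move=> i; apply/eqP.
  rewrite (bigD1 w) ?(Qext _ _ wk) //= (eq_group_sum wk) big1 ?addr0 // => w' /andP[Qw' ne].
  apply: contraNeq ne => /(H _ Qw') w'k; apply/eqP/ffunP=> i; apply/val_inj.
  by rewrite /= -/(wt_nat w' i) w'k -wk.
rewrite big1 => [|w Qw]; last first.
  by have := nw w; apply: contraNeq => /(H _ Qw) wk; apply/forallP => i; rewrite wk.
rewrite /group_sum big_pred0 // => a; apply/negbTE; have := nw (code a).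
by apply: contra => /forallP E; apply/forallP=> i; rewrite /wt_nat codeE.
Qed.

End GroupSums.

Lemma sum_groups0 (C : comNzRingType) N (I : finType) (c : I -> C) (e : I -> 'I_N -> nat) x :
  (forall k, group_sum c e k = 0) -> \sum_a c a * monom x (e a) = 0.
Proof.
move=> H; pose B := (\sum_a \sum_i e a i).+1.
pose code (a : I) : {ffun 'I_N -> 'I_B} := [ffun i => inord (e a i)].
have codeE a i : code a i = e a i :> nat.
  by rewrite ffunE inordK // ltnS (bigD1 a) //= (bigD1 i) //= -addnA leq_addr.
rewrite (partition_big code predT) //= big1 // => w _.
transitivity (group_sum c e (wt_nat w) * monom x (wt_nat w)); last by rewrite H mul0r.
rewrite big_distrl /=; apply: eq_big => [a|a /eqP <-]; last first.
  by congr (_ * _); apply: eq_bigr => i _; rewrite /wt_nat codeE.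
apply/eqP/forallP => [<- i|E]; first by rewrite /wt_nat codeE.
by apply/ffunP=> i; apply/val_inj => /=; rewrite codeE (eqP (E i)).
Qed.

Lemma sort_perm N (k : 'I_N -> nat) : injective k ->
  exists s : 'S_N, strictly_dec (k \o s).
Proof.
move=> kinj; pose t := [tuple k i | i < N].
have /tuple_permP[s Es] : perm_eq (sort geq t) t by rewrite perm_sort.
exists s => i j ij /=.
have nthE (l : 'I_N) : nth 0%N (sort geq t) l = k (s l).
  by rewrite Es -tnth_nth tnth_mktuple tnth_mktuple.
have gt : transitive geq by move=> a b d; rewrite /geq /= => ab bd; exact: leq_trans bd ab.
have st : sorted geq (sort geq t) by apply: sort_sorted => a b; exact: leq_total.
have sz : size (sort geq t) = N by rewrite size_sort size_tuple.
have := sorted_ltn_nth gt 0%N st; move=> /(_ i j); rewrite !inE sz !ltn_ord => /(_ isT isT ij).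
rewrite !nthE /geq /= leq_eqVlt => /orP[/eqP/kinj/perm_inj ji|//].
by move: ij; rewrite ji ltnn.
Qed.

Lemma monomD (A : comNzRingType) N (x : 'rV[A]_N) e e' :
  monom x (fun i => e i + e' i)%N = monom x e * monom x e'.
Proof. by rewrite /monom -big_split; apply: eq_bigr => i _; rewrite exprD. Qed.

Lemma eq_pairing N (h h' e e' : 'I_N -> nat) : h =1 h' -> e =1 e' -> pairing h e = pairing h' e'.
Proof. by move=> E E'; apply: eq_bigr => i _; rewrite E E'. Qed.

Lemma pairingD N (h e e' : 'I_N -> nat) :
  pairing h (fun i => e i + e' i)%N = (pairing h e + pairing h e')%N.
Proof. by rewrite /pairing -big_split; apply: eq_bigr => i _; rewrite mulnDr. Qed.

(** The equality case of [2 a b <= a^2 + b^2], summed over the coordinates. *)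
Lemma pairing_eqsq N (k k' : 'I_N -> nat) :
  pairing k k = pairing k' k' -> (pairing k' k' <= pairing k' k)%N -> k =1 k'.
Proof.
move=> E le i.
have H : (\sum_i 2 * (k i * k' i) <= \sum_i (k i ^ 2 + k' i ^ 2) ?= iff [forall i, k i == k' i])%N.
  exact: (leqif_sum (fun i _ => nat_Cauchy (k i) (k' i))).
have E1 : (\sum_i 2 * (k i * k' i) = 2 * pairing k' k)%N.
  by rewrite /pairing big_distrr /=; apply: eq_bigr => j _; rewrite (mulnC (k j)).
have E2 : (\sum_i (k i ^ 2 + k' i ^ 2) = 2 * pairing k' k')%N.
  by rewrite big_split /= mul2n -addnn -{1}E; congr (_ + _)%N.
case: H => H1 H2; move: H2; rewrite (_ : (_ == _) = true); last first.
  by rewrite eqn_leq H1 E1 E2 leq_mul2l le orbT.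
by move/esym/forallP/(_ i)/eqP.
Qed.

Lemma count_gt n i : (\sum_(j < n | i < j) 1 = n - i.+1)%N.
Proof.
rewrite big_mkcond /=; elim: n => [|n IH]; first by rewrite big_ord0.
rewrite big_ord_recr /= IH; case: ltnP => ni; last by lia.
by rewrite subSS addn1 -subSn ?subSS.
Qed.

Lemma count_lt n i : (i <= n)%N -> (\sum_(j < n | j < i) 1 = i)%N.
Proof.
rewrite big_mkcond /=; elim: n => [|n IH]; first by rewrite big_ord0 leqn0 => /eqP.
rewrite big_ord_recr leq_eqVlt => /orP[/eqP ->|]; last first.
  by rewrite ltnS => le; rewrite IH //= ltnNge le addn0.
rewrite /= ltnSn; under eq_bigr do rewrite (leq_trans (ltn_ord _) (leqnSn _)).
by rewrite sum1_card card_ord addn1.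
Qed.

Definition monic_deg (A : nzRingType) n (p : {poly A}) := p \is monic /\ size p = n.+1.

Lemma monic_deg_prod (A : comNzRingType) (J : Type) (r : seq J) (P : pred J)
    (F : J -> {poly A}) (d : J -> nat) :
  (forall i, P i -> monic_deg (d i) (F i)) ->
  monic_deg (\sum_(i <- r | P i) d i)%N (\prod_(i <- r | P i) F i).
Proof.
move=> H; elim/big_rec2: _ => [|i p n Pi [mp sp]]; first by split; rewrite ?monic1 ?size_poly1.
have [mF sF] := H i Pi; split; first by rewrite monicMl.
by rewrite size_monicM ?monic_neq0 // sp sF addSn addnS.
Qed.

Lemma monic_degB (A : nzRingType) n (p : {poly A}) : (size p <= n)%N -> monic_deg n ('X^n + p).
Proof.
move=> sp; have lt : (size p < size ('X^n : {poly A}))%N by rewrite size_polyXn.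
by split; rewrite ?size_polyDl ?size_polyXn // monicE lead_coefDl // lead_coefXn.
Qed.

Section Weyl.
Variables (C : numFieldType) (N B : nat).
Local Notation Wt := {ffun 'I_N -> 'I_B}.
Variables (m : Wt -> C) (lam : 'I_N -> nat).

Definition wsum (x : 'rV[C]_N) : C := \sum_w m w * monom x (wt_nat w).
Definition wsum1 i (x : 'rV[C]_N) : C := \sum_w m w * (wt_nat w i)%:R * monom x (wt_nat w).
Definition wsum2 i (x : 'rV[C]_N) : C :=
  \sum_w m w * (wt_nat w i)%:R ^+ 2 * monom x (wt_nat w).

Let cas : C :=
  \sum_i (lam i)%:R ^+ 2 + \sum_(i < N) \sum_(j < N | (i < j)%N) ((lam i)%:R - (lam j)%:R).

Hypothesis radial : forall x, generic x ->
  cas * wsum x = \sum_i wsum2 i x +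
    \sum_i \sum_(j | j != i) x 0 i / (x 0 i - x 0 j) * (wsum1 i x - wsum1 j x).
Hypothesis homogeneous : forall x, \sum_i wsum1 i x = (\sum_i (lam i)%:R) * wsum x.
Hypothesis weights_le : forall h w, strictly_dec h -> m w != 0 ->
  (pairing h (wt_nat w) <= pairing h lam ?= iff [forall i, wt_nat w i == lam i])%N.
Hypothesis weight_lam : exists2 w, wt_nat w =1 lam & m w = 1.
Hypothesis wsum_sym : forall (s : 'S_N) (x : 'rV[C]_N), wsum (\row_i x 0 (s i)) = wsum x.
Hypothesis lam_dec : forall i j : 'I_N, (i <= j)%N -> (lam j <= lam i)%N.

Let bet i : nat := (lam i + stair i)%N.
Let I : finType := ('S_N * Wt)%type.
Let e (a : I) i : nat := (stair (a.1 i) + wt_nat a.2 i)%N.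
Let c (a : I) : C := (-1) ^+ a.1 * m a.2.

Let vdm_wsum x : vdm x * wsum x = \sum_a c a * monom x (e a).
Proof.
rewrite -alternant_stair alternantE mulr_suml.
rewrite (eq_bigr _ (fun s _ => mulr_sumr _ _ _ _)) pair_big /=.
by apply: eq_bigr => -[s w] _; rewrite /c /e monomD /= mulrACA.
Qed.

Let stair_sq : C := \sum_(i < N) (stair i)%:R ^+ 2.

Let sum_stair_sq (s : 'S_N) : \sum_i (stair (s i))%:R ^+ 2 = stair_sq.
Proof. by rewrite /stair_sq [RHS](reindex_inj (@perm_inj _ s)). Qed.

Let sum_lt (F : 'I_N -> C) : \sum_(i < N) \sum_(j < N | (i < j)%N) F i =
  \sum_i F i * (stair i)%:R.
Proof.
apply: eq_bigr => i _; rewrite sumr_const mulr_natr; congr (_ *+ _).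
by rewrite -sum1_card (eq_bigl (fun j : 'I_N => (i < j)%N)) // count_gt.
Qed.

Let sum_gt (F : 'I_N -> C) : \sum_(i < N) \sum_(j < N | (i < j)%N) F j =
  \sum_(i < N) F i * (i : nat)%:R.
Proof.
rewrite (exchange_big_dep predT) //=; apply: eq_bigr => i _.
rewrite sumr_const mulr_natr; congr (_ *+ _).
by rewrite -sum1_card (eq_bigl (fun j : 'I_N => (j < i)%N)) // count_lt // ltnW.
Qed.

(** Expand the squared norm of [lam + stair], using [2 * stair i = (stair i - i) + (N - 1)]: the
    first part pairs with [lam] to the positive roots, the second to the degree. *)
Let eigenvalue_eq :
  stair_sq + (cas + (N%:R - 1) * \sum_i (lam i)%:R) = (pairing bet bet)%:R.
Proof.
rewrite /cas /stair_sq; under [X in _ + (_ + X + _)]eq_bigr do rewrite sumrB.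
rewrite sumrB sum_lt sum_gt mulr_sumr /pairing natr_sum -sumrB -!big_split /=.
apply: eq_bigr => i _.
have -> : N%:R = (stair i)%:R + (i : nat)%:R + 1 :> C.
  by rewrite -natrD -[1]/(1%:R) -natrD; congr _%:R; rewrite /stair; have := ltn_ord i; lia.
by rewrite natrM natrD; move: (stair _)%:R (lam _)%:R (i : nat)%:R => a b k; ring.
Qed.

(** The product rule for the second-order operator leaves the cross terms
    [2 (x_i d vdm) (x_i d chi)]. By [vdm_derivative] they are the first-order part of the radial
    equation, up to a multiple of the degree. *)
Let laplace x : generic x ->
  \sum_a c a * (pairing (e a) (e a))%:R * monom x (e a) =
  (pairing bet bet)%:R * (vdm x * wsum x).
Proof.
move=> gx; have [x0 xd] := gx.
have -> : \sum_a c a * (pairing (e a) (e a))%:R * monom x (e a) =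
  stair_sq * (vdm x * wsum x) +
  \sum_i (2 * (alternant1 x (@stair N) i * wsum1 i x) + vdm x * wsum2 i x).
  transitivity (\sum_(a : I) (stair_sq * (c a * monom x (e a)) +
      \sum_i (2 * (((-1) ^+ a.1 * (stair (a.1 i))%:R * monom x (fun i => stair (a.1 i))) *
                   (m a.2 * (wt_nat a.2 i)%:R * monom x (wt_nat a.2))) +
              ((-1) ^+ a.1 * monom x (fun i => stair (a.1 i))) *
                   (m a.2 * (wt_nat a.2 i)%:R ^+ 2 * monom x (wt_nat a.2))))).
    apply: eq_bigr => -[s w] _; rewrite /c /e /= -(sum_stair_sq s) /pairing natr_sum.
    rewrite mulr_sumr !mulr_suml -big_split /=; apply: eq_bigr => i _.
    rewrite natrM natrD monomD; move: ((-1) ^+ _) (monom _ _) (monom _ _) => g p q.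
    by move: (stair _)%:R (wt_nat _ _)%:R (m w) => a b k; ring.
  rewrite big_split /= -mulr_sumr -vdm_wsum; congr (_ + _).
  rewrite exchange_big /=; apply: eq_bigr => i _; rewrite big_split /= -mulr_sumr.
  congr (2 * _ + _); rewrite -?alternant_stair ?alternantE mulr_suml;
    rewrite [RHS](eq_bigr _ (fun s _ => mulr_sumr _ _ _ _)) pair_big /=; exact: eq_bigr.
rewrite -eigenvalue_eq mulrDl; congr (_ + _).
have E : \sum_i (2 * (alternant1 x (@stair N) i * wsum1 i x) + vdm x * wsum2 i x) =
   vdm x * (\sum_i wsum2 i x + \sum_i (\sum_(j | j != i) x 0 i / (x 0 i - x 0 j)) * wsum1 i x *+ 2).
  rewrite mulrDr !mulr_sumr -big_split; apply: eq_bigr => i _.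
  rewrite vdm_derivative //= addrC; congr (_ + _).
  by move: (vdm x) (wsum1 i x) (\sum_(_ | _) _) => p q r; ring.
rewrite E mulrCA; congr (_ * _); rewrite mulrDl radial // -mulrA -homogeneous -addrA; congr (_ + _).
have -> : \sum_i \sum_(j | j != i) x 0 i / (x 0 i - x 0 j) * (wsum1 i x - wsum1 j x) =
  \sum_i \sum_(j | j != i) (x 0 i / (x 0 i - x 0 j) - x 0 j / (x 0 j - x 0 i)) * wsum1 i x.
  under eq_bigr do under eq_bigr do rewrite mulrBr.
  under [RHS]eq_bigr do under eq_bigr do rewrite mulrBl.
  under eq_bigr do rewrite sumrB; under [RHS]eq_bigr do rewrite sumrB.
  rewrite !sumrB; congr (_ - _); rewrite (exchange_big_dep predT) //=.
  by apply: eq_bigr => i _; apply: eq_bigl => j; rewrite eq_sym.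
rewrite mulr_sumr -big_split; apply: eq_bigr => i _ /=.
rewrite -mulr_suml -mulrDl -mulrnAl; congr (_ * _).
(* After symmetrization each coefficient is [(x_i + x_j) / (x_i - x_j) = 2 x_i / (x_i - x_j) - 1];
   the [N - 1] terms -1 cancel against the homogeneity term. *)
transitivity (\sum_(j | j != i) (2 * (x 0 i / (x 0 i - x 0 j)) - 1) + (N%:R - 1)).
  rewrite sumrB -mulr_sumr sumr_const cardC1 card_ord.
  have -> : N%:R - 1 = (N.-1)%:R :> C.
    by case: (N) (i) => [[]//|n _]; rewrite -natr1 addrK.
  by rewrite subrK mulr_sumr -mulr_natl mulr_sumr.
congr (_ + _); apply: eq_bigr => j ji.
have xij : x 0 i - x 0 j != 0 by rewrite subr_eq0 xd // eq_sym.
have xji : x 0 j - x 0 i != 0 by rewrite subr_eq0 xd.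
by field; rewrite xij xji.
Qed.

Let f := group_sum c e.

Let f_norm k : f k != 0 -> pairing k k = pairing bet bet.
Proof.
move=> fk; apply/eqP; rewrite -(eqr_nat C) -subr_eq0.
have : \sum_(a | [forall i, e a i == k i])
    c a * ((pairing (e a) (e a))%:R - (pairing bet bet)%:R) = 0.
  apply: (monom_indep (c := fun a => c a * _) (e := e)) => x gx.
  transitivity (\sum_a c a * (pairing (e a) (e a))%:R * monom x (e a) -
      (pairing bet bet)%:R * \sum_a c a * monom x (e a)).
    rewrite mulr_sumr -sumrB; apply: eq_bigr => a _.
    by rewrite mulrBr mulrBl; congr (_ - _); rewrite mulrCA mulrA.
  by rewrite laplace // vdm_wsum subrr.
rewrite (eq_bigr (fun a => c a * ((pairing k k)%:R - (pairing bet bet)%:R))).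
  by rewrite -mulr_suml => /eqP; rewrite mulf_eq0 (negPf fk).
by move=> a /forallP E; rewrite (@eq_pairing _ (e a) k (e a) k) // => i; apply/eqP.
Qed.

(** The product of [vdm] and [wsum] restricted to the one-parameter torus [X ^ h]. *)
Let F (h : 'I_N -> nat) : {poly C} := \sum_a c a *: 'X^(pairing h (e a)).

Let bet_dec : strictly_dec bet.
Proof.
move=> i j ij; rewrite /bet /stair; have := lam_dec (ltnW ij); have := ltn_ord j; lia.
Qed.

Let F_factor h : F h = vdm (\row_i 'X^(h i)) * \sum_w m w *: 'X^(pairing h (wt_nat w)).
Proof.
have mE (k : 'I_N -> nat) : monom (\row_i ('X^(h i) : {poly C})) k = 'X^(pairing h k).
  by rewrite /monom /pairing -prodrXr; apply: eq_bigr => i _; rewrite mxE exprM.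
rewrite -alternant_stair alternantE mulr_suml.
rewrite (eq_bigr _ (fun s _ => mulr_sumr _ _ _ _)) pair_big /=.
apply: eq_bigr => -[s w] _; rewrite /c /e /= mE pairingD exprD -!mul_polyC rmorphM rmorph_sign.
by rewrite mulrACA.
Qed.

(** Every Vandermonde factor is led by [X ^ h i], and [lam] is the only weight of maximal pairing,
    with coefficient 1. *)
Let F_monic h : strictly_dec h -> monic_deg (pairing h bet) (F h).
Proof.
move=> hd; have mv : monic_deg (pairing h (@stair N)) (vdm (\row_i ('X^(h i) : {poly C}))).
  have -> : pairing h (@stair N) = (\sum_(i < N) \sum_(j < N | (i < j)%N) h i)%N.
    apply: eq_bigr => i _; rewrite sum_nat_const mulnC; congr (_ * _)%N.
    by rewrite -sum1_card (eq_bigl (fun j : 'I_N => (i < j)%N)) // count_gt.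
  apply: monic_deg_prod => i _; apply: monic_deg_prod => j ij; rewrite !mxE.
  by apply: monic_degB; rewrite size_polyN size_polyXn hd.
have [w0 w0l mw0] := weight_lam.
have mw : monic_deg (pairing h lam) (\sum_w m w *: 'X^(pairing h (wt_nat w))).
  rewrite (bigD1 w0) //= mw0 scale1r (eq_pairing (frefl h) w0l); apply: monic_degB.
  apply: leq_trans (size_sum _ _ _) _; apply/bigmax_leqP => w ne.
  have [->|mw] := eqVneq (m w) 0; first by rewrite scale0r size_poly0.
  apply: leq_trans (size_scale_leq _ _) _; rewrite size_polyXn.
  have [le eq] := weights_le hd mw; rewrite ltn_neqAle le eq andbT.
  apply: contra ne => /forallP E; apply/eqP/ffunP => i; apply/val_inj => /=.
  by rewrite -/(wt_nat w i) (eqP (E i)) -w0l.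
have [m1 s1] := mv; have [m2 s2] := mw; rewrite F_factor; split; first by rewrite monicMl.
by rewrite size_monicM ?monic_neq0 // s1 s2 addSn addnS /= addnC -pairingD.
Qed.

(** With [h = k], Cauchy-Schwarz shows that [k] is the only exponent of its norm whose pairing with
    [k] is [<k, k>], so this coefficient of [F k] isolates [f k]. *)
Let F_coef k : pairing k k = pairing bet bet -> (F k)`_(pairing k k) = f k.
Proof.
move=> kn; rewrite /f -(sum_one_group (Q := fun k' => pairing k k' == pairing k k)) //.
- rewrite coef_sum [RHS]big_mkcond; apply: eq_bigr => a _; rewrite coefZ coefXn eq_sym.
  by case: eqP; rewrite ?mulr1 ?mulr0.
- by move=> k1 k2 E; rewrite (eq_pairing (frefl k) E).
- by move=> k' /eqP E fk'; apply: pairing_eqsq; rewrite ?E // kn f_norm.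
Qed.

(** A nonzero coefficient at [<k, k>] cannot lie beyond the degree [<k, bet>] of [F k]. *)
Let f_dec k : strictly_dec k -> f k != 0 -> bet =1 k.
Proof.
move=> kd fk; have kn := f_norm fk; apply: pairing_eqsq => //.
have [_ sF] := F_monic kd; rewrite -ltnS -sF ltnNge.
by apply: contra fk => /(nth_default 0); rewrite F_coef // => ->.
Qed.

Let f_bet : f bet = 1.
Proof.
have [mF sF] := F_monic bet_dec; rewrite -F_coef //.
by move/eqP: mF; rewrite /lead_coef sF.
Qed.

Let wt_perm (s : 'S_N) (w : Wt) : Wt := [ffun i => w (s i)].

Let m_sym s w : m (wt_perm s w) = m w.
Proof.
have H : forall w, m (wt_perm s w) - m w = 0.
  move=> {}w; have := monom_indep (c := fun w => m (wt_perm s w) - m w) (e := @wt_nat N B) _ (wt_nat w).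
  rewrite (big_pred1 w) => [->//|w' /=]; last first.
    apply/forallP/eqP => [E|-> //]; by apply/ffunP=> k; apply/val_inj/eqP; exact: E.
  move=> x gx; under eq_bigr do rewrite mulrBl.
  rewrite sumrB -/(wsum x) -(wsum_sym s x) /wsum (reindex_inj (h := wt_perm s^-1)) /=; last first.
    move=> w1 w2 /ffunP E; apply/ffunP => i; have := E (s i).
    by rewrite !ffunE permK.
  rewrite -sumrB big1 // => w1 _.
  have -> : wt_perm s (wt_perm s^-1 w1) = w1 by apply/ffunP => i; rewrite !ffunE permK.
  apply/eqP; rewrite subr_eq0; apply/eqP; congr (_ * _).
  rewrite /monom [LHS](reindex_inj (@perm_inj _ s)) /=.
  by apply: eq_bigr => i _; rewrite /wt_nat ffunE mxE permK.
by apply/eqP; rewrite -subr_eq0 H.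
Qed.

Let f_perm (s : 'S_N) k : f (k \o s) = (-1) ^+ s * f k.
Proof.
pose g (a : I) : I := (s * a.1, wt_perm s a.2)%g.
have ginj : injective g.
  move=> [s1 w1] [s2 w2] [/mulgI -> /ffunP E]; congr pair; apply/ffunP => i.
  by have := E (s^-1%g i); rewrite !ffunE permKV.
rewrite /f /group_sum (reindex_inj ginj) mulr_sumr; apply: eq_big => [a|a _].
  apply/forallP/forallP => E i.
    by have := E (s^-1%g i); rewrite /e /g /wt_nat /= permM ffunE permKV.
  by have := E (s i); rewrite /e /g /wt_nat /= permM ffunE.
by rewrite /c /g /= m_sym odd_permM signr_addb mulrA.
Qed.

Let bet_inj : injective bet.
Proof.
move=> i j E; apply/val_inj; case: (ltngtP i j) => // /bet_dec; by rewrite E ltnn.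
Qed.

(** Compare coefficients. On the permutations of [bet] both sides alternate and agree at [bet].
    Elsewhere a repeated entry gives 0 by a transposition, and distinct entries can be sorted,
    contradicting [f_dec]. *)
Lemma weyl_formula x : vdm x * wsum x = alternant x bet.
Proof.
rewrite vdm_wsum alternantE; apply/eqP; rewrite -subr_eq0; apply/eqP.
pose J : finType := (I + 'S_N)%type.
pose cJ (a : J) : C := match a with inl a => c a | inr s => - (-1) ^+ s end.
pose eJ (a : J) : 'I_N -> nat := match a with inl a => e a | inr s => bet \o s end.
transitivity (\sum_a cJ a * monom x (eJ a)).
  rewrite big_sumType /= -sumrN; congr (_ + _).
  by apply: eq_bigr => s _; rewrite mulNr.
apply: sum_groups0 => k; rewrite /group_sum big_sumType /= -/(group_sum c e k) -/f.
have [/existsP[s /forallP Es]|/existsPn ns] := boolP [exists s : 'S_N, [forall i, bet (s i) == k i]].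
  have Ek : k =1 bet \o s by move=> i; rewrite /= (eqP (Es i)).
  rewrite /f (eq_group_sum c e Ek) -/f f_perm f_bet mulr1 (big_pred1 s) ?subrr // => s' /=.
  apply/forallP/eqP => [E|-> //]; apply/permP => i; apply: bet_inj.
  by rewrite (eqP (E i)) Ek.
rewrite [X in _ + X]big_pred0 ?addr0 => [|s]; last by apply/negbTE; exact: ns.
apply/eqP/negPn/negP => fk.
have kinj : injective k.
  move=> i j kij; apply/eqP/negPn/negP => ij; case/eqP: fk.
  have /eq_group_sum H : k \o tperm i j =1 k.
    by move=> l /=; case: tpermP => // ->.
  have := f_perm (tperm i j) k; rewrite /f H odd_tperm ij expr1 mulN1r => /eqP.
  by rewrite -addr_eq0 -mulr2n mulrn_eq0 => /eqP.
have [s sd] := sort_perm kinj.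
have /(f_dec sd) E : f (k \o s) != 0 by rewrite f_perm mulf_neq0 ?signr_eq0.
case/negP: (ns (s^-1)%g); apply/forallP => i.
by rewrite E /= permKV.
Qed.

End Weyl.

(** * Traces on the component of determinant -1 *)

Lemma monom_ext (C : numFieldType) N (I : finType) (c : I -> C) (e : I -> 'I_N -> nat) :
  (forall x, generic x -> \sum_a c a * monom x (e a) = 0) ->
  forall x, \sum_a c a * monom x (e a) = 0.
Proof. by move=> H x; apply: sum_groups0; exact: monom_indep H. Qed.

Lemma char_poly_conj (F : fieldType) n (P g t : 'M[F]_n) : P \in unitmx ->
  P *m g = t *m P -> char_poly g = char_poly t.
Proof.
move=> Pu E; have E' : map_mx polyC P *m char_poly_mx g = char_poly_mx t *m map_mx polyC P.
  rewrite /char_poly_mx mulmxBr mulmxBl -!map_mxM E; congr (_ - _).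
  by rewrite scalar_mxC.
have := congr1 determinant E'; rewrite !det_mulmx mulrC => /mulIf; apply.
by rewrite det_map_mx polyC_eq0 -unitfE -unitmxE.
Qed.

Lemma char_poly_inv_trig (F : fieldType) n (t : 'M[F]_n) : t \in unitmx -> is_trig_mx t ->
  char_poly (invmx t) = \prod_i ('X - ((t i i)^-1)%:P).
Proof.
move=> tu tt; have E : map_mx polyC t *m char_poly_mx (invmx t) = 'X *: map_mx polyC t - 1%:M.
  rewrite /char_poly_mx mulmxBr -map_mxM mulmxV // map_mx1; congr (_ - _).
  by rewrite mul_mx_scalar.
have dt : \det (map_mx polyC t) = \prod_i (t i i)%:P.
  by rewrite det_map_mx (det_trig tt) rmorph_prod.
have tn i : t i i != 0.
  by move: tu; rewrite unitmxE unitfE (det_trig tt) => /prodf_neq0 H; exact: H.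
have := congr1 determinant E; rewrite det_mulmx dt [X in _ = X]det_trig; last first.
  apply/is_trig_mxP => i j ij; rewrite !mxE (is_trig_mxP tt) // polyC0 mulr0 sub0r.
  by rewrite (_ : (i == j) = false) ?oppr0 //; apply: ltn_eqF.
under [X in _ = X]eq_bigr => i _.
  rewrite !mxE eqxx (_ : _ - _ = (t i i)%:P * ('X - ((t i i)^-1)%:P)); last first.
    by rewrite mulrBr -polyCM divff // [X in X - _]mulrC.
  over.
rewrite big_split /=; apply: mulfI; apply/prodf_neq0 => i _.
by rewrite polyC_eq0.
Qed.

Section Spectrum.
Variables (C : numClosedFieldType) (N K d : nat).
Variable c : 'I_d -> 'I_d -> 'M[C]_#|tensidx N K|.
Hypothesis N0 : (0 < N)%N.

Local Notation W := (polymap c).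
Local Notation WX := (polymapX c).
Local Notation char := (char c).

Hypothesis W1 : W 1%:M = 1%:M.
Hypothesis WM : forall g h, W (g *m h) = W g *m W h.

Lemma trW_conj P g t : P \in unitmx -> P *m g = t *m P -> \tr (W g) = \tr (W t).
Proof.
move=> Pu E; have -> : g = invmx P *m (t *m P) by rewrite -E mulKmx.
by rewrite !WM mxtrace_mulC -mulmxA -WM mulmxV // W1 mulmx1.
Qed.

Lemma char_sym (s : 'S_N) (x : 'rV[C]_N) : char (\row_i x 0 (s i)) = char x.
Proof.
apply: (@trW_conj (perm_mx s^-1)); first exact: unitmx_perm.
apply/matrixP=> i j; rewrite mul_mx_diag mul_diag_mx !mxE.
have [<-|_] := eqVneq (s^-1%g i) j; last by rewrite mul0r mulr0.
by rewrite permKV mulrC.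
Qed.

(** The matrices [contract h t] are conjugate to [t] for nonzero parameter and end at its diagonal
    part; a polynomial trace that is constant off 0 is constant. *)
Lemma trW_trig t : is_trig_mx t -> \tr (W t) = char (\row_i t i i).
Proof.
move=> tt; pose h (i : 'I_N) := (N - i)%N.
have hd : strictly_dec h by move=> i j ij; rewrite /h; have := ltn_ord j; lia.
pose p : {poly C} := \tr (WX (contract h t)) - (\tr (W t))%:P.
have ev s : p.[s] = \tr (W (evalmx s (contract h t))) - \tr (W t).
  rewrite /p hornerD hornerN hornerC; congr (_ - _).
  by rewrite -evalmx_polymapX /evalmx trace_map_mx.
have p0 : p = 0.
  apply: (@poly_eq0_generic _ 'X); first by rewrite polyX_eq0.
  move=> s; rewrite hornerX => s0; rewrite ev; apply/eqP; rewrite subr_eq0; apply/eqP.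
  apply: (@trW_conj (diag_mx (\row_i s ^+ h i))).
    rewrite unitmxE det_diag unitfE; apply/prodf_neq0 => i _.
    by rewrite mxE expf_neq0.
  have := congr1 (evalmx s) (contractM hd tt); rewrite !evalmxM evalmx_cst.
  rewrite (_ : evalmx s (diag_mx _) = diag_mx (\row_i s ^+ h i)) //.
  apply/matrixP=> i j; rewrite !mxE /horner_eval; have [_|_] := eqVneq i j.
    by rewrite !mulr1n hornerXn.
  by rewrite !mulr0n horner0.
have := ev 0; rewrite p0 horner0 contract0 // => /esym/eqP.
by rewrite subr_eq0 => /eqP.
Qed.

Lemma char_perm (x y : 'rV[C]_N) :
  \prod_i ('X - (x 0 i)%:P) = \prod_i ('X - (y 0 i)%:P) -> char x = char y.
Proof.
move=> E; have /tuple_permP[s Es] : perm_eq [tuple x 0 i | i < N] [tuple y 0 i | i < N].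
  by apply: prod_XsubC_eq; rewrite !big_tuple; under eq_bigr do rewrite tnth_mktuple;
     under [RHS]eq_bigr do rewrite tnth_mktuple.
rewrite -(char_sym s y); congr char; apply/rowP => i; rewrite mxE.
have := congr1 (fun t => nth 0 t i) Es.
by rewrite -!tnth_nth !tnth_mktuple.
Qed.

(** Schur triangularization covers elements that are not diagonalizable. The last clause is for
    orthogonal [g], where the inverse is the transpose. *)
Lemma trW_spectrum g : exists x : 'rV[C]_N, [/\ char_poly g = \prod_i ('X - (x 0 i)%:P),
  \det g = \prod_i x 0 i, \tr (W g) = char x &
  g \in unitmx -> char_poly (invmx g) = \prod_i ('X - ((x 0 i)^-1)%:P)].
Proof.
have [P PU tt] := Schur g N0; have Pu := unitarymx_unit PU.
pose t := P *m g *m invmx P.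
have E : P *m g = t *m P by rewrite /t mulmxKV.
have {}tt : is_trig_mx t by move: tt; rewrite /similar_to conjumx.
have Et : t = P *m g *m invmx P by []; clearbody t.
exists (\row_i t i i); split.
- rewrite (char_poly_conj Pu E) char_poly_trig //; apply: eq_bigr => i _.
  by rewrite mxE.
- under eq_bigr do rewrite mxE; rewrite -det_trig // Et !det_mulmx mulrAC -det_mulmx.
  by rewrite mulmxV // det1 mul1r.
- by rewrite (trW_conj Pu E) trW_trig.
move=> gu; have tu : t \in unitmx by rewrite Et !unitmx_mul Pu gu unitmx_inv.
rewrite (@char_poly_conj _ _ P _ (invmx t)) //; last first.
  by apply: (can_inj (mulKmx tu)); rewrite mulKVmx // mulmxA -E mulmxK.
rewrite char_poly_inv_trig //; apply: eq_bigr => i _; by rewrite mxE.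
Qed.

Variable lam : 'I_N -> nat.
Hypothesis weyl : forall x, vdm x * char x = alternant x (fun i => lam i + stair i)%N.

Let bet i : nat := (lam i + stair i)%N.

Lemma char_path (y : 'rV[{poly C}]_N) : exists p : {poly C},
  forall s, p.[s] = char (map_mx (horner_eval s) y).
Proof.
exists (\sum_w (char_coef c w)%:P * monom y (wt_nat w)) => s.
rewrite charE horner_sum; apply: eq_bigr => w _; rewrite hornerM hornerC.
by congr (_ * _); rewrite -[LHS]/(horner_eval s _) monom_map.
Qed.

(** The alternant vanishes, but so may [vdm x]. The point is therefore deformed to pairwise distinct
    entries while 1 and -1 stay in place. *)
Lemma char_same_parity (x : 'rV[C]_N) i j : (forall k l, odd (bet k) = odd (bet l)) ->
  x 0 i = 1 -> x 0 j = -1 -> char x = 0.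
Proof.
move=> par xi xj.
have neq11 : (1 : C) != -1 by rewrite -addr_eq0 -[1 + 1]/(2%:R) pnatr_eq0.
have ij : i != j.
  apply/eqP => ij; move: xi; rewrite ij xj => /esym/eqP.
  by rewrite (negPf neq11).
have alt0 (y : 'rV[C]_N) : y 0 i = 1 -> y 0 j = -1 -> alternant y bet = 0.
  move=> yi yj; apply/eqP/det0P.
  (* By the common parity, row [j] is [(-1) ^ bet i] times row [i]. *)
  exists (delta_mx 0 j - (-1) ^+ (bet i) *: delta_mx 0 i).
    apply/eqP => /rowP/(_ j)/eqP; rewrite !mxE !eqxx [j == i]eq_sym (negPf ij) mulr0 subr0.
    by rewrite oner_eq0.
  rewrite mulmxBl -scalemxAl -!rowE; apply/rowP => k; rewrite !mxE yi yj expr1n mulr1.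
  by rewrite -[(-1) ^+ bet k]signr_odd (par k i) signr_odd subrr.
(* Distinct nonzero slopes [k + 1] away from [i] and [j] make all differences nonzero
   polynomials. *)
pose y : 'rV[{poly C}]_N := \row_k if (k == i) || (k == j) then (x 0 k)%:P
   else (x 0 k)%:P + k.+1%:R *: 'X.
have [p Hp] := char_path y.
have vy : vdm y != 0.
  apply/prodf_neq0 => a _; apply/prodf_neq0 => b ab.
  have nab : a != b by apply: contraTneq ab => ->; rewrite ltnn.
  rewrite subr_eq0; apply/eqP => /(congr1 (fun p : {poly C} => (p`_0, p`_1))); rewrite !mxE.
  have c1 (l : 'I_N) : (if (l == i) || (l == j) then (x 0 l)%:P
       else (x 0 l)%:P + l.+1%:R *: 'X : {poly C})`_1 = if (l == i) || (l == j) then 0 else l.+1%:R.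
    by case: ifP => _; rewrite ?coefD coefC //= coefZ coefX mulr1 add0r.
  case; rewrite !c1.
  case: (boolP ((a == i) || (a == j))) => Ha; case: (boolP ((b == i) || (b == j))) => Hb.
  - rewrite !coefC /= => E _; move: nab; case/orP: Ha E => /eqP ->; case/orP: Hb => /eqP -> E;
      rewrite ?eqxx // => _; move: E; rewrite xi xj => /eqP.
      by rewrite (negPf neq11).
    by rewrite eq_sym (negPf neq11).
  - by move=> _ /eqP; rewrite eq_sym pnatr_eq0.
  - by move=> _ /eqP; rewrite pnatr_eq0.
  - by move=> _ /eqP; rewrite eqr_nat eqSS => /eqP/val_inj ab'; rewrite ab' eqxx in nab.
have p0 : p = 0.
  apply: poly_eq0_generic vy _ => s vs; rewrite Hp; apply: (mulfI vs); rewrite mulr0.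
  rewrite -[X in X * _]/(horner_eval s _) vdm_map weyl; apply: alt0; rewrite !mxE eqxx ?orbT /=.
    by rewrite /horner_eval hornerC.
  by rewrite /horner_eval hornerC.
have := Hp 0; rewrite p0 horner0 => ->; congr char; apply/rowP => k; rewrite !mxE /horner_eval.
by case: ifP => _; rewrite ?hornerD hornerC // hornerZ hornerX mulr0 addr0.
Qed.

(** Multiplying row [i] by [x_i ^ w] turns the exponent [- e j] into [e (rev_ord j)], which reverses
    the columns. *)
Lemma alternant_inv (x : 'rV[C]_N) e w : (forall i, x 0 i != 0) ->
  (forall i : 'I_N, e i + e (rev_ord i) = w)%N ->
  (\prod_i x 0 i ^+ w) * alternant (\row_i (x 0 i)^-1) e =
  (-1) ^+ (perm (@rev_ord_inj N)) * alternant x e.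
Proof.
move=> x0 ew.
have -> : \prod_i x 0 i ^+ w = \det (diag_mx (\row_i x 0 i ^+ w)).
  by rewrite det_diag; apply: eq_bigr => i _; rewrite mxE.
pose s : 'S_N := perm (@rev_ord_inj N).
rewrite -det_mulmx (_ : _ *m _ = col_perm s (\matrix_(i, j) x 0 i ^+ e j)).
  by rewrite col_permE det_mulmx det_perm odd_permV mulrC.
rewrite mul_diag_mx; apply/matrixP=> i j; rewrite !mxE permE -(ew j) exprD mulrAC exprVn.
by rewrite mulfV ?mul1r // expf_neq0.
Qed.

(** Divide the instance of [alternant_inv] for [bet] by the one for the staircase; the signs cancel.
    Division needs a generic point, so the identity is then extended to all [x]. *)
Lemma char_inv (x : 'rV[C]_N) w : (forall i, x 0 i != 0) ->
  (forall i, lam i + lam (rev_ord i) = w)%N ->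
  char x = (\prod_i x 0 i ^+ w) * char (\row_i (x 0 i)^-1).
Proof.
move=> x0 lw.
have stw (i : 'I_N) : (stair i + stair (rev_ord i) = N.-1)%N.
  by rewrite /stair /=; have := ltn_ord i; lia.
have betw (i : 'I_N) : (bet i + bet (rev_ord i) = w + N.-1)%N.
  by rewrite /bet -(lw i) -(stw i); lia.
pose Wt := {ffun 'I_N -> 'I_K.+1}.
(* Multiplying by the [K]-th power of every entry makes all exponents natural numbers, as
   [monom_ext] requires. *)
pose e (a : Wt + Wt) (i : 'I_N) : nat := match a with
  | inl v => wt_nat v i + K | inr v => w + (K - wt_nat v i) end%N.
pose m (a : Wt + Wt) : C := match a with
  | inl v => char_coef c v | inr v => - char_coef c v end.
have sumE (y : 'rV[C]_N) : (forall i, y 0 i != 0) -> \sum_a m a * monom y (e a) =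
    (\prod_i y 0 i ^+ K) * (char y - (\prod_i y 0 i ^+ w) * char (\row_i (y 0 i)^-1)).
  move=> y0; rewrite big_sumType /= mulrBr !charE !mulr_sumr; congr (_ + _).
    by apply: eq_bigr => v _; rewrite monomD mulrA mulrC.
  rewrite -sumrN; apply: eq_bigr => v _; rewrite mulNr; congr (- _).
  have -> : monom y (e (inr v)) = (\prod_i y 0 i ^+ w) *
      ((\prod_i y 0 i ^+ K) * monom (\row_i (y 0 i)^-1) (wt_nat v)).
    rewrite monomD; congr (_ * _); rewrite /monom -big_split /=; apply: eq_bigr => i _.
    have le : (wt_nat v i <= K)%N by rewrite -ltnS /wt_nat ltn_ord.
    have <- : y 0 i ^+ (K - wt_nat v i) * y 0 i ^+ wt_nat v i = y 0 i ^+ K.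
      by rewrite -exprD subnK.
    by rewrite mxE exprVn mulfK // expf_neq0.
  move: (\prod_i y 0 i ^+ w) (\prod_i y 0 i ^+ K) (monom _ _) (char_coef c v) => p q r t.
  ring.
have z y : \sum_a m a * monom y (e a) = 0.
  move: y; apply: monom_ext => y [y0 yd]; rewrite sumE //.
  have iv0 (k : nat) : \prod_i y 0 i ^+ k != 0.
    by apply/prodf_neq0 => i _; rewrite expf_neq0.
  have vy (u : 'rV[C]_N) : (forall i j, i != j -> u 0 i != u 0 j) -> vdm u != 0.
    move=> ud; apply/prodf_neq0 => i _; apply/prodf_neq0 => j ij.
    by rewrite subr_eq0 ud //; apply: contraTneq ij => ->; rewrite ltnn.
  pose yi : 'rV[C]_N := \row_i (y 0 i)^-1.
  have vyi : vdm yi != 0.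
    by apply: vy => i j ij; rewrite !mxE (inj_eq invr_inj) yd.
  have A1 := alternant_inv y0 betw; have A2 := alternant_inv y0 stw.
  rewrite -/yi in A1 A2 *; rewrite -!weyl in A1; rewrite !alternant_stair in A2.
  suff -> : char y = (\prod_i y 0 i ^+ w) * char yi by rewrite subrr mulr0.
  move: A1 A2; set sg := (-1) ^+ _ => A1 A2.
  have sg0 : sg != 0 by rewrite signr_eq0.
  apply: (mulfI (vy y yd)); apply: (mulfI sg0).
    rewrite -A1 [RHS]mulrA -A2.
  under [X in X * _ = _]eq_bigr do rewrite exprD.
  rewrite big_split /=; move: (vdm yi) (char yi) (\prod_i y 0 i ^+ w) (\prod_i _) => p q r t.
  ring.
apply/eqP; rewrite -subr_eq0; have := z x; rewrite sumE // => /eqP.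
rewrite mulf_eq0 => /orP[|//]; rewrite prodf_seq_eq0 => /hasP[i _].
by rewrite /= expf_eq0 (negPf (x0 i)) andbF.
Qed.

(** [1 - g = g (g^T - 1)] and [-1 - g = g (-1 - g^T)]. With [\det g = -1], and [N] even in the first
    case, each determinant equals its own negative, so 1 and -1 are eigenvalues. *)
Lemma trW_same_parity g : ~~ odd N -> (forall k l, odd (bet k) = odd (bet l)) ->
  g *m g^T = 1%:M -> \det g = -1 -> \tr (W g) = 0.
Proof.
move=> evN par gO dg; have [x [cp _ -> _]] := trW_spectrum g.
have root_of a : \det (a%:M - g) = 0 -> exists i, x 0 i = a.
  move=> H; have : (char_poly g).[a] = 0.
    rewrite /char_poly -[LHS]/(horner_eval a _) -det_map_mx -[RHS]H; congr (\det _).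
    rewrite /char_poly_mx map_mxB map_scalar_mx /= /horner_eval hornerX; congr (_ - _).
    by apply/matrixP=> i j; rewrite !mxE hornerC.
  rewrite cp horner_prod => /eqP; rewrite prodf_seq_eq0 => /hasP[i _ /=].
  by rewrite hornerXsubC subr_eq0 => /eqP ->; exists i.
have dgT : \det g^T = -1 by rewrite det_tr.
have gTO : g^T *m g = 1%:M by exact: mulmx1C.
have half (z : C) : z = - z -> z = 0.
  by move/eqP; rewrite -addr_eq0 -mulr2n mulrn_eq0 => /eqP.
have [i xi] : exists i, x 0 i = 1.
  apply: root_of; apply: half.
  have E : 1%:M - g = g *m (g^T - 1%:M) by rewrite mulmxBr gO mulmx1.
  rewrite {1}E det_mulmx dg mulN1r; congr (- _).
  rewrite -det_tr raddfB /= trmxK trmx1 -opprB -scaleN1r detZ.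
  by rewrite -signr_odd (negPf evN) mul1r.
have [j xj] : exists i, x 0 i = -1.
  apply: root_of; apply: half.
  have E : (-1)%:M - g = g *m ((-1)%:M - g^T).
    by rewrite mulmxBr gO mul_mx_scalar scaleN1r raddfN /= addrC.
  rewrite {1}E det_mulmx dg mulN1r; congr (- _).
  by rewrite -det_tr raddfB /= trmxK tr_scalar_mx.
exact: char_same_parity par xi xj.
Qed.

Lemma trW_symmetric g w : odd w -> (forall i, lam i + lam (rev_ord i) = w)%N ->
  g *m g^T = 1%:M -> \det g = -1 -> \tr (W g) = 0.
Proof.
move=> ow lw gO dg; have [gu _] := mulmx1_unit gO.
have [x [cp dx trx cpi]] := trW_spectrum g.
have [y [cpT _ _ _]] := trW_spectrum g^T.
have x0 i : x 0 i != 0.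
  by move: gu; rewrite unitmxE unitfE dx => /prodf_neq0 H; exact: H.
have gT : g^T = invmx g by rewrite -[LHS]mul1mx -(mulVmx gu) -mulmxA gO mulmx1.
have cT : char_poly g^T = char_poly g.
  rewrite /char_poly -det_tr; congr (\det _); apply/matrixP=> i j.
  by rewrite !mxE eq_sym.
have E : char x = char (\row_i (x 0 i)^-1).
  apply: char_perm; rewrite -cp -cT gT cpi //; apply: eq_bigr => i _.
  by rewrite mxE.
have := char_inv x0 lw; rewrite -E prodrXl -dx dg -signr_odd ow expr1 mulN1r trx => /eqP.
by rewrite -addr_eq0 -mulr2n mulrn_eq0 => /eqP.
Qed.

End Spectrum.

(** * Intertwiners of star-closed groups *)

Local Open Scope sesquilinear_scope.

Section Adjoint.
Variable C : numClosedFieldType.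

Lemma adjM m n p (A : 'M[C]_(m, n)) (B : 'M_(n, p)) : (A *m B)^t* = B^t* *m A^t*.
Proof. by rewrite trmx_mul map_mxM. Qed.

Lemma adjD m n (A B : 'M[C]_(m, n)) : (A + B)^t* = A^t* + B^t*.
Proof. by rewrite linearD map_mxD. Qed.

Lemma adjZ m n a (A : 'M[C]_(m, n)) : (a *: A)^t* = a^* *: A^t*.
Proof. by rewrite linearZ map_mxZ. Qed.

Lemma adj0 m n : (0 : 'M[C]_(m, n))^t* = 0.
Proof. by rewrite trmx0 map_mx0. Qed.

Lemma adj_sum m n (I : Type) (r : seq I) (P : pred I) (F : I -> 'M[C]_(m, n)) :
  (\sum_(i <- r | P i) F i)^t* = \sum_(i <- r | P i) (F i)^t*.
Proof. by rewrite linear_sum /= raddf_sum. Qed.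

Lemma tr_adj n (A : 'M[C]_n) : \tr (A^t*) = (\tr A)^*.
Proof. by rewrite trace_map_mx mxtrace_tr. Qed.

Lemma tr_adj_mul m n (A B : 'M[C]_(m, n)) : \tr (A *m B^t*) = \sum_i \sum_j A i j * (B i j)^*.
Proof. by apply: eq_bigr => i _; rewrite mxE; apply: eq_bigr => j _; rewrite !mxE. Qed.

Lemma mul_adj_eq0 m n (A : 'M[C]_(m, n)) : A *m A^t* = 0 -> A = 0.
Proof.
move=> H; apply/matrixP=> i j; rewrite mxE.
have := congr1 (fun M : 'M_m => M i i) H; rewrite !mxE => /eqP.
rewrite psumr_eq0 => [/allP/(_ j)|k _]; last by rewrite !mxE -normCK exprn_ge0.
by rewrite mem_index_enum !mxE -normCK => /(_ isT); rewrite expf_eq0 /= normr_eq0 => /eqP.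
Qed.

Lemma adj_mul_eq0 m n (A : 'M[C]_(m, n)) : A^t* *m A = 0 -> A = 0.
Proof.
move=> H; have /mul_adj_eq0 E : A^t* *m A^t*^t* = 0 by rewrite trmxCK.
by rewrite -[A]trmxCK E adj0.
Qed.

Lemma orthonormal_rows n (S : 'rV[C]_n -> Prop) :
  S 0 -> (forall a u v, S u -> S v -> S (a *: u + v)) ->
  exists m (B : 'M[C]_(m, n)), B \is unitarymx /\ forall v, (v <= B)%MS <-> S v.
Proof.
move=> S0 SD; have [U HU] := vspace_of_prop S0 SD.
pose A : 'M[C]_(\dim U, n) := \matrix_i (vbasis U)`_i.
have AU v : (v <= A)%MS <-> v \in U.
  split=> [/submxP[D ->]|vU].
    rewrite mulmx_sum_row memv_suml // => i _; rewrite rowK memvZ //.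
    by rewrite vbasis_mem // mem_nth // size_tuple.
  rewrite (coord_vbasis vU) summx_sub // => i _; rewrite scalemx_sub //.
  by have := row_sub i A; rewrite rowK.
exists (\rank A), (schmidt (row_base A)); split.
  by rewrite schmidt_unitarymx // rank_leq_col.
move=> v; rewrite -HU -AU eqmx_schmidt_free ?row_base_free //.
by rewrite eq_row_base.
Qed.

Lemma sub_unitary m n p (B : 'M[C]_(m, n)) (v : 'M_(p, n)) : B \is unitarymx -> (v <= B)%MS ->
  v = v *m B^t* *m B.
Proof. by move=> /unitarymxP BB /submxP[D ->]; rewrite -(mulmxA D) BB mulmx1. Qed.

End Adjoint.

Lemma mul_delta_entry (A : comPzRingType) m n p q (X : 'M[A]_(m, n)) (Z : 'M[A]_(p, q)) i j k l :
  (X *m delta_mx i j *m Z) k l = X k i * Z j l.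
Proof.
rewrite -[delta_mx i j](mul_delta_mx (0 : 'I_1)) mulmxA -colE -mulmxA -rowE.
by rewrite mxE big_ord1 !mxE.
Qed.

Section StarAlgebra.
Variables (C : numClosedFieldType) (N T : nat) (G : 'M[C]_N -> Prop) (Th : 'M[C]_N -> 'M[C]_T).
Hypothesis GM : forall g h, G g -> G h -> G (g *m h).
Hypothesis Gstar : forall g, G g -> G (g^t*).
Hypothesis ThM : forall g h, G g -> G h -> Th (g *m h) = Th g *m Th h.
Hypothesis Thstar : forall g, G g -> Th (g^t*) = (Th g)^t*.

Definition span_closed (Q : 'M[C]_T -> Prop) :=
  [/\ Q 0, forall a A B, Q A -> Q B -> Q (a *: A + B) & forall g, G g -> Q (Th g)].

(** The linear span of the [Th g], encoded by its induction principle. *)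
Definition in_span M := forall Q, span_closed Q -> Q M.

Lemma in_span_closed : span_closed in_span.
Proof.
split=> [Q [] //|a A B SA SB Q HQ|g Gg Q [_ _]]; last exact.
by have [_ QD _] := HQ; apply: QD; [exact: SA|exact: SB].
Qed.

Lemma in_span_mulr g M : G g -> in_span M -> in_span (M *m Th g).
Proof.
have [s0 sD sG] := in_span_closed.
move=> Gg /(_ (fun M => in_span (M *m Th g))); apply; split; first by rewrite mul0mx.
  by move=> a A B SA SB; rewrite mulmxDl -scalemxAl; exact: sD.
by move=> h Gh; rewrite -ThM //; apply: sG; exact: GM.
Qed.

Lemma in_span_star M : in_span M -> in_span (M^t*).
Proof.
have [s0 sD sG] := in_span_closed.
move=> /(_ (fun M => in_span (M^t*))); apply; split; first by rewrite adj0.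
  by move=> a A B SA SB; rewrite adjD adjZ; exact: sD.
by move=> g Gg; rewrite -Thstar //; apply: sG; exact: Gstar.
Qed.

(** Gram-Schmidt for the Hermitian trace form on matrices, which [mxvec] turns into the standard
    form on rows. *)
Lemma star_basis : exists m (b : 'I_m -> 'M[C]_T),
  [/\ forall i, in_span (b i),
      forall i j, \tr (b i *m (b j)^t*) = (i == j)%:R &
      forall M, in_span M -> M = \sum_i \tr (M *m (b i)^t*) *: b i].
Proof.
have [s0 sD sG] := in_span_closed.
have [|a u v|m [B [BU HB]]] := @orthonormal_rows C _ (fun v : 'rV_(T * T) => in_span (vec_mx v)).
- by rewrite linear0.
- by rewrite linearP; exact: sD.
have ipE (A A' : 'M[C]_T) : \tr (A *m A'^t*) = (mxvec A *m (mxvec A')^t*) 0 0.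
  rewrite tr_adj_mul pair_big /= mxE.
  rewrite [RHS](reindex _ (curry_mxvec_bij T T)) /=.
  by apply: eq_bigr => -[i j] _; rewrite !mxE !mxvecE.
exists m, (fun i => vec_mx (row i B)); split.
- by move=> i; apply/HB; exact: row_sub.
- move=> i j; rewrite ipE !vec_mxK; have /unitarymxP/matrixP/(_ i j) := BU.
  rewrite !mxE => <-; apply: eq_bigr => k _; by rewrite !mxE.
move=> M SM; have : (mxvec M <= B)%MS by apply/HB; rewrite mxvecK.
move=> /(sub_unitary BU) E; rewrite -[LHS]mxvecK [in LHS]E mulmx_sum_row linear_sum /=.
apply: eq_bigr => i _; rewrite linearZ /= ipE vec_mxK; congr (_ *: _).
by rewrite !mxE; apply: eq_bigr => k _; rewrite !mxE.
Qed.

Section Intertwiners.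
Variables (d1 d2 : nat) (L1 : {linear 'M[C]_T -> 'M[C]_d1}) (L2 : {linear 'M[C]_T -> 'M[C]_d2}).
Hypothesis L1M : forall g h, G g -> G h -> L1 (Th g *m Th h) = L1 (Th g) *m L1 (Th h).
Hypothesis L2M : forall g h, G g -> G h -> L2 (Th g *m Th h) = L2 (Th g) *m L2 (Th h).

Variables (m : nat) (b : 'I_m -> 'M[C]_T).
Hypothesis b_span : forall i, in_span (b i).
Hypothesis b_basis : forall M, in_span M -> M = \sum_i \tr (M *m (b i)^t*) *: b i.

(* For a group algebra, [b] would run through the group elements scaled by
   [#|G| ^ (-1/2)]; an orthonormal basis of the spanned algebra does the same job
   without integration. *)
Definition gaschutz (Y : 'M[C]_(d2, d1)) : 'M[C]_(d2, d1) := \sum_i L2 ((b i)^t*) *m Y *m L1 (b i).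

(** Right multiplication by [Th g] on the [b i] and left multiplication on their adjoints have
    transposed matrices for the trace form, so [g] can be carried across the sum. The second matrix
    comes from the first one for the adjoint of [g], which lies in [G]. *)
Lemma gaschutz_intertwines Y g : G g -> gaschutz Y *m L1 (Th g) = L2 (Th g) *m gaschutz Y.
Proof.
move=> Gg.
have L1r M : in_span M -> L1 (M *m Th g) = L1 M *m L1 (Th g).
  move=> /(_ (fun M => L1 (M *m Th g) = L1 M *m L1 (Th g))); apply; split.
  - by rewrite mul0mx linear0 mul0mx.
  - by move=> a A B EA EB; rewrite mulmxDl -scalemxAl [L1 (_ + _)]linearP EA EB
         [L1 (a *: A + B)]linearP mulmxDl -scalemxAl.
  - by move=> h Gh; exact: L1M.
have L2l M : in_span M -> L2 (Th g *m M) = L2 (Th g) *m L2 M.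
  move=> /(_ (fun M => L2 (Th g *m M) = L2 (Th g) *m L2 M)); apply; split.
  - by rewrite mulmx0 linear0 mulmx0.
  - by move=> a A B EA EB; rewrite mulmxDr -scalemxAr [L2 (_ + _)]linearP EA EB
         [L2 (a *: A + B)]linearP mulmxDr -scalemxAr.
  - by move=> h Gh; exact: L2M.
have right i : b i *m Th g = \sum_j \tr (b i *m Th g *m (b j)^t*) *: b j.
  by apply: b_basis; exact: in_span_mulr.
have left i : Th g *m (b i)^t* = \sum_j \tr (b j *m Th g *m (b i)^t*) *: (b j)^t*.
  have Gs := Gstar Gg.
  have := b_basis (in_span_mulr Gs (b_span i)) => /(congr1 (fun A => A^t*)).
  rewrite adjM Thstar // trmxCK => ->; rewrite adj_sum; apply: eq_bigr => j _.
  by rewrite adjZ -tr_adj !adjM !trmxCK mulmxA.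
rewrite /gaschutz mulmx_suml mulmx_sumr.
transitivity (\sum_i \sum_j \tr (b i *m Th g *m (b j)^t*) *: (L2 ((b i)^t*) *m Y *m L1 (b j))).
  apply: eq_bigr => i _; rewrite -mulmxA -L1r // [in L1 _]right linear_sum mulmx_sumr.
  by apply: eq_bigr => j _; rewrite [L1 _]linearZ -scalemxAr.
rewrite exchange_big /=; apply: eq_bigr => i _.
rewrite !mulmxA -L2l; last exact: in_span_star.
rewrite [in L2 _]left linear_sum !mulmx_suml; apply: eq_bigr => j _.
by rewrite [L2 (_ *: _)]linearZ -!scalemxAl.
Qed.

(** Taking [Y] among the matrix units gives orthogonality relations between matrix coefficients. *)
Lemma gaschutz_eq0 (A : 'M[C]_d2) (B : 'M[C]_d1) : (forall Y, gaschutz (A *m Y *m B) = 0) ->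
  forall k p q l, \sum_i (L2 ((b i)^t*) *m A) k p * (B *m L1 (b i)) q l = 0.
Proof.
move=> H k p q l; have /matrixP/(_ k l) := H (delta_mx p q); rewrite /gaschutz summxE !mxE => E.
rewrite -[RHS]E; apply: eq_bigr => i _.
by rewrite !mulmxA -(mulmxA _ B) mul_delta_entry.
Qed.

End Intertwiners.
End StarAlgebra.

Section Unitarizable.
Variables (C : numClosedFieldType) (N K d : nat).
Variable c : 'I_d -> 'I_d -> 'M[C]_#|tensidx N K|.
Local Notation W := (polymap c).
Hypothesis d0 : (0 < d)%N.
Hypothesis W1 : W 1%:M = 1%:M.
Hypothesis WM : forall g h, W (g *m h) = W g *m W h.
Hypothesis irrW : forall S : 'cV[C]_d -> Prop,
  S 0 -> (forall a u v, S u -> S v -> S (a *: u + v)) ->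
  (forall g w, g \in unitmx -> S w -> S (W g *m w)) ->
  forall w0, w0 != 0 -> S w0 -> forall w, S w.

Lemma theta_star (g : 'M[C]_N) : theta K (g^t*) = (theta K g)^t*.
Proof. by rewrite -theta_map -theta_tr. Qed.

Lemma unitmx_star n (g : 'M[C]_n) : (g^t* \in unitmx) = (g \in unitmx).
Proof. by rewrite map_unitmx unitmx_tr. Qed.

(** If all averages from [W] to [theta] vanished, the orthogonality relations and independence of
    the [b i] would give [linmap c (b i) = 0] for all [i], hence [W 1 = 0]. *)
Lemma embed_theta : exists2 J : 'M[C]_(#|tensidx N K|, d), J != 0 &
  forall g, g \in unitmx -> J *m W g = theta K g *m J.
Proof.
pose G (g : 'M[C]_N) := is_true (g \in unitmx).
have GM (g h : 'M[C]_N) : G g -> G h -> G (g *m h) by rewrite /G unitmx_mul => -> ->.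
have Gs (g : 'M[C]_N) : G g -> G (g^t*) by rewrite /G unitmx_star.
have TM (g h : 'M[C]_N) : G g -> G h -> theta K (g *m h) = theta K g *m theta K h.
  by move=> _ _; exact: thetaM.
have Ts (g : 'M[C]_N) : G g -> theta K (g^t*) = (theta K g)^t* by move=> _; exact: theta_star.
have [m [b [bS bo bb]]] := star_basis G (@theta N K C).
have L1M (g h : 'M[C]_N) : G g -> G h ->
    linmap c (theta K g *m theta K h) = linmap c (theta K g) *m linmap c (theta K h).
  by move=> _ _; rewrite -thetaM; exact: WM.
have [[Y Y0]|noY] := pselect (exists Y, gaschutz (linmap c) idfun b Y != 0).
  exists (gaschutz (linmap c) idfun b Y) => // g Gg.
  by rewrite (gaschutz_intertwines GM Gs TM Ts L1M _ bS bb).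
have Z (Y : 'M_(#|tensidx N K|, d)) : gaschutz (linmap c) idfun b (1%:M *m Y *m 1%:M) = 0.
  by apply/eqP/negPn/negP => ne; apply: noY; exists (1%:M *m Y *m 1%:M).
have Lb i : linmap c (b i) = 0.
  apply/matrixP=> q l; rewrite [RHS]mxE.
  pose x j := linmap c (b j) q l.
  have E : \sum_j x j *: (b j)^t* = 0.
    apply/matrixP=> k p; rewrite summxE mxE -[RHS](gaschutz_eq0 Z k p q l).
    by apply: eq_bigr => j _; rewrite mulmx1 mul1mx mxE mulrC.
  have : \tr ((\sum_j x j *: (b j)^t*) *m b i) = 0 by rewrite E mul0mx mxtrace0.
  rewrite mulmx_suml raddf_sum (bigD1 i) //= -scalemxAl mxtraceZ mxtrace_mulC bo eqxx mulr1.
  rewrite big1 ?addr0 // => j ji.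
  by rewrite -scalemxAl mxtraceZ mxtrace_mulC bo eq_sym (negPf ji) mulr0.
have [_ _ sG] := in_span_closed G (@theta N K C).
have := bb _ (sG 1%:M (unitmx1 _ _)) => /(congr1 (linmap c)).
rewrite linear_sum big1 => [|i _]; last by rewrite linearZ /= Lb scaler0.
rewrite -/(W 1%:M) W1 => /matrixP/(_ (Ordinal d0) (Ordinal d0))/eqP.
by rewrite !mxE eqxx oner_eq0.
Qed.

(** [J] is injective by irreducibility. Orthonormalizing its columns conjugates [W g] to the
    compression of [theta g] to the image, and compressions commute with adjoints. *)
Lemma unitarizable : exists2 R : 'M[C]_d, R \in unitmx &
  forall g, g \in unitmx -> R *m W (g^t*) *m invmx R = (R *m W g *m invmx R)^t*.
Proof.
have [J J0 JW] := embed_theta.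
have Jinj (w : 'cV[C]_d) : J *m w = 0 -> w = 0.
  move=> Jw; apply/eqP/negPn/negP => w0; case/eqP: J0.
  pose S (u : 'cV[C]_d) := J *m u = 0.
  have SA : forall u, S u.
    apply: (irrW (S := S)) w0 Jw; rewrite /S; first by rewrite mulmx0.
      by move=> a u v Hu Hv; rewrite mulmxDr -scalemxAr Hu Hv scaler0 addr0.
    by move=> g u gu Hu; rewrite mulmxA JW // -mulmxA Hu mulmx0.
  by apply/matrixP=> i j; have := SA (delta_mx j 0); rewrite /S -colE => /matrixP/(_ i 0); rewrite !mxE.
pose A := J^t*.
have Afree : row_free A.
  apply: inj_row_free => v vA; have : J *m v^t* = 0 by rewrite -[J]trmxCK -adjM vA adj0.
  by move/Jinj => v0; rewrite -[v]trmxCK v0 adj0.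
have dT : (d <= #|tensidx N K|)%N by rewrite -(eqP Afree) rank_leq_col.
pose B := schmidt A; have BU : B \is unitarymx by exact: schmidt_unitarymx.
have AB : (A :=: B)%MS by apply/eqmx_sym; exact: eqmx_schmidt_free.
have /submxP[X AX] : (A <= B)%MS by rewrite AB.
have Xu : X \in unitmx.
  have : (\rank A <= \rank X)%N by rewrite AX mxrankM_maxl.
  by rewrite (eqP Afree) row_leq_rank row_free_unit.
pose R := X^t*; have Ru : R \in unitmx by rewrite unitmx_star.
have JR : J = B^t* *m R by rewrite -[J]trmxCK -/A AX adjM.
have BB : B *m B^t* = 1%:M by exact/unitarymxP.
have E g : g \in unitmx -> R *m W g *m invmx R = B *m theta K g *m B^t*.
  move=> gu; have := JW g gu; rewrite JR => /(congr1 (mulmx B)).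
  by rewrite !mulmxA BB mul1mx => ->; rewrite mulmxK.
exists R => // g gu; rewrite !E ?unitmx_star // theta_star !adjM trmxCK.
by rewrite mulmxA.
Qed.

End Unitarizable.

Section Projections.
Variables (C : numClosedFieldType) (d : nat).

Lemma kernel_projection (T : 'M[C]_d) : exists P : 'M[C]_d,
  [/\ P^t* = P, T *m P = 0 & forall n (X : 'M_(d, n)), T *m X = 0 -> P *m X = X].
Proof.
pose Q := schmidt (row_base (kermx (T^t*))).
have QU : Q \is unitarymx by rewrite schmidt_unitarymx // rank_leq_col.
have QK : (Q :=: kermx (T^t*))%MS.
  by apply: eqmx_trans (eq_row_base _); apply: eqmx_schmidt_free; exact: row_base_free.
have QT : Q *m T^t* = 0 by apply/sub_kermxP; rewrite QK.
exists (Q^t* *m Q); split.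
- by rewrite adjM trmxCK.
- have := congr1 (fun A => A^t*) QT; rewrite adjM trmxCK adj0 => TQ.
  by rewrite mulmxA TQ mul0mx.
move=> n X TX; have : (X^t* <= Q)%MS.
  by rewrite QK; apply/sub_kermxP; rewrite -adjM TX adj0.
move/(sub_unitary QU) => E.
by rewrite -[in RHS](trmxCK X) E !adjM !trmxCK mulmxA.
Qed.

(** The product of the adjoint of [T] with [T] is injective off the kernel, and [P] fills the kernel
    in; inverting the sum [M] gives a pseudo-inverse. *)
Lemma moore_penrose (T P P' : 'M[C]_d) :
  P^t* = P -> T *m P = 0 -> (forall n (X : 'M_(d, n)), T *m X = 0 -> P *m X = X) ->
  P'^t* = P' -> T^t* *m P' = 0 -> (forall n (X : 'M_(d, n)), T^t* *m X = 0 -> P' *m X = X) ->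
  exists Z, Z *m T = 1%:M - P /\ T *m Z = 1%:M - P'.
Proof.
move=> Ps TP PX P's TP' P'X; have PP : P *m P = P by exact: PX.
pose M := T^t* *m T + P.
have PT : P *m T^t* = 0 by rewrite -[P]Ps -adjM TP adj0.
have P'T : P' *m T = 0 by rewrite -[T]trmxCK -[P']P's -adjM TP' adj0.
have MP : M *m P = P by rewrite mulmxDl -mulmxA TP mulmx0 add0r PP.
have PM : P *m M = P by rewrite mulmxDr mulmxA PT mul0mx add0r PP.
have Mu : M \in unitmx.
  rewrite -unitmx_tr -row_free_unit; apply: inj_row_free => v vM.
  have MX : M *m v^T = 0 by rewrite -[M]trmxK -trmx_mul vM trmx0.
  have PX0 : P *m v^T = 0 by rewrite -PM -mulmxA MX mulmx0.
  have TX0 : T *m v^T = 0.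
    apply: adj_mul_eq0; rewrite adjM -mulmxA (mulmxA _ T).
    by move: MX; rewrite mulmxDl PX0 addr0 => ->; rewrite mulmx0.
  by apply: trmx_inj; rewrite trmx0 -(PX _ _ TX0) PX0.
have VP : invmx M *m P = P by rewrite -{1}MP mulKmx.
have PV : P *m invmx M = P by rewrite -{1}PM mulmxK.
exists (invmx M *m T^t*); split.
  have -> : invmx M *m T^t* *m T = invmx M *m (M - P) by rewrite addrK mulmxA.
  by rewrite mulmxBr mulVmx // VP.
set E := T *m _; have TE : T^t* *m (1%:M - E) = 0.
  rewrite mulmxBr mulmx1 /E !mulmxA.
  have -> : T^t* *m T = M - P by rewrite addrK.
  by rewrite mulmxBl mulmxV // PV mulmxBl mul1mx PT subr0 subrr.
by have := P'X _ _ TE; rewrite mulmxBr mulmx1 /E mulmxA P'T mul0mx subr0 => ->; rewrite subKr.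
Qed.

End Projections.

Section IsoOfTrace.
Variables (C : numClosedFieldType) (N d : nat) (rho : 'M[C]_N -> 'M[C]_d).

Definition orth (g : 'M[C]_N) : Prop := g *m g^T = 1%:M.

Hypothesis rho1 : rho 1%:M = 1%:M.
Hypothesis rhoM : forall g h, orth g -> orth h -> rho (g *m h) = rho g *m rho h.
Hypothesis rhoS : forall g, orth g -> rho (g^t*) = (rho g)^t*.
Hypothesis rho_tr : forall g, orth g -> \det g = -1 -> \tr (rho g) = 0.

Lemma orthM g h : orth g -> orth h -> orth (g *m h).
Proof. by move=> Og Oh; rewrite /orth trmx_mul mulmxA -(mulmxA g) Oh mulmx1. Qed.

Lemma orth1 : orth 1%:M.
Proof. by rewrite /orth trmx1 mulmx1. Qed.

Lemma orth_star g : orth g -> orth (g^t*).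
Proof.
move=> Og; have Og' : g^T *m g = 1%:M by exact: mulmx1C.
by rewrite /orth map_trmx -map_mxM trmxK Og' map_mx1.
Qed.

Lemma orth_det g : orth g -> \det g = 1 \/ \det g = -1.
Proof.
move=> /(congr1 determinant); rewrite det_mulmx det_tr det1 -expr2 => /eqP.
by rewrite sqrf_eq1 => /orP[] /eqP; [left|right].
Qed.

Let rho2 g := \det g *: rho g.

Let rho2M g h : orth g -> orth h -> rho2 (g *m h) = rho2 g *m rho2 h.
Proof. by move=> Og Oh; rewrite /rho2 det_mulmx rhoM // -scalemxAl -scalemxAr scalerA. Qed.

Let rho2S g : orth g -> rho2 (g^t*) = (rho2 g)^t*.
Proof. by move=> Og; rewrite /rho2 rhoS // adjZ det_map_mx det_tr. Qed.

(** Both representations sit in one block matrix, so that they are two linear maps on the same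
    spanned algebra. *)
Let Th g : 'M[C]_(d + d) := block_mx (rho g) 0 0 (rho2 g).

Let ThM g h : orth g -> orth h -> Th (g *m h) = Th g *m Th h.
Proof.
move=> Og Oh; rewrite /Th mulmx_block !mulmx0 !mul0mx !addr0 !add0r.
by rewrite rhoM // rho2M.
Qed.

Let ThS g : orth g -> Th (g^t*) = (Th g)^t*.
Proof. by move=> Og; rewrite /Th tr_block_mx map_block_mx !trmx0 !map_mx0 rhoS // rho2S. Qed.

Let L1 (M : 'M[C]_(d + d)) : 'M[C]_d := ulsubmx M.
Let L2 (M : 'M[C]_(d + d)) : 'M[C]_d := drsubmx M.

Fact L1_linear : linear L1.
Proof. by move=> a A B; apply/matrixP=> i j; rewrite !mxE. Qed.
Fact L2_linear : linear L2.
Proof. by move=> a A B; apply/matrixP=> i j; rewrite !mxE. Qed.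
HB.instance Definition _ := GRing.isLinear.Build C _ _ _ L1 L1_linear.
HB.instance Definition _ := GRing.isLinear.Build C _ _ _ L2 L2_linear.

Let L1Th g : L1 (Th g) = rho g. Proof. exact: block_mxKul. Qed.
Let L2Th g : L2 (Th g) = rho2 g. Proof. exact: block_mxKdr. Qed.

Let L2_star M : L2 (M^t*) = (L2 M)^t*.
Proof. by apply/matrixP=> i j; rewrite !mxE. Qed.

Definition twists (T : 'M[C]_d) := forall g, orth g -> T *m rho g = rho2 g *m T.

Let twists_star T : twists T -> twists (T^t*).
Proof.
move=> HT g Og; have Os := orth_star Og.
have := HT _ Os => /(congr1 (fun A => A^t*)); rewrite !adjM rhoS // rho2S // !trmxCK => E.
rewrite /rho2 -scalemxAl E /rho2 -scalemxAr scalerA.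
by case: (orth_det Og) => ->; rewrite ?mulrNN ?mulr1 scale1r.
Qed.

(** The kernel of [T] is invariant; applied to the adjoint of [g], this makes its orthogonal
    complement invariant too. *)
Let proj_comm T P : twists T -> P^t* = P -> T *m P = 0 ->
  (forall n (X : 'M_(d, n)), T *m X = 0 -> P *m X = X) ->
  forall g, orth g -> P *m rho g = rho g *m P.
Proof.
move=> HT Ps TP PX.
have half g : orth g -> P *m rho g *m P = rho g *m P.
  by move=> Og; rewrite -mulmxA PX // mulmxA HT // -mulmxA TP mulmx0.
move=> g Og; rewrite -half //.
have := half _ (orth_star Og) => /(congr1 (fun A => A^t*)).
by rewrite !adjM rhoS // !trmxCK Ps mulmxA => ->.
Qed.

(** [T] identifies the two representations off its kernel and cokernel, and their full traces agree,
    so kernel and cokernel have equal traces on the algebra. If every average between them vanished,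
    orthogonality would kill this trace, and with it the dimension [\tr P] of the kernel. *)
Lemma bigger_twist T : twists T -> T \notin unitmx ->
  exists2 T', twists T' & (\rank T < \rank T')%N.
Proof.
move=> HT Tnu.
have [P [Ps TP PX]] := kernel_projection T.
have [P' [P's TP' P'X]] := kernel_projection (T^t*).
have [Z [ZT TZ]] := moore_penrose Ps TP PX P's TP' P'X.
have Pc := proj_comm HT Ps TP PX.
have P'c := proj_comm (twists_star HT) P's TP' P'X.
have PP : P *m P = P by exact: PX.
have P'P' : P' *m P' = P' by exact: P'X.
have P'T : P' *m T = 0 by rewrite -[T]trmxCK -[P']P's -adjM TP' adj0.
have [m [b [bS bo bb]]] := star_basis orth Th.
have L1M g h : orth g -> orth h -> L1 (Th g *m Th h) = L1 (Th g) *m L1 (Th h).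
  by move=> Og Oh; rewrite -ThM // !L1Th rhoM.
have L2M g h : orth g -> orth h -> L2 (Th g *m Th h) = L2 (Th g) *m L2 (Th h).
  by move=> Og Oh; rewrite -ThM // !L2Th rho2M.
pose Phi Y := gaschutz L1 L2 b (P' *m Y *m P).
have Phi_tw Y : twists (Phi Y).
  move=> g Og; rewrite -L1Th -L2Th.
  exact: (gaschutz_intertwines orthM orth_star ThM ThS L1M L2M bS bb (P' *m Y *m P) Og).
have L1P M : in_span orth Th M -> L1 M *m P = P *m L1 M.
  move=> /(_ (fun M => L1 M *m P = P *m L1 M)); apply; split.
  - by rewrite linear0 mul0mx mulmx0.
  - by move=> a A B EA EB; rewrite [L1 _]linearP mulmxDl mulmxDr -scalemxAl -scalemxAr EA EB.
  - by move=> g Og; rewrite L1Th Pc.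
have L2P M : in_span orth Th M -> L2 M *m P' = P' *m L2 M.
  move=> /(_ (fun M => L2 M *m P' = P' *m L2 M)); apply; split.
  - by rewrite linear0 mul0mx mulmx0.
  - by move=> a A B EA EB; rewrite [L2 _]linearP mulmxDl mulmxDr -scalemxAl -scalemxAr EA EB.
  - by move=> g Og; rewrite L2Th /rho2 -scalemxAl -scalemxAr P'c.
have tr_eq M : in_span orth Th M -> \tr (P *m L1 M) = \tr (L2 M *m P').
  move=> /(_ (fun M => \tr (P *m L1 M) = \tr (L2 M *m P'))); apply; split.
  - by rewrite [L1 0]linear0 [L2 0]linear0 mulmx0 mul0mx !mxtrace0.
  - move=> a A B EA EB; rewrite [L1 _]linearP [L2 _]linearP mulmxDl mulmxDr -scalemxAl -scalemxAr.
    by rewrite !raddfD /= !mxtraceZ EA EB.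
  - move=> g Og; rewrite L1Th L2Th.
    have E1 : \tr (rho g) = \tr (rho2 g).
      rewrite /rho2 mxtraceZ; case: (orth_det Og) => E; rewrite E ?mul1r //.
      by rewrite rho_tr // mulr0.
    have E2 : \tr (rho g *m (1%:M - P)) = \tr (rho2 g *m (1%:M - P')).
      by rewrite -ZT -TZ !mulmxA -HT // [LHS]mxtrace_mulC mulmxA.
    move: E2; rewrite !mulmxBr !raddfB /= !mulmx1 E1 => /addrI /oppr_inj.
    by rewrite mxtrace_mulC.
(* A nonzero average lives on the kernel of [T] and maps into the complement of its image, so the
   ranks add up. *)
have [[Y Y0]|noY] := pselect (exists Y, Phi Y != 0).
  have PhiP : Phi Y *m P = Phi Y.
    rewrite /Phi /gaschutz mulmx_suml; apply: eq_bigr => i _.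
    by rewrite -(mulmxA _ (L1 _)) L1P // !mulmxA -(mulmxA _ P P) PP.
  have P'Phi : P' *m Phi Y = Phi Y.
    rewrite /Phi /gaschutz mulmx_sumr; apply: eq_bigr => i _.
    rewrite !mulmxA -L2P; last exact: (in_span_star orth_star ThS).
    by rewrite -(mulmxA _ P' P') P'P'.
  exists (T + Phi Y).
    by move=> g Og; rewrite mulmxDl mulmxDr HT // Phi_tw.
  have sT : (T <= (T + Phi Y)%R)%MS.
    apply/submxP; exists (1%:M - P').
    by rewrite mulmxBl mul1mx mulmxDr P'T P'Phi add0r addrK.
  have sPhi : (Phi Y <= (T + Phi Y)%R)%MS.
    by apply/submxP; exists P'; rewrite mulmxDr P'T P'Phi add0r.
  have disj : (T :&: Phi Y = 0)%MS.
    apply/eqP; rewrite -submx0; apply/rV_subP => u; rewrite sub_capmx => /andP[/submxP[a ->]].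
    case/submxP => a' E; have : a *m T *m P = 0 by rewrite -mulmxA TP mulmx0.
    by rewrite E -mulmxA PhiP => ->; rewrite sub0mx.
  have le : (\rank T + \rank (Phi Y) <= \rank (T + Phi Y)%R)%N.
    rewrite -mxrank_disjoint_sum //; apply: mxrankS.
    by rewrite addsmx_sub sT sPhi.
  by apply: leq_trans le; rewrite -addn1 leq_add2l lt0n mxrank_eq0.
have Z0 Y : gaschutz L1 L2 b (P' *m Y *m P) = 0.
  by apply/eqP/negPn/negP => ne; apply: noY; exists Y.
have b0 i : \tr (P *m L1 (b i)) = 0.
  (* Equality of the traces turns each squared modulus into a product of a cokernel trace and a
     kernel trace, to which the orthogonality relations apply. *)
  have S0 : \sum_j `|\tr (P *m L1 (b j))| ^+ 2 = 0.
    transitivity (\sum_k \sum_q \sum_j (L2 ((b j)^t*) *m P') k k * (P *m L1 (b j)) q q).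
      under [RHS]eq_bigr do rewrite exchange_big /=.
      rewrite exchange_big /=; apply: eq_bigr => j _.
      under eq_bigr do rewrite -mulr_sumr; rewrite -mulr_suml.
      rewrite -/(\tr (P *m L1 (b j))) -/(\tr (L2 ((b j)^t*) *m P')).
      have -> : \tr (L2 ((b j)^t*) *m P') = (\tr (P *m L1 (b j)))^*.
        by rewrite tr_eq // L2_star -[P' in LHS]P's -adjM tr_adj mxtrace_mulC.
      by rewrite mulrC -normCK.
    by rewrite big1 // => k _; rewrite big1 // => q _; exact: (gaschutz_eq0 Z0).
  move/eqP: S0; rewrite psumr_eq0 => [/allP/(_ i)|j _]; last exact: exprn_ge0.
  by rewrite mem_index_enum expf_eq0 /= normr_eq0 => /(_ isT)/eqP.
have [_ _ sG] := in_span_closed orth Th.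
have trP : \tr P = 0.
  have := bb _ (sG _ orth1) => /(congr1 (fun M => \tr (P *m L1 M))).
  rewrite L1Th rho1 mulmx1 => ->; rewrite linear_sum mulmx_sumr raddf_sum big1 // => i _.
  by rewrite linearZ /= -scalemxAr mxtraceZ b0 mulr0.
have P0 : P = 0.
  apply: mul_adj_eq0; rewrite Ps PP; apply/matrixP=> i j.
  have pos k : 0 <= P k k.
    by rewrite -PP -{2}Ps mxE sumr_ge0 // => l _; rewrite !mxE -normCK exprn_ge0.
  have Pkk k : P k k = 0.
    move/eqP: trP; rewrite psumr_eq0 => [/allP/(_ k)|l _]; last exact: pos.
    by rewrite mem_index_enum => /(_ isT)/eqP.
  have := Pkk i; rewrite -{1}PP -{2}Ps !mxE => /eqP.
  rewrite psumr_eq0 => [/allP/(_ j)|l _]; last by rewrite !mxE -normCK exprn_ge0.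
  by rewrite mem_index_enum !mxE -normCK => /(_ isT); rewrite expf_eq0 /= normr_eq0 => /eqP.
case/negP: Tnu; rewrite -unitmx_tr -row_free_unit; apply: inj_row_free => v vT.
have TX : T *m v^T = 0 by rewrite -[T]trmxK -trmx_mul vT trmx0.
by apply: trmx_inj; rewrite trmx0 -(PX _ _ TX) P0 mul0mx.
Qed.

Lemma twist_of_trace : exists2 T : 'M[C]_d, T \in unitmx &
  forall g, orth g -> T *m rho g = \det g *: (rho g *m T).
Proof.
pose Pr n := `[< exists T, twists T /\ \rank T = n >].
have ex : exists n, Pr n.
  exists 0%N; apply/asboolP; exists 0; rewrite mxrank0; split=> // g _.
  by rewrite mul0mx mulmx0.
have ub n : Pr n -> (n <= d)%N by move=> /asboolP[T [_ <-]]; exact: rank_leq_row.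
case: (ex_maxnP ex ub) => n /asboolP[T [HT rT]] max.
have [Tu|Tnu] := boolP (T \in unitmx).
  by exists T => // g Og; rewrite HT // /rho2 scalemxAl.
have [T' HT' lt] := bigger_twist HT Tnu.
have /max : Pr (\rank T') by apply/asboolP; exists T'.
by rewrite -rT leqNgt lt.
Qed.

End IsoOfTrace.

Local Close Scope sesquilinear_scope.

(** * Nonvanishing of alternants at orthogonal spectra *)

Definition del (T : Type) i (s : seq T) := take i s ++ drop i.+1 s.

Lemma size_del (T : Type) i (s : seq T) : (i < size s)%N -> size (del i s) = (size s).-1.
Proof. by move=> lt; rewrite size_cat size_take size_drop lt; lia. Qed.

Lemma nth_del (T : Type) (x : T) i k s : (i < size s)%N -> nth x (del i s) k = nth x s (bump i k).
Proof.
move=> lt; rewrite nth_cat size_take lt /bump; case: ltnP => ik.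
  by rewrite nth_take // leqNgt ik.
by rewrite nth_drop; congr nth; rewrite /= ?add1n; lia.
Qed.

Lemma del_rem (T : eqType) (x : T) i (s : seq T) : uniq s -> (i < size s)%N ->
  del i s = rem (nth x s i) s.
Proof. by move=> us lt; rewrite remE index_uniq. Qed.

Section Laplace.
Variable C : numFieldType.
Implicit Types (rows : seq (nat -> C)) (k : seq nat).

(* The determinant of the matrix [rows_i (k_j)], expanded along its first row. *)
Fixpoint lap rows k : C :=
  if rows is r :: rows' then
    \sum_(i < size k) (-1) ^+ i * r (nth 0%N k i) * lap rows' (del i k)
  else 1.

Lemma lap_det n rows k : size rows = n -> size k = n ->
  lap rows k = \det (\matrix_(i < n, j < n) nth (fun=> 0) rows i (nth 0%N k j)).
Proof.
elim: n rows k => [|n IH] [|r rows] k //=; first by rewrite det_mx00.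
move=> [sr] sk; rewrite (expand_det_row _ ord0) sk; apply: eq_bigr => i _.
rewrite mxE /= /cofactor add0n -mulrA mulrCA; congr (_ * (_ * _)).
rewrite (IH rows) ?size_del ?sk //; congr (\det _); apply/matrixP=> a b.
by rewrite !mxE nth_del ?sk.
Qed.

Fixpoint orth_rows (zs : seq C) : seq (nat -> C) :=
  if zs is z :: zs' then (fun n => z ^+ n) :: (fun n => z ^- n) :: orth_rows zs'
  else [:: fun=> 1; fun n => (-1) ^+ n].

Lemma lap_pair p q : lap (orth_rows [::]) [:: p; q] = (-1) ^+ q - (-1) ^+ p.
Proof.
rewrite /= !(big_ord_recl, big_ord0) /= /del /=.
by rewrite expr0 expr1 !mul1r !addr0 !mulr1 mulN1r.
Qed.

Definition all_par b k := all (fun n => odd n == b) k.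

Lemma all_par_sub b k k' : {subset k' <= k} -> all_par b k -> all_par b k'.
Proof. by move=> sub /allP H; apply/allP => n /sub; exact: H. Qed.

Lemma del_sub (T : eqType) i (s : seq T) : {subset del i s <= s}.
Proof. by move=> n; rewrite mem_cat => /orP[/mem_take|/mem_drop]. Qed.

(** The expansion ends in 2 by 2 minors of the last two rows, 1 and [(-1) ^ n], which agree up to
    sign on exponents of one parity. *)
Lemma lap_all_par b zs k : size k = (size zs).*2.+2 -> all_par b k -> lap (orth_rows zs) k = 0.
Proof.
elim: zs k => [|z zs IH] k.
  case: k => [|p [|q []]] // _; rewrite lap_pair => /and3P[/eqP op /eqP oq _].
  by rewrite -signr_odd oq -[(-1) ^+ p]signr_odd op subrr.
rewrite /= doubleS => sk pk; rewrite big1 // => i _; rewrite big1 ?mulr0 // => j _.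
rewrite IH ?mulr0 ?size_del ?sk //.
by apply: all_par_sub pk => n /del_sub /del_sub.
Qed.

Lemma lap_step zs k (p q : nat) : uniq k -> p \in k -> q \in k -> (q < p)%N ->
  lap (orth_rows zs) (rem q (rem p k)) != 0 ->
  (forall p' q' : nat, p' \in k -> q' \in k -> (p' + q = p + q')%N -> (p', q') != (p, q) ->
     lap (orth_rows zs) (rem q' (rem p' k)) = 0) ->
  exists2 z, z != 0 & lap (orth_rows (z :: zs)) k != 0.
Proof.
(* Multiplying by [z ^ M] clears the negative powers of [z]. *)
move=> uk pk qk qp nz others; pose M := \max_(n <- k) n.
have leM (n : nat) : n \in k -> (n <= M)%N by move=> nk; apply: (leq_bigmax_seq (F := id)).
pose u (i : 'I_(size k)) (j : 'I_(size (del i k))) : C :=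
  (-1) ^+ i * (-1) ^+ j * lap (orth_rows zs) (del j (del i k)).
(* Expansion along the rows of [z] and [1/z], as a polynomial in [z]. *)
pose Q : {poly C} := \sum_(i < size k) \sum_(j < size (del i k))
  u i j *: 'X^(M + nth 0%N k i - nth 0%N (del i k) j).
have mi (i : 'I_(size k)) : nth 0%N k i \in k by rewrite mem_nth.
have mj (i : 'I_(size k)) (j : 'I_(size (del i k))) : nth 0%N (del i k) j \in k.
  by apply: (@del_sub _ i); rewrite mem_nth.
have udel i : uniq (del i k).
  by apply: (subseq_uniq _ uk); rewrite /del -{3}(cat_take_drop i k) cat_subseq //
     -add1n -drop_drop drop_subseq.
have Q0 : Q != 0.
  have ip : (index p k < size k)%N by rewrite index_mem.
  pose i0 := Ordinal ip.
  have ni0 : nth 0%N k i0 = p by rewrite nth_index.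
  have di0 : del i0 k = rem p k by rewrite (del_rem 0%N) // ni0.
  have qk' : q \in del i0 k by rewrite di0 mem_rem_uniq // inE qk andbT neq_ltn qp.
  have iq : (index q (del i0 k) < size (del i0 k))%N by rewrite index_mem.
  pose j0 := Ordinal iq.
  have nj0 : nth 0%N (del i0 k) j0 = q by rewrite nth_index.
  have coefQ : Q`_(M + p - q) = u i0 j0.
    rewrite coef_sum (bigD1 i0) //= coef_sum (bigD1 j0) //= coefZ coefXn ni0 nj0 eqxx mulr1.
    rewrite big1 => [|j jj0]; last first.
      rewrite coefZ coefXn; case: eqP => [E|_]; last by rewrite mulr0.
      have : nth 0%N (del i0 k) j == nth 0%N (del i0 k) j0.
        have {}E : (M + p - q = M + p - nth 0%N (del i0 k) j)%N := E.
        by rewrite nj0; have := leM _ (mj i0 j); have := leM _ qk; move: E; lia.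
      by rewrite nth_uniq // => /eqP/val_inj ej; rewrite ej eqxx in jj0.
    rewrite big1 ?addr0 // => i ii0; rewrite coef_sum big1 // => j _.
    rewrite coefZ coefXn; case: eqP => [E|_]; last by rewrite mulr0.
    have ne : nth 0%N k i != p.
      by rewrite -ni0; apply: contra ii0; rewrite nth_uniq // => /eqP/val_inj ->.
    have {}E : (M + p - q = M + nth 0%N k i - nth 0%N (del i k) j)%N := E.
    suff l0 : lap (orth_rows zs) (del j (del i k)) = 0 by rewrite /u l0 mulr0 mul0r.
    rewrite (del_rem 0%N (udel i)) // [X in rem _ X](del_rem 0%N uk) // others ?mi ?mj //.
      move: E (leM _ (mj i j)) (leM _ qk); move: (nth _ k i) (nth _ _ j) (M) => a a' M'.
      lia.
    by rewrite xpair_eqE (negPf ne).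
  apply: contra_neq nz => Qz; move: coefQ; rewrite Qz coef0 /u => /esym/eqP.
  rewrite !mulf_eq0 !signr_eq0 /= (del_rem 0%N (s := del i0 k)) // nj0 di0 => /eqP.
  exact.
(* The factor ['X] ensures that [z] is nonzero. *)
have [z] : exists z, ('X * Q).[z] != 0 by apply: poly_neq0_ex; rewrite mulf_neq0 ?polyX_eq0.
rewrite hornerM hornerX mulf_eq0 negb_or => /andP[z0 Qz]; exists z => //.
suff E : Q.[z] = z ^+ M * lap (orth_rows (z :: zs)) k.
  by apply: contra_neq Qz => E'; rewrite E E' mulr0.
rewrite /= mulr_sumr horner_sum; apply: eq_bigr => i _.
rewrite horner_sum !mulr_sumr; apply: eq_bigr => j _.
have le : (nth 0%N (del i k) j <= M + nth 0%N k i)%N by have := leM _ (mj i j); lia.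
have -> : u i j = (-1) ^+ i * (-1) ^+ j * lap (orth_rows zs) (del j (del i k)) by [].
rewrite hornerZ hornerXn; set a := nth _ _ i; set b := nth _ _ j.
have -> : z ^+ (M + a - b) = z ^+ M * z ^+ a * z ^- b.
  have zb : z ^+ b != 0 by rewrite expf_neq0.
  by apply: (mulIf zb); rewrite mulfVK // -!exprD subnK.
move: ((-1) ^+ i) ((-1) ^+ j) (z ^+ M) (z ^+ a) (z ^- b) (lap _ _) => v1 v2 v3 v4 v5 v6.
ring.
Qed.

End Laplace.

(** * Exponent sequences and their ends *)

Lemma all2_rcons (S T : Type) (r : S -> T -> bool) s t a b : size s = size t ->
  all2 r (rcons s a) (rcons t b) = all2 r s t && r a b.
Proof.
elim: s t => [|x s IH] [|y t] //=; first by rewrite andbT.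
by case=> st; rewrite IH // andbA.
Qed.

Lemma rem_rcons (T : eqType) (x y : T) s : x \notin s ->
  rem x (rcons s y) = if y == x then s else rcons s y.
Proof.
elim: s => [|a s IH] /=; first by case: eqP.
by rewrite inE negb_or eq_sym => /andP[/negPf -> /IH ->]; case: ifP.
Qed.

Lemma rem_rcons_rcons (T : eqType) (x y : T) s : x \notin s ->
  rem x (rcons (rcons s x) y) = rcons s y.
Proof.
elim: s => [|a s IH] /=; first by rewrite eqxx.
by rewrite inE negb_or eq_sym => /andP[/negPf -> /IH ->].
Qed.

Section Good.
Local Open Scope nat_scope.
Implicit Types (k mid : seq nat).

Definition sym_sum w k := all2 (fun a b => a + b == w) k (rev k).

Lemma sym_sum_ends w x mid y : sym_sum w (x :: rcons mid y) = (x + y == w) && sym_sum w mid.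
Proof.
rewrite /sym_sum rev_cons rev_rcons /= all2_rcons ?size_rev //.
by rewrite [y + x]addnC; case: (x + y == w); rewrite ?andbF ?andbT.
Qed.

Lemma sym_sum_inj w w' k : k != [::] -> sym_sum w k -> sym_sum w' k -> w = w'.
Proof.
case: k => // a s _; rewrite /sym_sum; case: (rev _) => [|b t] //=.
by move=> /andP[/eqP <- _] /andP[/eqP <- _].
Qed.

(** The negation of both alternatives of the criterion, for the exponents [beta]. Since [N - 1] is
    odd, an odd sum for [lam] is an even sum for [beta]. *)
Definition good k : Prop :=
  (forall b, ~~ all_par b k) /\ (forall w, ~~ odd w -> ~~ sym_sum w k).

Lemma all_par_ends b x mid y :
  all_par b (x :: rcons mid y) = [&& odd x == b, odd y == b & all_par b mid].
Proof. by rewrite /all_par /= all_rcons. Qed.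

Lemma good_ends x mid y : odd x != odd y -> good (x :: rcons mid y).
Proof.
move=> xy; split=> [b|w ow].
  by rewrite all_par_ends; case: b (odd x) (odd y) xy => [] [] [].
rewrite sym_sum_ends; apply: contra ow => /andP[/eqP <- _].
by rewrite oddD; case: (odd x) (odd y) xy => [] [].
Qed.

Definition dec k := pairwise gtn k.

Lemma dec_uniq k : dec k -> uniq k.
Proof. by apply: pairwise_uniq => n; rewrite /= ltnn. Qed.

Lemma dec_ends x mid y :
  dec (x :: rcons mid y) = [&& y < x, all (gtn x) mid, all (fun n => y < n) mid & dec mid].
Proof. by rewrite /dec /= all_rcons pairwise_rcons -andbA. Qed.

End Good.

Section NonVanishing.
Variable C : numFieldType.
Local Notation rows := (@orth_rows C).

Lemma lap_ends_neq0 x y : odd x != odd y -> lap (rows [::]) [:: x; y] != 0.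
Proof.
move=> xy; rewrite lap_pair -signr_odd -[(-1) ^+ x]signr_odd.
have n2 : (1 + 1 : C) != 0 by rewrite -[1 + 1]/(2%:R) pnatr_eq0.
by case: (odd x) (odd y) xy => [] [] // _; rewrite expr0 expr1 ?opprK // -opprD oppr_eq0.
Qed.

Lemma lap_good_step n k (p q : nat) :
  (forall k, size k = n.*2.+2 -> dec k -> good k ->
     exists zs, [/\ size zs = n, all (fun z => z != 0) zs & lap (rows zs) k != 0]) ->
  size k = n.*2.+4 -> dec k -> p \in k -> q \in k -> (q < p)%N -> good (rem q (rem p k)) ->
  (forall p' q' : nat, p' \in k -> q' \in k -> (p' + q = p + q')%N -> (p', q') != (p, q) ->
     exists b, all_par b (rem q' (rem p' k))) ->
  exists zs, [/\ size zs = n.+1, all (fun z => z != 0) zs & lap (rows zs) k != 0].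
Proof.
move=> IH sk dk pk qk qp gr others; have uk := dec_uniq dk.
have size2 (p' q' : nat) : p' \in k -> q' \in k -> q' != p' -> size (rem q' (rem p' k)) = n.*2.+2.
  move=> pk' qk' ne; rewrite size_rem; last by rewrite mem_rem_uniq // inE ne.
  by rewrite size_rem // sk.
have dr : dec (rem q (rem p k)).
  by apply: subseq_pairwise dk; apply: subseq_trans (rem_subseq _ _) (rem_subseq _ _).
have [zs [szs nzs nz]] := IH _ (size2 _ _ pk qk (negbT (ltn_eqF qp))) dr gr.
have [z z0 H] : exists2 z, z != 0 & lap (rows (z :: zs)) k != 0.
  apply: (lap_step uk pk qk qp nz) => p' q' pk' qk' E ne.
  have [b pb] := others _ _ pk' qk' E ne.
  apply: (@lap_all_par _ b); rewrite ?szs ?size2 //.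
  by apply/eqP => e; clear -E qp e; lia.
by exists (z :: zs); rewrite /= szs z0 nzs.
Qed.

(** With [k] written as [x > a > mid > e > y], one of the pairs [(x, y)], [(x, e)], [(a, y)],
    [(a, e)] can be removed: what is left is good, and every competing pair of the same difference
    leaves exponents of one parity or does not exist. *)
Lemma lap_good n k : size k = n.*2.+2 -> dec k -> good k ->
  exists zs, [/\ size zs = n, all (fun z => z != 0) zs & lap (rows zs) k != 0].
Proof.
elim: n k => [|n IH].
  move=> [|x [|y []]] // _ _ gk; exists [::]; split=> //; apply: lap_ends_neq0.
  apply/negP => /eqP xy; have [/(_ (odd x)) + _] := gk.
  by rewrite /all_par /= xy eqxx.
case=> [//|x k]; case/lastP: k => [//|mid y].
case: mid => [//|a mid]; case/lastP: mid => [//|mid e].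
set K := x :: _; move=> sK dK gK.
have smid : size mid = n.*2 by move: sK; rewrite /K /= !size_rcons doubleS => -[].
have uK := dec_uniq dK.
move: (dK); rewrite dec_ends => /and4P[yx /allP xm /allP ym]; rewrite dec_ends.
move=> /and4P[ea /allP am /allP em dm].
have {}xa : (a < x)%N by apply: xm; rewrite mem_head.
have {}ye : (y < e)%N by apply: ym; rewrite inE mem_rcons mem_head orbT.
have xk : x \in K by rewrite mem_head.
have ak : a \in K by rewrite !inE eqxx orbT.
have ek : e \in K by rewrite !inE mem_rcons inE mem_rcons inE eqxx !orbT.
have yk : y \in K by rewrite !inE mem_rcons inE eqxx !orbT.
have {xm ym} smem (p : nat) : p \in K -> [\/ p = x, p = y | [/\ p \in a :: rcons mid e, (p <= a)%N & (e <= p)%N]].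
  rewrite inE => /orP[/eqP|]; first by constructor 1.
  rewrite -rcons_cons mem_rcons inE => /orP[/eqP|pm]; first by constructor 2.
  constructor 3; split=> //; move: pm; rewrite inE mem_rcons inE.
    by case/or3P => [/eqP ->|/eqP ->|/am /ltnW //]; rewrite ?leqnn // ltnW.
  by case/or3P => [/eqP ->|/eqP ->|/em /ltnW //]; rewrite ?leqnn // ltnW.
have anm : a \notin mid by apply/negP => /am; rewrite /= ltnn.
have enm : e \notin mid by apply/negP => /em; rewrite ltnn.
have ynm : y \notin rcons mid e.
  by rewrite mem_rcons inE negb_or ltn_eqF //=; apply/negP => /em; rewrite ltnNge ltnW.
have rem_xy : rem y (rem x K) = a :: rcons mid e.
  rewrite /K /= eqxx -rcons_cons rem_rcons ?eqxx // inE negb_or ynm andbT ltn_eqF //.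
  exact: ltn_trans ea.
have rem_ay : rem y (rem a K) = x :: rcons mid e.
  rewrite /K /= gtn_eqF // eqxx /= gtn_eqF // rem_rcons // eqxx //.
have rem_xe : rem e (rem x K) = a :: rcons mid y.
  rewrite /K /= eqxx /= gtn_eqF // rem_rcons_rcons //.
have rem_ae : rem e (rem a K) = x :: rcons mid y.
  by rewrite /K /= gtn_eqF // eqxx /= gtn_eqF ?(ltn_trans ea) // rem_rcons_rcons.
have parx b (q : nat) : all_par b (a :: rcons mid e) -> odd y == b -> all_par b (rem q (rem x K)).
  move=> /allP pm py; apply/allP => n0 /mem_rem; rewrite mem_rem_uniq // inE => /andP[nx /smem].
  by case=> [E|->|[/pm]] //; rewrite E eqxx in nx.
have pary b (p : nat) : all_par b (a :: rcons mid e) -> odd x == b -> all_par b (rem y (rem p K)).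
  move=> /allP pm py; apply/allP => n0; rewrite mem_rem_uniq ?rem_uniq // inE => /andP[ny /mem_rem /smem].
  by case=> [->|E|[/pm]] //; rewrite E eqxx in ny.
have step := lap_good_step IH sK dK.
(* The difference [x - y] is the largest and occurs once. *)
have [gm|ngm] := pselect (good (a :: rcons mid e)).
  apply: (step x y) => //; rewrite ?rem_xy // => p q /smem Hp /smem Hq E /negP[].
  rewrite xpair_eqE; apply/andP; clear -Hp Hq E yx xa ye ea.
  by case: Hp => [?|?|[_ ? ?]]; case: Hq => [?|?|[_ ? ?]]; split; apply/eqP; lia.
have [[b pm]|npar] := pselect (exists b, all_par b (a :: rcons mid e)).
  have /and3P[/eqP oa /eqP oe pmid] : [&& odd a == b, odd e == b & all_par b mid].
    by rewrite -all_par_ends.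
  have npar : ~~ ((odd x == b) && (odd y == b)).
    have [/(_ b) + _] := gK; apply: contra => /andP[px py].
    by rewrite /K all_par_ends px py.
  have odd_diff (p q p' q' : nat) : (p + q = p' + q')%N -> odd p (+) odd q = odd p' (+) odd q'.
    by move=> E; rewrite -!oddD E.
  have pairP (p q p' q' : nat) : (p, q) != (p', q') -> p <> p' \/ q <> q'.
    by rewrite xpair_eqE negb_and => /orP[] /eqP; [left|right].
  (* Here [y] has the other parity, so removing [(x, e)] leaves ends of opposite parity. A competing
     pair must end in [y], and without [y] only parity [b] remains. *)
  have [/eqP px|px] := boolP (odd x == b).
    have py : odd y != b by move: npar; rewrite px eqxx.
    apply: (step x e) => //; rewrite ?rem_xe.
    - exact: ltn_trans xa.
    - by apply: good_ends; rewrite oa eq_sym.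
    move=> p q /smem Hp /smem Hq E /pairP ne; exists b.
    suff -> : q = y by apply: pary => //; rewrite px.
    clear -Hp Hq E ne xa ye ea yx.
    by case: Hq => [?|?|[_ ? ?]] //; case: Hp => [?|?|[_ ? ?]]; lia.
  have [/eqP py|py] := boolP (odd y == b).
    apply: (step a y) => //; rewrite ?rem_ay.
    - exact: ltn_trans ea.
    - by apply: good_ends; rewrite oe.
    move=> p q /smem Hp /smem Hq E /pairP ne; exists b.
    suff -> : p = x by apply: parx => //; rewrite py.
    clear -Hp Hq E ne xa ye ea yx.
    by case: Hp => [?|?|[_ ? ?]] //; case: Hq => [?|?|[_ ? ?]]; lia.
  (* Now neither end has parity [b]. The sign of [(x + y) - (a + e)] tells which of [a - y] and
     [x - e] is larger; the larger has no competitor. *)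
  have [lt|lt|eq] := ltngtP (x + y)%N (a + e)%N.
  - apply: (step a y) => //; rewrite ?rem_ay.
    + exact: ltn_trans ea.
    + by apply: good_ends; rewrite oe.
    move=> p q /smem Hp /smem Hq E /pairP ne; exfalso.
    clear -Hp Hq E ne xa ye ea yx lt.
    by case: Hp => [?|?|[_ ? ?]]; case: Hq => [?|?|[_ ? ?]]; lia.
  - apply: (step x e) => //; rewrite ?rem_xe.
    + exact: ltn_trans xa.
    + by apply: good_ends; rewrite oa eq_sym.
    move=> p q /smem Hp /smem Hq E /pairP ne; exfalso.
    clear -Hp Hq E ne xa ye ea yx lt.
    by case: Hp => [?|?|[_ ? ?]]; case: Hq => [?|?|[_ ? ?]]; lia.
  have oae : ~~ odd (a + e) by rewrite oddD oa oe addbb.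
  have nsym : forall w, ~~ sym_sum w (x :: rcons mid y).
    move=> w; rewrite sym_sum_ends; apply/negP => /andP[/eqP Ew sm].
    have [_ /(_ w)] := gK; rewrite -Ew eq => /(_ oae) /negP; apply.
    by rewrite /K !sym_sum_ends eq eqxx /= -eq Ew.
  (* The two differences coincide, so [(a, e)] is removed. Its difference is even, while pairs
     mixing an end with an inner exponent have odd difference, and [x - y] is too large. *)
  apply: (step a e) => //; rewrite ?rem_ae.
    split=> [b'|w _]; last exact: nsym.
    rewrite all_par_ends; apply/negP => /and3P[px' py' pm'].
    case: mid smid {sK dK gK K smem am em dm anm enm ynm rem_xy rem_ay rem_xe rem_ae
      parx pary step xk ak ek yk uK ngm pm} pmid nsym pm' => [|f mid] _ pmid nsym pm'.
      by have := nsym (x + y)%N; rewrite (@sym_sum_ends _ x [::] y) eqxx.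
    move: pmid pm' => /= /andP[/eqP fb _] /andP[/eqP fb' _].
    by move: px; rewrite (eqP px') -fb' fb eqxx.
  move=> p q /smem Hp /smem Hq E /pairP ne; exfalso.
  have par_in (r : nat) : r \in a :: rcons mid e -> odd r = b by move/(allP pm)/eqP.
  have := odd_diff _ _ _ _ E.
  case: Hp => [Ep|Ep|[/par_in op pa pe]]; case: Hq => [Eq|Eq|[/par_in oq qa qe]].
  - by clear -E Ep Eq ea; lia.
  - by clear -E Ep Eq ea xa ye; lia.
  - by rewrite Ep oa oe oq; move: px; clear; case: (odd x) b => [] [].
  - by clear -E Ep Eq ea yx; lia.
  - by clear -E Ep Eq ea; lia.
  - by clear -E Ep qe ea ye; lia.
  - by clear -E pa Eq ea xa; lia.
  - by rewrite op oa oe Eq; move: py; clear; case: (odd y) b => [] [].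
  - by clear -E ne pa qe; lia.
(* The inner sequence is symmetric with even sum [w] and of mixed parity, so [mid] is not empty. A
   symmetric sum of the remaining sequence is forced by [mid] to be [w], but its ends have another
   sum. *)
have [w ow sw] : exists2 w, ~~ odd w & sym_sum w (a :: rcons mid e).
  apply: contrapT => nsw; apply: ngm; split=> [b|w ow].
    by apply/negP => pb; apply: npar; exists b.
  by apply/negP => sw; apply: nsw; exists w.
have /andP[/eqP ae smw] : (a + e == w)%N && sym_sum w mid by rewrite -sym_sum_ends.
have oae : odd a = odd e.
  by move: ow; rewrite -ae oddD; case: (odd a) (odd e) => [] [].
have mid0 : mid != [::].
  apply/eqP => m0; apply: npar; exists (odd a).
  by rewrite all_par_ends eqxx -oae eqxx m0.
have neq : (x + y != w)%N.
  have [_ /(_ w ow)] := gK; apply: contra => /eqP e'.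
  by rewrite /K sym_sum_ends e' eqxx.
have [lt|lt|eq] := ltngtP (x + y)%N (a + e)%N; last by rewrite eq ae eqxx in neq.
- apply: (step a y) => //; rewrite ?rem_ay.
  + exact: ltn_trans ea.
  + split=> [b|w' _]; rewrite ?sym_sum_ends ?all_par_ends; apply/negP.
      move=> /and3P[_ pe pm]; apply: npar; exists b.
      by rewrite all_par_ends oae pe pm.
    move=> /andP[/eqP xe /(sym_sum_inj mid0 smw) ww].
    by clear -xe ww ae xa; lia.
  move=> p q /smem Hp /smem Hq E; rewrite xpair_eqE negb_and => /orP ne; exfalso.
  have {}ne : p <> a \/ q <> y by case: ne => /eqP; [left|right].
  clear -Hp Hq E ne xa ye ea yx lt.
  by case: Hp => [?|?|[_ ? ?]]; case: Hq => [?|?|[_ ? ?]]; lia.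
apply: (step x e) => //; rewrite ?rem_xe.
- exact: ltn_trans xa.
- split=> [b|w' _]; rewrite ?sym_sum_ends ?all_par_ends; apply/negP.
    move=> /and3P[pa _ pm]; apply: npar; exists b.
    by rewrite all_par_ends -oae pa pm.
  move=> /andP[/eqP ay /(sym_sum_inj mid0 smw) ww].
  by clear -ay ww ae ye; lia.
move=> p q /smem Hp /smem Hq E; rewrite xpair_eqE negb_and => /orP ne; exfalso.
have {}ne : p <> x \/ q <> e by case: ne => /eqP; [left|right].
clear -Hp Hq E ne xa ye ea yx lt.
by case: Hp => [?|?|[_ ? ?]]; case: Hq => [?|?|[_ ? ?]]; lia.
Qed.

End NonVanishing.

(** * Orthogonal matrices with prescribed spectrum *)

(** Matches the positions of [z] and [1/z] in [orth_eigs] and fixes those of 1 and -1. *)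
Definition swap_pairs r i : nat := if (i < r.*2)%N then (if odd i then i.-1 else i.+1) else i.

Lemma swap_pairs_lt r i : (i < r.*2.+2 -> swap_pairs r i < r.*2.+2)%N.
Proof. by rewrite /swap_pairs; case: ifP => // ir; case: ifP => // _; lia. Qed.

Lemma swap_pairsK r : involutive (swap_pairs r).
Proof.
move=> i; rewrite /swap_pairs.
case: (ltnP i r.*2) => ir; last by rewrite ltnNge ir.
have [oi|oi] := boolP (odd i).
  have i0 : (0 < i)%N by case: (posnP i) oi => [->|].
  have -> : (i.-1 < r.*2)%N by lia.
  by rewrite -subn1 oddB // oi /= subn1 prednK.
have -> : (i.+1 < r.*2)%N.
  rewrite ltn_neqAle ir andbT; apply/eqP => e.
  by have := congr1 odd e; rewrite /= oi odd_double.
by rewrite /= oi.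
Qed.

Lemma swap_pairsSS r i : swap_pairs r.+1 i.+2 = (swap_pairs r i).+2.
Proof.
rewrite /swap_pairs (_ : (i.+2 < r.+1.*2)%N = (i < r.*2)%N) // oddS oddS negbK.
case: ifP => // _; have [oi|//] := boolP (odd i).
by case: i oi.
Qed.

Section OrthogonalElement.
Variable C : numClosedFieldType.

Fixpoint orth_eigs (zs : seq C) : seq C :=
  if zs is z :: zs' then [:: z, z^-1 & orth_eigs zs'] else [:: 1; -1].

Lemma size_orth_eigs zs : size (orth_eigs zs) = (size zs).*2.+2.
Proof. by elim: zs => //= z zs ->. Qed.

Lemma orth_rowsE zs i n : (i < (size zs).*2.+2)%N ->
  nth (fun=> 0) (orth_rows zs) i n = nth 0 (orth_eigs zs) i ^+ n.
Proof.
elim: zs i => [|z zs IH] [|[|i]] //=; rewrite ?expr1n ?exprVn //.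
by rewrite doubleS !ltnS; exact: IH.
Qed.

Lemma orth_eigs_swap zs i : all (fun z => z != 0) zs -> (i < (size zs).*2.+2)%N ->
  nth 0 (orth_eigs zs) i * nth 0 (orth_eigs zs) (swap_pairs (size zs) i) = 1.
Proof.
elim: zs i => [|z zs IH] [|[|i]] //.
- by rewrite /= mulr1.
- by rewrite /= mulrNN mulr1.
- by move=> /= /andP[z0 _] _; rewrite mulfV.
- by move=> /= /andP[z0 _] _; rewrite mulVf.
by rewrite swap_pairsSS => /= /andP[_ nz] lt; apply: IH.
Qed.

Lemma prod_orth_eigs zs : all (fun z => z != 0) zs -> \prod_(z <- orth_eigs zs) z = -1.
Proof.
elim: zs => [|z zs IH] /=; first by rewrite !big_cons big_nil mulr1 mul1r.
by move=> /andP[z0 /IH nz]; rewrite !big_cons nz mulrA mulfV // mul1r.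
Qed.

(** The diagonal matrix preserves the symmetric form [S] given by the permutation. A symmetric
    square root [P] of [S] carries this form to the standard one. *)
Lemma orth_conj_diag n (x : 'rV[C]_n) (s : 'S_n) : (forall i, s (s i) = i) ->
  (forall i, x 0 i * x 0 (s i) = 1) ->
  exists g P, [/\ orth g, P \in unitmx & P *m g = diag_mx x *m P].
Proof.
move=> ss xs; pose S : 'M[C]_n := perm_mx s; pose D := diag_mx x.
have SS : S *m S = 1%:M.
  rewrite -perm_mxM (_ : (s * s)%g = 1%g) ?perm_mx1 //.
  by apply/permP => i; rewrite permM perm1.
have St : S^T = S.
  apply/matrixP=> i j; rewrite !mxE; congr (_%:R); congr nat_of_bool.
  by apply/eqP/eqP => <-; rewrite ss.
have DSD : D *m S *m D = S.
  apply/matrixP=> i j; rewrite mul_mx_diag mul_diag_mx !mxE.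
  by have [<-|_] := eqVneq (s i) j; rewrite ?mulr1 ?mulr0 ?mul0r.
(* As [S] is an involution, the square of [S + i] is [2 i S]; [a] normalizes the factor. *)
pose a : C := sqrtC ((2 * 'i)^-1).
have aa : a * a * (2 * 'i) = 1.
  by rewrite -expr2 sqrtCK mulVf // mulf_neq0 ?neq0Ci ?pnatr_eq0.
pose P : 'M[C]_n := a *: (S + 'i%:M).
have Pt : P^T = P by rewrite linearZ /= linearD /= St tr_scalar_mx.
have PP : P *m P = S.
  have ii : 'i%:M *m 'i%:M = - 1%:M :> 'M[C]_n by rewrite -scalar_mxM -expr2 sqrCi raddfN.
  rewrite /P -scalemxAl -scalemxAr scalerA mulmxDl !mulmxDr SS ii.
  rewrite mul_mx_scalar mul_scalar_mx addrA -(addrA 1%:M) addrC addKr.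
  by rewrite -scalerDl scalerA -mulr2n -(mulr_natl 'i) aa scale1r.
have [Su _] := mulmx1_unit SS.
have Pu : P \in unitmx by move: Su; rewrite -PP unitmx_mul => /andP[].
exists (invmx P *m D *m P), P; split=> //; last by rewrite !mulmxA mulmxV // mul1mx.
rewrite /orth !trmx_mul trmx_inv tr_diag_mx Pt !mulmxA.
rewrite -(mulmxA (invmx P *m D)) PP -(mulmxA (invmx P)) -(mulmxA (invmx P)) DSD -PP.
by rewrite mulKmx // mulmxV.
Qed.

End OrthogonalElement.

(** * The twist criterion *)

Lemma castmx_conj (A : comNzRingType) d m (e : d = m) :
  exists (E : 'M[A]_(m, d)) (F : 'M[A]_(d, m)), [/\ E *m F = 1%:M, F *m E = 1%:M &
    forall M : 'M[A]_d, castmx (e, e) M = E *m M *m F].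
Proof.
case: m / e; exists 1%:M, 1%:M; split; rewrite ?mulmx1 // => M.
by rewrite castmx_id mul1mx mulmx1.
Qed.

Lemma rep_tens_det (F : fieldType) N d (V : 'M[F]_N -> 'M[F]_d) :
  exists (E : 'M[F]_(d * 1, d)) (E' : 'M[F]_(d, d * 1)), [/\ E *m E' = 1%:M, E' *m E = 1%:M &
    forall g, rep_tens V det_rep g = \det g *: (E *m V g *m E')].
Proof.
have [E [E' [EE' E'E cE]]] := castmx_conj F (esym (muln1 d)).
exists E, E'; split=> // g; rewrite /rep_tens /det_rep tens_mx_scalar cE.
by rewrite -scalemxAr -scalemxAl.
Qed.

Lemma polynomial_rep_theta (F : fieldType) N d (V : 'M[F]_N -> 'M[F]_d) : polynomial_rep V ->
  exists K (c : 'I_d -> 'I_d -> 'M[F]_#|tensidx N K|),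
    forall g, g \in unitmx -> V g = linmap c (theta K g).
Proof.
move=> [p Hp].
pose deg i j := (\max_(m <- mpoly.msupp (p i j)) \sum_k mpoly.fun_of_multinom m k)%N.
pose K := (\max_i \max_j deg i j)%N.
have leK i j : (deg i j <= K)%N.
  by apply: leq_trans (leq_bigmax i); exact: (leq_bigmax j).
have /choice[c Hc] : forall ij : 'I_d * 'I_d, exists cij : 'M[F]_#|tensidx N K|, forall g : 'M[F]_N,
    mpoly.meval (fun k => mxvec g 0 k) (p ij.1 ij.2) = \sum_a \sum_b cij a b * theta K g a b.
  by move=> ij; exact: mpoly_theta (leK ij.1 ij.2).
exists K, (fun i j => c (i, j)) => g gu; apply/matrixP=> i j.
by rewrite (Hp g gu) (Hc (i, j)) mxE.
Qed.

Lemma upper_uni_unit (F : fieldType) n (u : 'M[F]_n) : upper_uni u -> u \in unitmx.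
Proof.
move=> Hu; rewrite -unitmx_tr unitmxE det_trig ?big1 ?unitr1 // => [i _|].
  by rewrite mxE Hu // eqxx.
apply/is_trig_mxP => i j ij; rewrite mxE Hu 1?ltnW //.
by rewrite (_ : (j == i) = false) //; apply: gtn_eqF.
Qed.

Lemma size_orth_rows (C : numFieldType) (zs : seq C) : size (orth_rows zs) = (size zs).*2.+2.
Proof. by elim: zs => //= z zs ->. Qed.

Lemma sym_sum_nth w k i : sym_sum w k -> (i < size k)%N ->
  (nth 0 k i + nth 0 k (size k - i.+1) = w)%N.
Proof.
move=> sk ik; rewrite -nth_rev //; move: sk; rewrite /sym_sum.
have : size (rev k) = size k by rewrite size_rev.
move: (rev k) => t; elim: k t i ik => [|a k IH] [|b t] [|i] //= ik [st] /andP[/eqP ab H] //.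
exact: IH.
Qed.

Section Main.
Variables (C : numClosedFieldType) (r N : nat).
Hypothesis hN : N = (2 * r + 2)%N.
Variables (lam : 'I_N -> nat) (d : nat) (V : 'M[C]_N -> 'M[C]_d).
Hypothesis hlam : is_partition lam.
Hypothesis hV : irr_poly_rep_of_highest_weight lam V.

Let N2 : N = r.*2.+2. Proof. by rewrite hN mul2n addn2. Qed.

Lemma twist_iff : rep_iso Omx V (rep_tens V det_rep) <->
  (forall i j : 'I_N, odd (beta lam i) = odd (beta lam j)) \/
  (exists w : nat, odd w /\ forall i : 'I_N, (lam i + lam (rev_ord i))%N = w).
Proof.
have [[V1 VM] /polynomial_rep_theta[K [c Vc]] [d0 Virr] [v [v0 vup vtor]]] := hV.
pose W := polymap c; have VW g : g \in unitmx -> V g = W g by exact: Vc.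
have W1 : W 1%:M = 1%:M by rewrite -VW ?unitmx1.
have WM g h : W (g *m h) = W g *m W h.
  apply: polymapM => g1 h1 gu hu.
  by have := VM _ _ gu hu; rewrite !VW // unitmx_mul gu.
have irrW (S : 'cV[C]_d -> Prop) : S 0 -> (forall a u v, S u -> S v -> S (a *: u + v)) ->
    (forall g w, g \in unitmx -> S w -> S (W g *m w)) ->
    forall w0, w0 != 0 -> S w0 -> forall w, S w.
  move=> S0 SD SW w0 w0n Sw0 w; have [U HU] := vspace_of_prop S0 SD.
  have [g gu u /HU Su|U0|Uf] := Virr U.
  - by apply/HU; rewrite VW //; exact: SW.
  - by case/eqP: w0n; apply/eqP; rewrite -memv0 -U0; apply/HU.
  - by apply/HU; rewrite Uf memvf.
have v_upper (u : 'M_N) : upper_uni u -> W u *m v = v.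
  move=> Hu; rewrite -VW ?upper_uni_unit // vup //.
  by apply/forallP => i; apply/forallP => j; apply/implyP => ji; rewrite Hu.
have v_torus (t : 'rV_N) : (forall i, t 0 i != 0) -> W (diag_mx t) *m v = monom t lam *: v.
  move=> t0; rewrite -VW ?vtor // unitmxE det_diag unitfE.
  by apply/prodf_neq0 => i _; exact: t0.
have weyl x : vdm x * char c x = alternant x (beta lam).
  rewrite charE; apply: (@weyl_formula _ _ _ (char_coef c) lam).
  - by move=> y gy; rewrite -[wsum _ y]charE; apply: (radial_equation W1 WM irrW v0 v_upper v_torus).
  - by move=> y; rewrite -[wsum _ y]charE; apply: (sum_char1 W1 WM irrW v0 v_torus).
  - move=> h w hd mw; apply: (highest_weight_max W1 WM irrW v0 v_upper v_torus hd).
    by apply: contraNneq mw => P0; rewrite /char_coef P0 mxtrace0.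
  - exact: (highest_weight_wt W1 WM irrW v0 v_upper v_torus).
  - by move=> s y; rewrite -![wsum _ _]charE char_sym.
  - exact: hlam.
have N0 : (0 < N)%N by rewrite N2.
have Ou g : orth g -> g \in unitmx by move=> /mulmx1_unit[].
have OmxE g : (g \in Omx) = (g *m g^T == 1%:M) by [].
have [E [E' [EE' E'E tensE]]] := rep_tens_det V.
split=> [[P [Q [PQ QP iso]]]|RHS].
  have tr0 g : orth g -> \det g = -1 -> \tr (W g) = 0.
    move=> Og dg; have := iso g; rewrite OmxE => /(_ (introT eqP Og)) H.
    have : \tr (V g) = - \tr (V g).
      rewrite -{1}[V g]mul1mx -QP -mulmxA H mulmxA mxtrace_mulC mulmxA PQ mul1mx tensE dg.
      by rewrite scaleN1r raddfN /= mxtrace_mulC mulmxA E'E mul1mx.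
    by rewrite VW ?Ou // => /eqP; rewrite -addr_eq0 -mulr2n mulrn_eq0 => /eqP.
  pose ks := [seq beta lam i | i <- enum 'I_N].
  have sks : size ks = r.*2.+2 by rewrite size_map size_enum_ord.
  (* The spectrum is realized by an orthogonal element of determinant -1, where the trace vanishes;
     the Weyl formula then makes the alternant vanish. *)
  have lap0 zs : size zs = r -> all (fun z => z != 0) zs -> lap (@orth_rows C zs) ks = 0.
    move=> szs nz.
    have szN : (size zs).*2.+2 = N by rewrite szs N2.
    have slt (i : 'I_N) : (swap_pairs r i < N)%N by have := @swap_pairs_lt r i; rewrite -N2; apply.
    pose f (i : 'I_N) := Ordinal (slt i).
    have ff : involutive f by move=> i; apply/val_inj; exact: swap_pairsK.
    pose s : 'S_N := perm (inv_inj ff).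
    pose x : 'rV[C]_N := \row_i nth 0 (orth_eigs zs) i.
    have [|i|g [Pm [Og Pu Pg]]] := @orth_conj_diag C N x s.
    + by move=> i; rewrite !permE.
    + by rewrite permE !mxE /= -szs orth_eigs_swap // szN.
    have dx : \prod_i x 0 i = -1.
      rewrite -(prod_orth_eigs nz) (big_nth 0) size_orth_eigs szN big_mkord.
      by apply: eq_bigr => i _; rewrite mxE.
    have dg : \det g = -1.
      have := congr1 determinant Pg; rewrite !det_mulmx det_diag dx mulrC.
      by apply: mulIf; rewrite -unitfE -unitmxE.
    have cx : char c x = 0 by rewrite /char -(trW_conj W1 WM Pu Pg) tr0.
    have := weyl x; rewrite cx mulr0 => alt0.
    rewrite (@lap_det C N) ?sks // -?N2 //; last by rewrite size_orth_rows.
    rewrite [RHS]alt0; congr (\det _); apply/matrixP=> i j; rewrite !mxE.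
    by rewrite orth_rowsE ?szN // (nth_map i) ?size_enum_ord // nth_ord_enum.
  have dks : dec ks.
    have : pairwise ltn (map val (enum 'I_N)).
      by rewrite val_enum_ord -sorted_pairwise ?iota_ltn_sorted //; exact: ltn_trans.
    rewrite /dec !pairwise_map; apply: sub_pairwise => i j /= ij.
    by rewrite /beta; have := hlam (ltnW ij); have := ltn_ord j; lia.
  have ngood : ~ good ks.
    move=> gk; have [zs [szs nz]] := lap_good C sks dks gk.
    by rewrite lap0 // eqxx.
  have beta_nth (i : 'I_N) : nth 0%N ks i = beta lam i.
    by rewrite (nth_map i) ?size_enum_ord // nth_ord_enum.
  have [[b pb]|npar] := pselect (exists b, all_par b ks).
    left=> i j; have oi (l : 'I_N) : odd (beta lam l) = b.
      by apply/eqP; move/allP: pb; apply; apply/mapP; exists l; rewrite ?mem_enum.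
    by rewrite !oi.
  right; have [w ow sw] : exists2 w, ~~ odd w & sym_sum w ks.
    apply: contrapT => nsw; apply: ngood; split=> [b|w ow].
      by apply/negP => pb; apply: npar; exists b.
    by apply/negP => sw; apply: nsw; exists w.
  have bsum (i : 'I_N) : (beta lam i + beta lam (rev_ord i) = w)%N.
    have := sym_sum_nth sw (i := i); rewrite sks -N2 => /(_ (ltn_ord i)).
    rewrite beta_nth => <-; congr (_ + _)%N; rewrite -beta_nth; congr nth.
  (* The two staircase entries at [i] and [rev_ord i] add up to [N - 1], which is odd, so the parity
     of the sum changes. *)
  exists (w - N.-1)%N; split.
    rewrite oddB; last by rewrite -(bsum (Ordinal N0)) /beta /=; lia.
    by rewrite (negPf ow) N2 /= odd_double.
  by move=> i; rewrite -(bsum i) /beta /=; have := ltn_ord i; lia.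
have tr0 g : orth g -> \det g = -1 -> \tr (W g) = 0.
  move=> Og dg; case: RHS => [par|[w [ow lw]]].
    by apply: (trW_same_parity N0 W1 WM weyl) => //; rewrite N2 /= odd_double.
  exact: (trW_symmetric N0 W1 WM weyl ow lw).
have [R Ru RS] := unitarizable d0 W1 WM irrW.
pose rho g := R *m W g *m invmx R.
have [||||T Tu HT] := @twist_of_trace C N d rho.
- by rewrite /rho W1 mulmx1 mulmxV.
- by move=> g h _ _; rewrite /rho WM !mulmxA mulmxKV.
- by move=> g Og; rewrite /rho RS // Ou.
- by move=> g Og dg; rewrite /rho mxtrace_mulC mulmxA mulVmx // mul1mx tr0.
pose T' := invmx R *m T *m R.
have T'W g : orth g -> T' *m W g = \det g *: (W g *m T').
  move=> Og; have := HT g Og => /(congr1 (fun M => invmx R *m M *m R)).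
  rewrite /rho !mulmxA mulmxKV // -scalemxAr -scalemxAl !mulmxA mulVmx // mul1mx => ->.
  by rewrite /T' ?mulmxA.
have T'u : T' \in unitmx by rewrite !unitmx_mul unitmx_inv Ru Tu.
exists (E *m T'), (invmx T' *m E'); split.
- by rewrite mulmxA mulmxK.
- by rewrite -mulmxA (mulmxA E') E'E mul1mx mulVmx.
move=> g; rewrite OmxE => /eqP Og; rewrite tensE !VW ?Ou // -mulmxA T'W // -scalemxAr -scalemxAl.
by rewrite -!mulmxA (mulmxA E') E'E mul1mx.
Qed.

End Main.

Theorem corollary8p7 (R : realType) (r N : nat) (hr : (1 <= r)%N)
  (hN : N = (2 * r + 2)%N) (lam : 'I_N -> nat) (hlam : is_partition lam)
  (d : nat) (V : 'M[complex R]_N -> 'M[complex R]_d)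
  (hV : irr_poly_rep_of_highest_weight lam V) :
  rep_iso Omx V (rep_tens V det_rep) <->
  (forall i j : 'I_N, odd (beta lam i) = odd (beta lam j)) \/
  (exists w : nat, odd w /\
     forall i : 'I_N, (lam i + lam (rev_ord i))%N = w).
Proof. exact: (twist_iff hN hlam hV). Qed.
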